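(* Let $\Omega\subset\mathbf{R}^2$ be a convex bounded domain whose boundary $\gamma=\partial\Omega$ is a smooth simple closed curve with curvature $k$ satisfying $0<\beta<k_{\min}:=\min_\gamma k$, and put $r=1/\beta$. Suppose the two-sided magnetic billiard in $\Omega$ with magnetic field of magnitude $\beta$ admits a non-constant polynomial integral $(\Phi_1,\Phi_2)$. Then for any point $Q\in\mathbf{C}^2$, every local branch at $Q$ of the (complex algebraic closures of the) parallel curves $\gamma_{+r},\gamma_{-r}$ has Puiseux index $\ge 2$; i.e. no such branch is sub-quadratic.
   Context: Two-sided magnetic billiard: a particle moves with unit speed in $\Omega$; between collisions it moves along a Larmor circle of radius $r=1/\beta$; after each collision with $\gamma$ (reflection by the law of geometric optics) the sign of the magnetic field changes, so the orientation of the Larmor circles alternates between counterclockwise (positive) and clockwise (negative). Equivalently, take two copies $\Omega_1,\Omega_2$ of $\Omega$ glued along $\gamma$, with field $+\beta$ on $\Omega_1$ (positive Larmor circles) and $-\beta$ on $\Omega_2$ (negative Larmor circles). A polynomial integral is a pair of functions $\Phi_1,\Phi_2$ on the unit tangent bundle $T_1\Omega$ of the form $\Phi_i(x,v)=\sum_{k+l=0}^N a^{(i)}_{kl}(x)v_1^kv_2^l$ with coefficients continuous up to the boundary, such that (1) $\Phi_1$, resp. $\Phi_2$, is constant along unit tangent vectors of positive, resp. negative, Larmor circles; (2) for every $z\in\gamma$ and unit $v\in T_z\Omega$, $\Phi_1(z,v)=\Phi_2(z,v-2\langle n,v\rangle n)$, where $n$ is the inward unit normal at $z$. Parallel curves: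 with $\gamma(s)$ the arc-length parametrization in counterclockwise direction and $J$ the counterclockwise rotation by $\pi/2$, $\gamma_{\pm r}(s)=\gamma(s)\pm rJ\dot\gamma(s)$. Under the hypothesis of the theorem these curves are real algebraic, and one considers their Zariski closures in $\mathbf{C}^2$. Puiseux index: every local branch of a plane algebraic curve at a point can, in suitable affine coordinates centered at the point, be parametrized as $t\mapsto (t^q, c\,t^p(1+o(1)))$ as $t\to0$, with $p,q\in\mathbf{N}$, $1\le q<p$, $c\neq0$; the number $p/q$ is its Puiseux index; the branch is quadratic if $p/q=2$ and sub-quadratic if $p/q<2$. *)

(* Defs.v *)
From Stdlib Require Import Reals Lra List.
From Coquelicot Require Import Coquelicot.
Open Scope R_scope.

Definition pt : Type := (R * R)%type.
Definition dist2 (p q : pt) : R :=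
  sqrt ((fst p - fst q) ^ 2 + (snd p - snd q) ^ 2).
Definition padd (p q : pt) : pt := (fst p + fst q, snd p + snd q).
Definition pscal (a : R) (p : pt) : pt := (a * fst p, a * snd p).
Definition dot (p q : pt) : R := fst p * fst q + snd p * snd q.
Definition Jrot (v : pt) : pt := (- snd v, fst v).
Definition unit_vec (v : pt) : Prop := fst v ^ 2 + snd v ^ 2 = 1.
Definition reflect_vec (n v : pt) : pt := padd v (pscal (- (2 * dot n v)) n).

Definition smooth_fun (f : R -> R) : Prop := forall (n : nat) (s : R), ex_derive (Derive_n f n) s.
Definition d1 (g : R -> pt) (s : R) : pt :=
  (Derive (fun u => fst (g u)) s, Derive (fun u => snd (g u)) s).
Definition d2 (g : R -> pt) (s : R) : pt :=
  (Derive_n (fun u => fst (g u)) 2 s, Derive_n (fun u => snd (g u)) 2 s).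
(** signed curvature of an arc-length parametrized curve *)
Definition curvature (g : R -> pt) (s : R) : R :=
  fst (d1 g s) * snd (d2 g s) - snd (d1 g s) * fst (d2 g s).

Definition smooth_simple_closed_arclength (g : R -> pt) (L : R) : Prop :=
  0 < L /\
  smooth_fun (fun u => fst (g u)) /\ smooth_fun (fun u => snd (g u)) /\
  (forall s, g (s + L) = g s) /\
  (forall s1 s2, 0 <= s1 < L -> 0 <= s2 < L -> g s1 = g s2 -> s1 = s2) /\
  (forall s, unit_vec (d1 g s)).

Definition parallel_curve (g : R -> pt) (rr : R) (s : R) : pt :=
  padd (g s) (pscal rr (Jrot (d1 g s))).

Definition is_open2 (O : pt -> Prop) : Prop :=
  forall x, O x -> exists e, 0 < e /\ forall y, dist2 x y < e -> O y.
Definition bounded2 (O : pt -> Prop) : Prop :=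
  exists M, forall x, O x -> dist2 x (0, 0) <= M.
Definition convex2 (O : pt -> Prop) : Prop :=
  forall x y t, O x -> O y -> 0 <= t <= 1 ->
    O (padd x (pscal t (padd y (pscal (-1) x)))).
Definition in_closure2 (O : pt -> Prop) (x : pt) : Prop :=
  forall e, 0 < e -> exists y, O y /\ dist2 x y < e.

(** Omega is a convex bounded domain bounded by gamma, with gamma oriented
    counterclockwise, i.e. J gamma' is the inward unit normal. *)
Definition convex_domain_bounded_by (O : pt -> Prop) (g : R -> pt) : Prop :=
  is_open2 O /\ bounded2 O /\ convex2 O /\ (exists x, O x) /\
  (forall x, (in_closure2 O x /\ ~ O x) <-> exists s, g s = x) /\
  (forall s, exists e0, 0 < e0 /\
       forall e, 0 < e < e0 -> O (padd (g s) (pscal e (Jrot (d1 g s))))).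

Definition larmor_pos_x (beta : R) (c : pt) (th t : R) : pt :=
  (fst c + / beta * cos (beta * t + th), snd c + / beta * sin (beta * t + th)).
Definition larmor_pos_v (beta : R) (c : pt) (th t : R) : pt :=
  (- sin (beta * t + th), cos (beta * t + th)).
Definition larmor_neg_x (beta : R) (c : pt) (th t : R) : pt :=
  (fst c + / beta * cos (- beta * t + th), snd c + / beta * sin (- beta * t + th)).
Definition larmor_neg_v (beta : R) (c : pt) (th t : R) : pt :=
  (sin (- beta * t + th), - cos (- beta * t + th)).

Definition polyPhi (a : nat -> nat -> pt -> R) (N : nat) (x v : pt) : R :=
  sum_f_R0 (fun k => sum_f_R0 (fun l => a k l x * fst v ^ k * snd v ^ l) (N - k)) N.

Definition coeffs_continuous_up_to_boundary (O : pt -> Prop) (a : nat -> nat -> pt -> R)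
  (N : nat) : Prop :=
  forall k l, (k + l <= N)%nat -> forall x, in_closure2 O x ->
    forall e, 0 < e -> exists d, 0 < d /\ forall y, in_closure2 O y -> dist2 x y < d ->
      Rabs (a k l y - a k l x) < e.

Definition polynomial_integral (beta : R) (g : R -> pt) (O : pt -> Prop)
  (N : nat) (a1 a2 : nat -> nat -> pt -> R) : Prop :=
  coeffs_continuous_up_to_boundary O a1 N /\
  coeffs_continuous_up_to_boundary O a2 N /\
  (forall c th t1 t2, t1 <= t2 -> (forall t, t1 <= t <= t2 -> O (larmor_pos_x beta c th t)) ->
     polyPhi a1 N (larmor_pos_x beta c th t1) (larmor_pos_v beta c th t1)
     = polyPhi a1 N (larmor_pos_x beta c th t2) (larmor_pos_v beta c th t2)) /\
  (forall c th t1 t2, t1 <= t2 -> (forall t, t1 <= t <= t2 -> O (larmor_neg_x beta c th t)) ->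
     polyPhi a2 N (larmor_neg_x beta c th t1) (larmor_neg_v beta c th t1)
     = polyPhi a2 N (larmor_neg_x beta c th t2) (larmor_neg_v beta c th t2)) /\
  (forall s v, unit_vec v ->
     polyPhi a1 N (g s) v = polyPhi a2 N (g s) (reflect_vec (Jrot (d1 g s)) v)).

Definition nonconstant_pair (O : pt -> Prop) (N : nat) (a1 a2 : nat -> nat -> pt -> R) : Prop :=
  ~ (exists c1 c2, forall x v, O x -> unit_vec v ->
        polyPhi a1 N x v = c1 /\ polyPhi a2 N x v = c2).

Definition cpt : Type := (C * C)%type.
(** a polynomial in two variables: list of monomials (i, j, coef) = coef z1^i z2^j *)
Definition poly2 : Type := list (nat * nat * C).
Definition eval_poly2 (P : poly2) (z : cpt) : C :=
  fold_right (fun m acc =>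
    Cplus acc (Cmult (snd m) (Cmult (Cpow (fst z) (fst (fst m))) (Cpow (snd z) (snd (fst m))))))
    (RtoC 0) P.
Definition embedC (p : pt) : cpt := (RtoC (fst p), RtoC (snd p)).
Definition zariski_closure (S : pt -> Prop) (z : cpt) : Prop :=
  forall P : poly2, (forall p, S p -> eval_poly2 P (embedC p) = RtoC 0) ->
    eval_poly2 P z = RtoC 0.
Definition curve_image (g : R -> pt) (p : pt) : Prop := exists s, g s = p.

Definition C_differentiable_at (f : C -> C) (z : C) : Prop :=
  exists l : C, forall e, 0 < e -> exists d, 0 < d /\ forall w, 0 < Cmod (Cminus w z) < d ->
    Cmod (Cminus (Cminus (f w) (f z)) (Cmult l (Cminus w z))) <= e * Cmod (Cminus w z).

(** phi is a parametrization (holomorphic on a disc around 0) of a piece of a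
    local branch at Q of the set Z, which in affine coordinates
    A(z) = M (z - Q), det M <> 0, takes the Puiseux form
    t |-> (t^q, c t^p (1 + o(1))), 1 <= q < p, c <> 0. *)
Definition puiseux_branch (Z : cpt -> Prop) (Q : cpt) (phi : C -> cpt) (q p : nat) : Prop :=
  (1 <= q)%nat /\ (q < p)%nat /\
  exists rho, 0 < rho /\
  (forall t, Cmod t < rho ->
     C_differentiable_at (fun u => fst (phi u)) t /\
     C_differentiable_at (fun u => snd (phi u)) t /\ Z (phi t)) /\
  exists (m11 m12 m21 m22 c : C) (h : C -> C),
    Cminus (Cmult m11 m22) (Cmult m12 m21) <> RtoC 0 /\ c <> RtoC 0 /\
    (forall t, Cmod t < rho ->
       Cplus (Cmult m11 (Cminus (fst (phi t)) (fst Q))) (Cmult m12 (Cminus (snd (phi t)) (snd Q)))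
         = Cpow t q /\
       Cplus (Cmult m21 (Cminus (fst (phi t)) (fst Q))) (Cmult m22 (Cminus (snd (phi t)) (snd Q)))
         = Cmult c (Cmult (Cpow t p) (Cplus (RtoC 1) (h t)))) /\
    (forall e, 0 < e -> exists d, 0 < d /\ forall t, Cmod t < d -> Cmod (h t) < e).

(* Main.v *)
From HB Require structures.
From mathcomp Require ssreflect ssrfun ssrbool eqtype choice ssrnat seq fintype prime bigop ssralg poly polydiv separable Rstruct.
Require Import Defs.
From Stdlib Require Import Reals Lra Lia List Classical ClassicalEpsilon Arith.
From Coquelicot Require Import Coquelicot.
Import Defs.
Open Scope R_scope.

(** An integral is a polynomial of the Larmor centre: Phi1(x, v) = F1(x + r J v) and
    Phi2(x, v) = F2(x - r J v).  The reflection law then says that F1 and F2 agree at the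
    points g + r (e cos a n - sin a t) and g + r (- e cos a n - sin a t), which run along circles
    tangent to the two parallel curves at a = 0.  Comparing Taylor coefficients in a shows that
    F - c vanishes along g_e (e = 1 or -1) to some exact order k >= 1, and that its k-th normal
    derivative W satisfies W^3 l_{-e}^{2k} = C mu^{2k} l_e^k with mu = r * curvature,
    l_e = 1 - e mu, C <> 0.  Since the curvature of g_e is algebraic in a separable equation f of
    g_e, this becomes a polynomial identity and holds on the Zariski closure.  On a branch
    (t^q, Y(t)), Y ~ c t^p, with p < 2q, Cauchy estimates bound Y'' (in the variable X = t^q) by a
    multiple of t^{p-2q}, and Y'' is unbounded.  But Y(t) and Y(zeta t), zeta^q = 1, are distinct
    k-fold roots of F - c over the same X, so d_Y^k F = O(t^{pk}); for unbounded Y'' the identity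
    is then violated, because it bounds |d_Y^k F|^3 |Y''|^k from below. *)

(** F - c need not vanish simply along g_e; working with its exact order k there replaces factoring
    F. The cube in the relation comes from a differential equation. Both families of circles carry
    one and the same function of (s, a), so its leading jet A, of even order 2k, its s-derivative A'
    and the next jet satisfy one linear relation for each sign e; eliminating the next jet leaves 3
    mu (1 - mu^2) A' = 2k (1 + mu^2) mu' A. So A^3 is a constant times (mu / (1 - mu^2))^{2k}, and W
    is a constant times l_e^k A. The assumption p < 2q acts twice. With q < p it prevents q from
    dividing p, so some zeta has zeta^p <> 1 and the roots Y(t), Y(zeta t) differ; and it makes Y''
    unbounded, since a bounded Y'' would give Y = O(t^{2q}). The final comparison is that t^{3pk}
    t^{(p-2q)k} = t^{(4p-2q)k} tends to 0. The curvature of g_e contains the power 3/2 of the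
    squared gradient of f, so the relation becomes polynomial only after multiplication by its
    conjugate under a change of sign of the square root. *)

Inductive pexpr (K : Type) : Type :=
| PC (c : K) | PX | PY | PA (a b : pexpr K) | PM (a b : pexpr K).
Arguments PC {K}. Arguments PX {K}. Arguments PY {K}. Arguments PA {K}. Arguments PM {K}.

(** * Formal calculus on polynomial expressions in two variables *)

Section Pexpr.
Variables (K : Type) (zero one : K) (add mul : K -> K -> K).
Fixpoint pev (e : pexpr K) (x y : K) : K :=
  match e with
  | PC c => c | PX => x | PY => y
  | PA a b => add (pev a x y) (pev b x y)
  | PM a b => mul (pev a x y) (pev b x y)
  end.
(** Derivatives act on the syntax, so that one definition serves the real integral and its complex
    closure, with [pmap] passing between them. Expressions are not normalised; that equal values
    give equal derivatives is therefore a separate fact. *)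
Fixpoint pdx (e : pexpr K) : pexpr K :=
  match e with
  | PC _ => PC zero | PX => PC one | PY => PC zero
  | PA a b => PA (pdx a) (pdx b)
  | PM a b => PA (PM (pdx a) b) (PM a (pdx b))
  end.
Fixpoint pdy (e : pexpr K) : pexpr K :=
  match e with
  | PC _ => PC zero | PX => PC zero | PY => PC one
  | PA a b => PA (pdy a) (pdy b)
  | PM a b => PA (PM (pdy a) b) (PM a (pdy b))
  end.
Fixpoint psubst (e ex ey : pexpr K) : pexpr K :=
  match e with
  | PC c => PC c | PX => ex | PY => ey
  | PA a b => PA (psubst a ex ey) (psubst b ex ey)
  | PM a b => PM (psubst a ex ey) (psubst b ex ey)
  end.
Lemma pev_psubst e ex ey x y :
  pev (psubst e ex ey) x y = pev e (pev ex x y) (pev ey x y).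
Proof. induction e; simpl; congruence. Qed.
End Pexpr.
Arguments pev {K}. Arguments pdx {K}. Arguments pdy {K}. Arguments psubst {K}.

Fixpoint pmap {K L : Type} (h : K -> L) (e : pexpr K) : pexpr L :=
  match e with
  | PC c => PC (h c) | PX => PX | PY => PY
  | PA a b => PA (pmap h a) (pmap h b)
  | PM a b => PM (pmap h a) (pmap h b)
  end.

Notation evR := (pev Rplus Rmult).
Notation dxR := (pdx 0 1).
Notation dyR := (pdy 0 1).
Notation evC := (pev Cplus Cmult).
Notation dxC := (pdx (RtoC 0) (RtoC 1)).
Notation dyC := (pdy (RtoC 0) (RtoC 1)).

(** * Separable equations and multiple roots *)

Module PolyC.
Import HB.structures.
Import ssreflect ssrfun ssrbool eqtype choice ssrnat seq fintype prime bigop ssralg poly polydiv separable Rstruct.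
Import GRing.Theory.
(** A copy of [C] that carries MathComp's field structure. *)
Definition CF : Type := C.
HB.instance Definition _ := Choice.copy CF (R * R)%type.
Lemma CF1_neq_0 : (RtoC 1 : CF) != RtoC 0.
Proof. by apply/eqP => -[]; exact: R1_neq_R0. Qed.
HB.instance Definition _ := GRing.isZmodule.Build CF
  Cplus_assoc Cplus_comm Cplus_0_l (fun x => etrans (Cplus_comm _ _) (Cplus_opp_r x)).
HB.instance Definition _ := GRing.Zmodule_isComNzRing.Build CF
  Cmult_assoc Cmult_comm Cmult_1_l Cmult_plus_distr_r CF1_neq_0.
Definition invCF (x : CF) : CF := if x == (RtoC 0 : CF) then RtoC 0 else Cinv x.
Lemma mulVCF (x : CF) : x != 0%R -> (invCF x * x)%R = 1%R.
Proof.
move=> x0; rewrite /invCF ifN //; apply: Cinv_l; exact/eqP.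
Qed.
Lemma invCF0 : invCF 0%R = 0%R.
Proof. by rewrite /invCF eqxx. Qed.
HB.instance Definition _ := GRing.ComNzRing_isField.Build CF mulVCF invCF0.

Lemma natCF n : (n%:R : CF)%R = RtoC (INR n).
Proof.
elim: n => [//|n IH]; rewrite S_INR RtoC_plus -IH mulrS addrC //.
Qed.
Lemma natCF_eq0 n : ((n%:R : CF) == 0)%R = (n == 0%N).
Proof.
rewrite natCF; apply/eqP/eqP => [H|->//].
have : INR n = 0 by case: H.
by case: n {H} => // n /(INR_eq n.+1 0%N).
Qed.

(** The outer variable is y and the coefficients lie in C[x], so the derivative of the outer
    polynomial is d/dy and its size measures the degree in y alone. *)
Definition ev2 (P : {poly {poly CF}}) (x y : CF) : CF := (P.[y%:P].[x])%R.

Fixpoint bipoly_of (e : pexpr C) : {poly {poly CF}} :=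
  match e with
  | PC c => (c : CF)%:P%:P%R
  | PX => ('X)%:P%R
  | PY => 'X%R
  | PA a b => (bipoly_of a + bipoly_of b)%R
  | PM a b => (bipoly_of a * bipoly_of b)%R
  end.
Lemma ev2_bipoly_of e x y : ev2 (bipoly_of e) x y = evC e x y.
Proof.
rewrite /ev2; elim: e => [c|||a IHa b IHb|a IHa b IHb] /=.
- by rewrite !hornerC.
- by rewrite hornerC hornerX.
- by rewrite hornerX hornerC.
- by rewrite !hornerD IHa IHb.
- by rewrite !hornerM IHa IHb.
Qed.

Lemma pexpr_of_poly (p : {poly CF}) : exists e : pexpr C,
  (forall x y, evC e x y = p.[x]%R) /\ (forall x y, evC (dyC e) x y = RtoC 0).
Proof.
elim/poly_ind: p => [|p c [e [He1 He2]]].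
  by exists (PC (RtoC 0)); split=> // x y; rewrite horner0.
exists (PA (PM e PX) (PC c)); split=> x y /=.
  by rewrite He1 hornerMXaddC.
by rewrite He2; ring.
Qed.
(** Both clauses are carried through the same Horner induction, because [dyC] depends on the syntax
    produced and not only on its values. *)
Lemma pexpr_of_bipoly (P : {poly {poly CF}}) : exists e : pexpr C,
  (forall x y, evC e x y = ev2 P x y) /\ (forall x y, evC (dyC e) x y = ev2 P^`()%R x y).
Proof.
rewrite /ev2; elim/poly_ind: P => [|P c [e [He1 He2]]].
  by exists (PC (RtoC 0)); split=> x y; rewrite ?deriv0 !horner0.
have [ec [Hc1 Hc2]] := pexpr_of_poly c.
exists (PA (PM e PY) ec); split=> x y /=.
  by rewrite He1 Hc1 hornerMXaddC hornerD hornerM hornerC.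
rewrite He1 He2 Hc2 derivMXaddC !hornerD hornerM hornerX hornerM hornerC.
rewrite -/(ev2 P x y).
change (Cplus (Cplus (Cmult (ev2 P^`()%R x y) y) (Cmult (ev2 P x y) (RtoC 1))) (RtoC 0)
  = Cplus (ev2 P x y) (Cmult (ev2 P^`()%R x y) y)); ring.
Qed.

Lemma ev2M P Q x y : ev2 (P * Q)%R x y = Cmult (ev2 P x y) (ev2 Q x y).
Proof. by rewrite /ev2 !hornerM. Qed.
Lemma ev2D P Q x y : ev2 (P + Q)%R x y = Cplus (ev2 P x y) (ev2 Q x y).
Proof. by rewrite /ev2 !hornerD. Qed.

(** Nonzero roots are split off one at a time, and the radius is the least of 1 and their moduli.
    The origin itself may be a root. *)
Lemma roots_isolated (p : {poly CF}) : p != 0%R ->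
  exists d, 0 < d /\ forall x : C, 0 < Cmod x < d -> p.[x]%R <> RtoC 0.
Proof.
have [n] := ubnP (size p); elim: n p => // n IH p sp p0.
have [[x [px x0]]|nex] := classic (exists x : C, p.[x]%R = RtoC 0 /\ x <> RtoC 0); last first.
  exists 1; split; first lra.
  move=> x [x0 _] px; apply: nex; exists x; split=> // xE; move: x0.
  by rewrite xE Cmod_0; lra.
have /factor_theorem [q pE] : root p x by rewrite /root px.
have q0 : q != 0%R by apply: contra_neq p0 => q0; rewrite pE q0 mul0r.
have [|d [d0 hd]] := IH q _ q0.
  by move: sp; rewrite pE size_Mmonic ?monicXsubC // size_XsubC addn2.
have x0' : 0 < Cmod x by apply/Cmod_gt_0.
exists (Rmin d (Cmod x)); split; first exact: Rmin_glb_lt.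
move=> z [z0 /Rmin_Rgt [zd zx]] pz.
have : ((q.[z] == 0) || ((z : CF) - x == 0))%R.
  by move: pz; rewrite pE hornerM hornerXsubC => /eqP; rewrite mulf_eq0.
move=> /orP [/eqP|]; first by apply: hd; lra.
by rewrite subr_eq0 => /eqP zE; move: zx; rewrite zE; lra.
Qed.

(** A nonzero polynomial of least degree in y among those vanishing on [Z] is separable: a repeated
    factor could be dropped once without losing a zero. *)
Lemma separable_vanishing_poly (Z : C -> C -> Prop) (P : {poly {poly CF}}) :
  P != 0%R -> (forall x y, Z x y -> ev2 P x y = RtoC 0) ->
  exists Q : {poly {poly CF}}, separable_poly Q /\ forall x y, Z x y -> ev2 Q x y = RtoC 0.
Proof.
have [n] := ubnP (size P); elim: n P => // n IH P sP P0 PZ.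
have [sep|nsep] := boolP (separable_poly P); first by exists P.
have [[Q [Q0 [sQ QZ]]]|nex] := classic (exists Q : {poly {poly CF}}, Q != 0%R /\ (size Q < size P)%N
    /\ forall x y, Z x y -> ev2 Q x y = RtoC 0).
  by apply: (IH Q) => //; exact: leq_trans sQ _.
case/negP: nsep; apply/separable_polyP; split.
  move=> u v uvP; apply/negP=> /negP ncop; apply: nex.
  have gP : (gcdp u v * gcdp u v %| P)%R.
    by apply: dvdp_trans uvP; rewrite dvdp_mul ?dvdp_gcdl ?dvdp_gcdr.
  set g := gcdp u v in ncop gP.
  (* Over C[x] divisibility holds up to a nonzero factor [c]. A zero of P is still a zero of w g g,
     hence of w g, whatever the value of [c] there. *)
  have /Pdiv.Idomain.dvdpP [[c w] /= c0 cP] := gP.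
  have cP0 : (c *: P)%R != 0%R by rewrite -mul_polyC mulf_neq0 ?polyC_eq0.
  have w0 : w != 0%R by apply: contra_neq cP0 => w0; rewrite cP w0 mul0r.
  have g0 : g != 0%R by apply: contra_neq cP0 => g0; rewrite cP g0 !mulr0.
  have sg : (1 < size g)%N.
    by rewrite ltn_neqAle eq_sym ncop lt0n size_poly_eq0 g0.
  exists (w * g)%R; split; first by rewrite mulf_neq0.
  split.
    rewrite -(size_scale P c0) cP mulrA [X in (_ < X)%N]size_mul ?mulf_neq0 //.
    by rewrite -(subnKC sg) addnS /= -[X in (X < _)%N]addn0 ltn_add2l.
  move=> x y Zxy.
  have := congr1 (fun Q => ev2 Q x y) cP.
  rewrite /ev2 hornerZ !hornerM -/(ev2 P x y) PZ // mulr0 => /esym /eqP.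
  rewrite !mulf_eq0 => /or3P H; apply/eqP; rewrite !mulf_eq0.
  by case: H => ->; rewrite ?orbT.
(* In characteristic 0 the leading coefficient of the derivative is the degree times that of [u],
   hence nonzero. *)
move=> u _ su; apply/eqP => u'0.
have := coef_deriv u (size u).-2; rewrite u'0 coef0 => /esym /eqP.
rewrite -mulr_natr mulf_eq0.
have -> : (size u).-2.+1 = (size u).-1 by rewrite -(subnKC su).
rewrite -lead_coefE lead_coef_eq0 -size_poly_eq0 -(subnKC su) /=.
by rewrite -polyC_natr polyC_eq0 natCF_eq0.
Qed.

(** A Bezout relation between f and its y-derivative, free of denominators, has a nonzero polynomial
    in x alone on the right. So d_y f cannot vanish at a zero of f above a small nonzero x, which
    allows division by d_y f on a branch. *)
Theorem separable_vanishing (Z : C -> C -> Prop) (e : pexpr C) :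
  (exists x y, evC e x y <> RtoC 0) -> (forall x y, Z x y -> evC e x y = RtoC 0) ->
  exists (f a b : pexpr C) (rr : C -> C),
    (forall x y, Z x y -> evC f x y = RtoC 0) /\
    (forall x y, Cplus (Cmult (evC a x y) (evC f x y)) (Cmult (evC b x y) (evC (dyC f) x y)) = rr x) /\
    exists d, 0 < d /\ forall x, 0 < Cmod x < d -> rr x <> RtoC 0.
Proof.
move=> [x0 [y0 nz]] eZ.
have [||Q [sepQ QZ]] := @separable_vanishing_poly Z (bipoly_of e).
- by apply/eqP=> e0; apply: nz; rewrite -ev2_bipoly_of e0 /ev2 !horner0.
- by move=> x y; rewrite ev2_bipoly_of; exact: eZ.
move: sepQ; rewrite unlock => /Bezout_coprimepP [[u v] /=].
rewrite -size_poly_eq1 => /size_poly1P [c c0 uvE].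
have [f [f1 f2]] := pexpr_of_bipoly Q.
have [a [a1 _]] := pexpr_of_bipoly u.
have [b [b1 _]] := pexpr_of_bipoly v.
exists f, a, b, (fun x => c.[x]%R); split; first by move=> x y /QZ; rewrite f1.
split; last exact: roots_isolated.
by move=> x y; rewrite f1 f2 a1 b1 -!ev2M -ev2D uvE /ev2 hornerC.
Qed.

(** * Uniform coefficient bounds and pairs of multiple roots *)

Fixpoint poly_in_y (e : pexpr C) (x : CF) : {poly CF} :=
  match e with
  | PC c => (c : CF)%:P%R
  | PX => x%:P%R
  | PY => 'X%R
  | PA a b => (poly_in_y a x + poly_in_y b x)%R
  | PM a b => (poly_in_y a x * poly_in_y b x)%R
  end.
Lemma horner_poly_in_y e x y : (poly_in_y e x).[y]%R = evC e x y.
Proof.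
elim: e => [c|||a IHa b IHb|a IHa b IHb] /=.
- by rewrite hornerC.
- by rewrite hornerC.
- by rewrite hornerX.
- by rewrite hornerD IHa IHb.
- by rewrite hornerM IHa IHb.
Qed.
Lemma deriv_poly_in_y e x : ((poly_in_y e x)^`() = poly_in_y (dyC e) x)%R.
Proof.
elim: e => [c|||a IHa b IHb|a IHa b IHb] /=; rewrite ?derivC ?derivX ?derivD ?derivM ?IHa ?IHb //.
Qed.
Lemma derivn_poly_in_y e x k : ((poly_in_y e x)^`(k) = poly_in_y (Nat.iter k dyC e) x)%R.
Proof. by elim: k => [//|k IH]; rewrite derivnS IH deriv_poly_in_y. Qed.

(** Degree and coefficients are bounded together because the polynomial in y varies with the
    abscissa x and the estimates must be uniform in it. *)
Definition poly_bounded (n : nat) (B : R) (p : {poly CF}) :=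
  (size p <= n)%N /\ forall i, Cmod (p`_i)%R <= B.

Lemma poly_bounded_le n m B B' p : (n <= m)%N -> B <= B' -> poly_bounded n B p -> poly_bounded m B' p.
Proof.
move=> nm BB [sp cp]; split; first exact: leq_trans sp nm.
by move=> i; apply: Rle_trans (cp i) BB.
Qed.
Lemma poly_bounded_const n B (c : CF) : Cmod c <= B -> poly_bounded n.+1 B c%:P%R.
Proof.
move=> cB; split; first by apply: leq_trans (size_polyC_leq1 _) _.
move=> i; rewrite coefC; case: eqP => // _.
by rewrite Cmod_0; apply: Rle_trans cB; exact: Cmod_ge_0.
Qed.
Lemma poly_bounded_add n B B' p q : poly_bounded n B p -> poly_bounded n B' q -> poly_bounded n (B + B') (p + q)%R.
Proof.
move=> [sp cp] [sq cq]; split.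
  by apply: leq_trans (size_polyD _ _) _; rewrite geq_max sp sq.
move=> i; rewrite coefD; apply: Rle_trans (Cmod_triangle _ _) _.
exact: Rplus_le_compat.
Qed.
Lemma poly_bounded_mul n B B' p q : 0 <= B -> 0 <= B' -> poly_bounded n B p -> poly_bounded n B' q ->
  poly_bounded (n + n) (INR (n + n) * (B * B')) (p * q)%R.
Proof.
move=> B0 B'0 [sp cp] [sq cq]; have spq : (size (p * q)%R <= n + n)%N.
  by apply: leq_trans (size_polyMleq _ _) _; apply: leq_trans (leq_pred _) _; exact: leq_add.
split=> // i.
have BB : 0 <= B * B' by exact: Rmult_le_pos.
have [ni|ni] := leqP (n + n) i.
  rewrite nth_default ?(leq_trans spq) // Cmod_0.
  by apply: Rmult_le_pos => //; exact: pos_INR.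
have H k : Cmod (\sum_(j < k) p`_j * q`_(i - j))%R <= INR k * (B * B').
  elim: k => [|k IH]; first by rewrite big_ord0 Cmod_0 Rmult_0_l; exact: Rle_refl.
  rewrite big_ord_recr S_INR Rmult_plus_distr_r Rmult_1_l.
  apply: Rle_trans (Cmod_triangle _ _) _; apply: Rplus_le_compat => //.
  rewrite [Cmod _]Cmod_mult; apply: Rmult_le_compat => //; exact: Cmod_ge_0.
rewrite coefM; apply: Rle_trans (H _) _; apply: Rmult_le_compat_r => //.
by apply: le_INR; apply/leP.
Qed.

Lemma poly_in_y_bounded e : exists n B, 0 <= B /\ forall x, Cmod x <= 1 -> poly_bounded n B (poly_in_y e x).
Proof.
elim: e => [c|||a [n [B [B0 H]]] b [m [B' [B'0 H']]]|a [n [B [B0 H]]] b [m [B' [B'0 H']]]].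
- by exists 1%N, (Cmod c); split; [exact: Cmod_ge_0|move=> x _; apply: poly_bounded_const; exact: Rle_refl].
- by exists 1%N, 1; split; [lra|move=> x x1; exact: poly_bounded_const].
- exists 2%N, 1; split; [lra|move=> x x1]; split; first by rewrite size_polyX.
  move=> i; rewrite coefX; case: (i == 1%N).
    by rewrite [Cmod _]Cmod_1; lra.
  by rewrite [Cmod _]Cmod_0; lra.
- exists (maxn n m), (B + B'); split; first by lra.
  move=> x x1; apply: poly_bounded_add; [apply: poly_bounded_le (H _ x1)|apply: poly_bounded_le (H' _ x1)];
  rewrite ?leq_maxl ?leq_maxr //; exact: Rle_refl.
- exists (maxn n m + maxn n m)%N, (INR (maxn n m + maxn n m) * (B * B')); split.
    by apply: Rmult_le_pos; [exact: pos_INR|exact: Rmult_le_pos].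
  move=> x x1; apply: poly_bounded_mul => //; [apply: poly_bounded_le (H _ x1)|apply: poly_bounded_le (H' _ x1)];
  rewrite ?leq_maxl ?leq_maxr //; exact: Rle_refl.
Qed.

(** Synthetic division from the top: the quotient satisfies h_{i-1} = E_i + a h_i, with E the
    dividend, and |a| <= 1 lets the bound grow by at most [B] at each step. *)
Lemma poly_bounded_div_linear n B (a : CF) h : 0 <= B -> Cmod a <= 1 ->
  poly_bounded n B (('X - a%:P) * h)%R -> poly_bounded n (INR n * B) h.
Proof.
move=> B0 a1 [sh ch].
have sh' : (size h <= n)%N.
  have [->|h0] := eqVneq h 0%R; first by rewrite size_poly0.
  by apply: leq_trans sh; rewrite size_monicM ?monicXsubC // size_XsubC addnC addn2 /= leqnSn.
split=> // i.
(* Counting down from index n starts the recursion at a coefficient that is zero. *)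
suff H k : Cmod (h`_(n - k))%R <= INR k * B.
  have [ni|ni] := leqP n i.
    rewrite nth_default ?(leq_trans sh') // Cmod_0.
    by apply: Rmult_le_pos => //; exact: pos_INR.
  rewrite -(subKn (ltnW ni)); apply: Rle_trans (H _) _.
  apply: Rmult_le_compat_r => //; apply: le_INR; apply/leP; exact: leq_subr.
elim: k => [|k IH].
  rewrite subn0 nth_default // Cmod_0 Rmult_0_l; exact: Rle_refl.
have [nk|nk] := leqP n k.
  move: IH; have -> : (n - k.+1 = n - k)%N by rewrite (eqP nk); apply/eqP/ltnW.
  move=> /Rle_trans; apply; apply: Rmult_le_compat_r => //.
  by rewrite S_INR; lra.
have E := ch (n - k)%N.
have hE : (h`_(n - k.+1) = (('X - a%:P) * h)`_(n - k) + a * h`_(n - k))%R.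
  rewrite mulrBl coefB coefXM coefCM subrK subn_eq0 leqNgt nk /=.
  by rewrite subnS.
rewrite hE S_INR; apply: Rle_trans (Cmod_triangle _ _) _.
rewrite Rmult_plus_distr_r Rmult_1_l Rplus_comm; apply: Rplus_le_compat => //.
rewrite [Cmod _]Cmod_mult -[X in _ <= X]Rmult_1_l; apply: Rmult_le_compat => //; exact: Cmod_ge_0.
Qed.

Lemma poly_bounded_div_power n B (a : CF) k h : 0 <= B -> Cmod a <= 1 ->
  poly_bounded n B (('X - a%:P) ^+ k * h)%R -> poly_bounded n (INR n ^ k * B) h.
Proof.
move=> B0 a1; elim: k h => [|k IH] h; first by rewrite expr0 mul1r /= Rmult_1_l.
rewrite exprSr -mulrA => /IH /poly_bounded_div_linear; rewrite /= Rmult_assoc; apply=> //.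
by apply: Rmult_le_pos => //; apply: pow_le; exact: pos_INR.
Qed.

Lemma poly_bounded_eval n B p (y : CF) : 0 <= B -> poly_bounded n B p -> Cmod y <= 1 -> Cmod p.[y]%R <= INR n * B.
Proof.
move=> B0 [sp cp] y1; rewrite (horner_coef_wide _ sp).
elim: (n) => [|k IH]; first by rewrite big_ord0 Cmod_0 Rmult_0_l; exact: Rle_refl.
rewrite big_ord_recr S_INR Rmult_plus_distr_r Rmult_1_l.
apply: Rle_trans (Cmod_triangle _ _) _; apply: Rplus_le_compat => //.
rewrite [Cmod _]Cmod_mult -[X in _ <= X]Rmult_1_r; apply: Rmult_le_compat => //.
- exact: Cmod_ge_0.
- exact: Cmod_ge_0.
have -> : (y ^+ k)%R = Cpow y k by elim: (k) => // j IHj; rewrite exprS IHj.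
rewrite Cmod_pow -(pow1 k); apply: pow_incr; split=> //; exact: Cmod_ge_0.
Qed.

(** For p = (X - a) q one has p^(i+1)(a) = (i+1) q^(i)(a). This carries both the vanishing and the
    factorial from p to q; i+1 can be cancelled in characteristic 0. *)
Lemma derivn_root_factor k (a : CF) p : (forall i, (i < k)%N -> p^`(i).[a] = 0)%R ->
  exists h, p = (('X - a%:P) ^+ k * h)%R /\ (p^`(k).[a] = h.[a] *+ k`!)%R.
Proof.
elim: k p => [|k IH] p H; first by exists p; rewrite expr0 mul1r.
have /factor_theorem [q pE] : root p a.
  by apply/eqP; have := H 0%N isT; rewrite derivn0.
have dE i : (p^`(i.+1) = ('X - a%:P) * q^`(i.+1) + q^`(i) *+ i.+1)%R.
  elim: i => [|i IHi].
    by rewrite pE derivn1 derivM derivXsubC mulr1 derivn1 mulrC.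
  rewrite derivnS IHi derivD derivM derivXsubC mul1r derivMn -!derivnS.
  by rewrite addrAC -mulrS addrC.
have [i ik|h [qE hE]] := IH q.
  have := H i.+1 ik; rewrite dE hornerD hornerM hornerXsubC subrr mul0r add0r hornerMn.
  by move=> /eqP; rewrite -mulr_natr mulf_eq0 natCF_eq0 orbF => /eqP.
exists h; split; first by rewrite pE qE exprS mulrC mulrA.
rewrite dE hornerD hornerM hornerXsubC subrr mul0r add0r hornerMn hE.
by rewrite -mulrnA mulnC factS.
Qed.

(** The k-th powers of X - y1 and X - y2 are coprime, so their product divides the polynomial in y.
    The cofactor g is bounded uniformly in x by synthetic division, however close the roots are, and
    the k-th derivative at y1 is k! (y1 - y2)^k g(y1). *)
Theorem double_root_bound (e : pexpr C) (k : nat) : exists K, forall x y1 y2 : C,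
  Cmod x <= 1 -> Cmod y1 <= 1 -> Cmod y2 <= 1 -> y1 <> y2 ->
  (forall i, (i < k)%coq_nat -> evC (Nat.iter i dyC e) x y1 = RtoC 0) ->
  (forall i, (i < k)%coq_nat -> evC (Nat.iter i dyC e) x y2 = RtoC 0) ->
  Cmod (evC (Nat.iter k dyC e) x y1) <= K * Cmod (Cminus y1 y2) ^ k.
Proof.
have [n [B [B0 HB]]] := poly_in_y_bounded e.
exists (INR k`! * (INR n * (INR n ^ k * (INR n ^ k * B)))).
move=> x y1 y2 x1 y11 y21 y12 H1 H2.
have /HB {}HB := x1.
set p := poly_in_y e x in HB.
have [i ik|h [pE hE]] := @derivn_root_factor k y1 p.
  by rewrite derivn_poly_in_y horner_poly_in_y H1 //; apply/ltP.
have [i ik|h' [pE' _]] := @derivn_root_factor k y2 p.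
  by rewrite derivn_poly_in_y horner_poly_in_y H2 //; apply/ltP.
have : (('X - (y2 : CF)%:P) ^+ k %| ('X - (y1 : CF)%:P) ^+ k * h)%R.
  by rewrite -pE pE' dvdp_mulIl.
rewrite Gauss_dvdpr; last first.
  apply: coprimep_expl; apply: coprimep_expr.
  rewrite coprimep_XsubC root_XsubC; apply/eqP => yE; exact: y12.
move=> /dvdpP [g gE].
rewrite mulrC in gE.
have Bh : poly_bounded n (INR n ^ k * B) h by apply: (@poly_bounded_div_power _ _ (y1 : CF)) => //; rewrite -pE.
have nk0 : 0 <= INR n ^ k by apply: pow_le; exact: pos_INR.
have nB0 : 0 <= INR n ^ k * B by exact: Rmult_le_pos.
have Bg : poly_bounded n (INR n ^ k * (INR n ^ k * B)) g.
  by apply: (@poly_bounded_div_power _ _ (y2 : CF)) => //; rewrite -gE.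
rewrite -horner_poly_in_y -derivn_poly_in_y hE gE hornerM horner_exp hornerXsubC -mulr_natr natCF.
have powE (z : CF) j : (z ^+ j)%R = Cpow z j by elim: j => // j IHj; rewrite exprS IHj.
rewrite [Cmod _]Cmod_mult [Cmod (@GRing.mul CF _ _)]Cmod_mult powE Cmod_pow Cmod_R Rabs_pos_eq; last exact: pos_INR.
rewrite Rmult_comm Rmult_assoc; apply: Rmult_le_compat_l; first exact: pos_INR.
rewrite Rmult_comm; apply: Rmult_le_compat_r; first by apply: pow_le; exact: Cmod_ge_0.
by apply: poly_bounded_eval => //; exact: Rmult_le_pos.
Qed.
End PolyC.

(** * Complex derivatives *)

(** The body of [C_differentiable_at] with the derivative exposed, so that the hypotheses on [phi]
    supply it directly. *)
Definition hol (h : C -> C) (z l : C) : Prop :=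
  forall e, 0 < e -> exists d, 0 < d /\ forall w, 0 < Cmod (w - z) < d ->
    Cmod (h w - h z - l * (w - z)) <= e * Cmod (w - z).

Definition cder (h : R -> C) (s : R) (l : C) : Prop :=
  is_derive (fun u => Re (h u)) s (Re l) /\ is_derive (fun u => Im (h u)) s (Im l).

Lemma is_derive_eps (f : R -> R) (x l : R) :
  is_derive f x l <->
  forall e, 0 < e -> exists d, 0 < d /\ forall u, Rabs (u - x) < d ->
    Rabs (f u - f x - l * (u - x)) <= e * Rabs (u - x).
Proof.
  rewrite is_derive_Reals; split.
  - intros H e He. destruct (H e He) as [d Hd]. exists d. split. apply cond_pos.
    intros u Hu. destruct (Req_dec u x) as [->|Hn].
    + replace (f x - f x - l * (x - x)) with 0 by ring. rewrite Rminus_diag, Rabs_R0. lra.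
    + specialize (Hd (u - x)). replace (x + (u - x)) with u in Hd by ring.
      assert (u - x <> 0) by lra.
      specialize (Hd H0 Hu).
      replace (f u - f x - l * (u - x)) with (((f u - f x) / (u - x) - l) * (u - x)) by (field; auto).
      rewrite Rabs_mult. apply Rmult_le_compat_r. apply Rabs_pos. lra.
  - intros H e He. destruct (H (e / 2)) as [d [Hd0 Hd]]. lra.
    exists (mkposreal d Hd0). simpl. intros h Hh Hhd.
    specialize (Hd (x + h)). replace (x + h - x) with h in Hd by ring. specialize (Hd Hhd).
    replace ((f (x + h) - f x) / h - l) with ((f (x + h) - f x - l * h) / h) by (field; auto).
    unfold Rdiv. rewrite Rabs_mult, Rabs_inv.
    assert (0 < Rabs h) by (apply Rabs_pos_lt; auto).
    apply Rle_lt_trans with (e / 2); [|lra].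
    apply Rmult_le_reg_r with (Rabs h); auto. rewrite Rmult_assoc, Rinv_l; lra.
Qed.

Lemma Rabs_Re_le (z : C) : Rabs (Re z) <= Cmod z.
Proof. apply re_le_Cmod. Qed.
Lemma Rabs_Im_le (z : C) : Rabs (Im z) <= Cmod z.
Proof. apply Rle_trans with (2 := Rmax_Cmod z). apply Rmax_r. Qed.
Lemma Cmod_le_ReIm (z : C) : Cmod z <= Rabs (Re z) + Rabs (Im z).
Proof.
  destruct z as [a b]; unfold Cmod, Re, Im; simpl fst; simpl snd.
  apply Rsqr_incr_0_var. 2: generalize (Rabs_pos a) (Rabs_pos b); lra.
  rewrite Rsqr_sqrt by nra. unfold Rsqr.
  replace (a^2) with (Rabs a ^ 2) by (rewrite pow2_abs; auto).
  replace (b^2) with (Rabs b ^ 2) by (rewrite pow2_abs; auto).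
  generalize (Rabs_pos a) (Rabs_pos b). nra.
Qed.

Lemma cder_eps (h : R -> C) (s : R) (l : C) :
  cder h s l <->
  forall e, 0 < e -> exists d, 0 < d /\ forall u, Rabs (u - s) < d ->
    Cmod (h u - h s - l * RtoC (u - s)) <= e * Rabs (u - s).
Proof.
  unfold cder. rewrite !is_derive_eps. split.
  - intros [H1 H2] e He.
    destruct (H1 (e / 2)) as [d1 [P1 Q1]]. lra.
    destruct (H2 (e / 2)) as [d2 [P2 Q2]]. lra.
    exists (Rmin d1 d2). split. apply Rmin_pos; auto.
    intros u Hu.
    assert (Hu1 := Rlt_le_trans _ _ _ Hu (Rmin_l d1 d2)).
    assert (Hu2 := Rlt_le_trans _ _ _ Hu (Rmin_r d1 d2)).
    specialize (Q1 u Hu1). specialize (Q2 u Hu2).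
    eapply Rle_trans. apply Cmod_le_ReIm.
    replace (Re (h u - h s - l * RtoC (u - s)))
      with (Re (h u) - Re (h s) - Re l * (u - s)) by (unfold Re; simpl; ring).
    replace (Im (h u - h s - l * RtoC (u - s)))
      with (Im (h u) - Im (h s) - Im l * (u - s)) by (unfold Im; simpl; ring).
    lra.
  - intros H; split; intros e He; destruct (H e He) as [d [P Q]]; exists d; split; auto;
    intros u Hu; specialize (Q u Hu); (eapply Rle_trans; [|exact Q]).
    + replace (Re (h u) - Re (h s) - Re l * (u - s)) with
        (Re (h u - h s - l * RtoC (u - s))) by (unfold Re; simpl; ring).
      apply Rabs_Re_le.
    + replace (Im (h u) - Im (h s) - Im l * (u - s)) with
        (Im (h u - h s - l * RtoC (u - s))) by (unfold Im; simpl; ring).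
      apply Rabs_Im_le.
Qed.

Lemma hol_bound h z l : hol h z l -> exists d, 0 < d /\ forall w, Cmod (w - z) < d ->
  Cmod (h w - h z) <= (Cmod l + 1) * Cmod (w - z).
Proof.
  intros H. destruct (H 1) as [d [P Q]]. lra. exists d; split; auto.
  intros w Hw. destruct (Req_dec (Cmod (w - z)) 0) as [E|E].
  - apply Cmod_eq_0 in E. assert (w = z) by (replace w with (w - z + z)%C by ring; rewrite E; ring).
    subst w. rewrite E. replace (h z - h z)%C with (RtoC 0) by ring. rewrite Cmod_0. lra.
  - assert (0 < Cmod (w - z)) by (generalize (Cmod_ge_0 (w - z)%C); lra).
    specialize (Q w (conj H0 Hw)).
    replace (h w - h z)%C with (h w - h z - l * (w - z) + l * (w - z))%C by ring.
    eapply Rle_trans. apply Cmod_triangle. rewrite Cmod_mult. lra.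
Qed.

Definition ccont (h : C -> C) (z : C) : Prop :=
  forall e, 0 < e -> exists d, 0 < d /\ forall w, Cmod (w - z) < d -> Cmod (h w - h z) < e.

Lemma hol_ccont h z l : hol h z l -> ccont h z.
Proof.
  intros H e He. destruct (hol_bound _ _ _ H) as [d [P Q]].
  generalize (Cmod_ge_0 l); intro L.
  exists (Rmin d (e / (Cmod l + 1) )). split.
  - apply Rmin_pos; auto. apply Rdiv_lt_0_compat; lra.
  - intros w Hw. eapply Rle_lt_trans. apply Q. eapply Rlt_le_trans. apply Hw. apply Rmin_l.
    assert (W := Rlt_le_trans _ _ _ Hw (Rmin_r _ _)).
    apply Rmult_lt_compat_l with (r := Cmod l + 1) in W; [|lra].
    replace ((Cmod l + 1) * (e / (Cmod l + 1))) with e in W by (field; lra). lra.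
Qed.

Lemma hol_ext h k z l : (exists d, 0 < d /\ forall w, Cmod (w - z) < d -> h w = k w) -> hol h z l -> hol k z l.
Proof.
  intros [d0 [P0 Q0]] H e He. destruct (H e He) as [d [P Q]].
  exists (Rmin d d0). split. apply Rmin_pos; auto.
  intros w [W1 W2]. rewrite <- !Q0. apply Q. split; auto. eapply Rlt_le_trans. apply W2. apply Rmin_l.
  replace (z - z)%C with (RtoC 0) by ring. rewrite Cmod_0; auto.
  eapply Rlt_le_trans. apply W2. apply Rmin_r.
Qed.
Lemma hol_const c z : hol (fun _ => c) z (RtoC 0).
Proof.
  intros e He. exists 1; split. lra. intros w [W _].
  replace (c - c - RtoC 0 * (w - z))%C with (RtoC 0) by ring. rewrite Cmod_0. nra.
Qed.
Lemma hol_id z : hol (fun w => w) z (RtoC 1).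
Proof.
  intros e He. exists 1; split. lra. intros w [W _].
  replace (w - z - RtoC 1 * (w - z))%C with (RtoC 0) by ring. rewrite Cmod_0. nra.
Qed.
Lemma hol_plus h k z l m : hol h z l -> hol k z m -> hol (fun w => (h w + k w)%C) z (l + m)%C.
Proof.
  intros H K e He. destruct (H (e/2)) as [d1 [P1 Q1]]. lra. destruct (K (e/2)) as [d2 [P2 Q2]]. lra.
  exists (Rmin d1 d2). split. apply Rmin_pos; auto.
  intros w [W1 W2].
  assert (Hu1 := Rlt_le_trans _ _ _ W2 (Rmin_l d1 d2)).
  assert (Hu2 := Rlt_le_trans _ _ _ W2 (Rmin_r d1 d2)).
  specialize (Q1 w (conj W1 Hu1)). specialize (Q2 w (conj W1 Hu2)).
  replace (_ - _)%C with (h w - h z - l * (w - z) + (k w - k z - m * (w - z)))%C by ring.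
  eapply Rle_trans. apply Cmod_triangle. lra.
Qed.
Lemma hol_mult h k z l m : hol h z l -> hol k z m ->
  hol (fun w => (h w * k w)%C) z (l * k z + h z * m)%C.
Proof.
  intros H K e He.
  set (A := Cmod (h z) + Cmod (k z) + Cmod l + 2).
  assert (Ah : 0 <= Cmod (h z)) by apply Cmod_ge_0.
  assert (Ak : 0 <= Cmod (k z)) by apply Cmod_ge_0.
  assert (Al : 0 <= Cmod l) by apply Cmod_ge_0.
  assert (A2 : 2 <= A) by (unfold A; lra).
  set (e1 := Rmin 1 (e / (3 * A))).
  assert (E0 : 0 < e1). { apply Rmin_pos. lra. apply Rdiv_lt_0_compat; lra. }
  assert (E1 : e1 <= 1) by apply Rmin_l.
  assert (E2 : e1 * (3 * A) <= e).
  { apply Rle_trans with (e / (3*A) * (3*A)). apply Rmult_le_compat_r. lra. apply Rmin_r.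
    right. field. lra. }
  destruct (H e1) as [d1 [P1 Q1]]. lra. destruct (K e1) as [d2 [P2 Q2]]. lra.
  destruct (hol_ccont _ _ _ K e1 E0) as [d3 [P3 Q3]].
  exists (Rmin d1 (Rmin d2 d3)). split. repeat apply Rmin_pos; auto.
  intros w [W1 W2].
  assert (Hu1 := Rlt_le_trans _ _ _ W2 (Rmin_l _ _)).
  assert (Hu := Rlt_le_trans _ _ _ W2 (Rmin_r _ _)).
  assert (Hu2 := Rlt_le_trans _ _ _ Hu (Rmin_l _ _)).
  assert (Hu3 := Rlt_le_trans _ _ _ Hu (Rmin_r _ _)).
  specialize (Q1 w (conj W1 Hu1)). specialize (Q2 w (conj W1 Hu2)). specialize (Q3 w Hu3).
  set (D := Cmod (w - z)) in *.
  replace (_ - _)%C with ((h w - h z - l * (w - z)) * (k z + (k w - k z)) + l * (w - z) * (k w - k z) + h z * (k w - k z - m * (w - z)))%C by ring.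
  eapply Rle_trans. apply Cmod_triangle.
  eapply Rle_trans. apply Rplus_le_compat_r. apply Cmod_triangle.
  rewrite !Cmod_mult. fold D.
  assert (KK : Cmod (k z + (k w - k z)) <= A).
  { eapply Rle_trans. apply Cmod_triangle. unfold A; lra. }
  assert (D0 : 0 < D) by auto.
  assert (T1 : Cmod (h w - h z - l * (w - z)) * Cmod (k z + (k w - k z)) <= (e1 * D) * A).
  { apply Rmult_le_compat; auto using Cmod_ge_0. }
  assert (T2 : Cmod l * D * Cmod (k w - k z) <= A * D * e1).
  { apply Rmult_le_compat; auto using Cmod_ge_0. nra. apply Rmult_le_compat_r. lra. unfold A; lra. lra. }
  assert (T3 : Cmod (h z) * Cmod (k w - k z - m * (w - z)) <= A * (e1 * D)).
  { apply Rmult_le_compat; auto using Cmod_ge_0. unfold A; lra. }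
  apply Rle_trans with (e1 * (3 * A) * D). lra. apply Rmult_le_compat_r; lra.
Qed.
Lemma hol_inv h z l : h z <> RtoC 0 -> hol h z l ->
  hol (fun w => (/ h w)%C) z (- (l / (h z * h z)))%C.
Proof.
  intros Hz H e He.
  assert (Hp : 0 < Cmod (h z)) by (apply Cmod_gt_0; auto).
  set (B := Cmod (h z)) in *.
  assert (Al : 0 <= Cmod l) by apply Cmod_ge_0.
  set (e1 := Rmin (B / 2) (e * (B * B * B) / (2 * (B + Cmod l)))).
  assert (E0 : 0 < e1).
  { apply Rmin_pos. lra. apply Rdiv_lt_0_compat. repeat apply Rmult_lt_0_compat; lra. lra. }
  assert (E1 : e1 <= B / 2) by apply Rmin_l.
  assert (E2 : e1 * (2 * (B + Cmod l)) <= e * (B * B * B)).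
  { apply Rle_trans with (e * (B * B * B) / (2 * (B + Cmod l)) * (2 * (B + Cmod l))).
    apply Rmult_le_compat_r. lra. apply Rmin_r. right. field. lra. }
  destruct (H e1 E0) as [d1 [P1 Q1]].
  destruct (hol_ccont _ _ _ H e1 E0) as [d3 [P3 Q3]].
  exists (Rmin d1 d3). split. apply Rmin_pos; auto.
  intros w [W1 W2].
  assert (Hu1 := Rlt_le_trans _ _ _ W2 (Rmin_l _ _)).
  assert (Hu3 := Rlt_le_trans _ _ _ W2 (Rmin_r _ _)).
  specialize (Q1 w (conj W1 Hu1)). specialize (Q3 w Hu3).
  assert (HW : B / 2 <= Cmod (h w)).
  { assert (B <= Cmod (h w) + Cmod (- (h w - h z))).
    { unfold B. replace (h z) with (h w + - (h w - h z))%C at 1 by ring. apply Cmod_triangle. }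
    rewrite Cmod_opp in H0. lra. }
  assert (Hw : h w <> RtoC 0) by (apply Cmod_gt_0; lra).
  replace (_ - _)%C with ((- h z * (h w - h z - l * (w - z)) + l * (w - z) * (h w - h z)) / (h w * (h z * h z)))%C.
  2:{ field. auto. }
  rewrite Cmod_div by (repeat apply Cmult_neq_0; auto).
  rewrite !Cmod_mult. fold B.
  set (D := Cmod (w - z)) in *.
  apply Rmult_le_reg_r with (Cmod (h w) * (B * B)). apply Rmult_lt_0_compat. lra. nra.
  unfold Rdiv. rewrite Rmult_assoc, Rinv_l. rewrite Rmult_1_r.
  2:{ apply Rgt_not_eq. apply Rmult_lt_0_compat. lra. nra. }
  eapply Rle_trans. apply Cmod_triangle. rewrite !Cmod_mult, Cmod_opp. fold B. fold D.
  assert (T1 : B * Cmod (h w - h z - l * (w - z)) <= B * (e1 * D)).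
  { apply Rmult_le_compat_l. lra. auto. }
  assert (T2 : Cmod l * D * Cmod (h w - h z) <= Cmod l * D * e1).
  { apply Rmult_le_compat_l. apply Rmult_le_pos; lra. lra. }
  apply Rle_trans with (e1 * (B + Cmod l) * D). lra.
  apply Rle_trans with (e * D * (B / 2 * (B * B))).
  2:{ apply Rmult_le_compat_l. nra. apply Rmult_le_compat_r. nra. auto. }
  nra.
Qed.

Lemma hol_pexpr (f : pexpr C) (a b : C -> C) z la lb : hol a z la -> hol b z lb ->
  hol (fun w => evC f (a w) (b w)) z
    (evC (dxC f) (a z) (b z) * la + evC (dyC f) (a z) (b z) * lb)%C.
Proof.
  intros Ha Hb. induction f; simpl.
  - replace (_ + _)%C with (RtoC 0) by ring. apply hol_const.
  - replace (_ + _)%C with la by ring. auto.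
  - replace (_ + _)%C with lb by ring. auto.
  - match goal with |- hol _ _ ?l => replace l with
      (evC (dxC f1) (a z) (b z) * la + evC (dyC f1) (a z) (b z) * lb + (evC (dxC f2) (a z) (b z) * la + evC (dyC f2) (a z) (b z) * lb))%C by ring end.
    apply hol_plus; auto.
  - match goal with |- hol _ _ ?l => replace l with
      ((evC (dxC f1) (a z) (b z) * la + evC (dyC f1) (a z) (b z) * lb) * evC f2 (a z) (b z) + evC f1 (a z) (b z) * (evC (dxC f2) (a z) (b z) * la + evC (dyC f2) (a z) (b z) * lb))%C by ring end.
    apply (hol_mult (fun w => evC f1 (a w) (b w)) (fun w => evC f2 (a w) (b w))); auto.
Qed.

Lemma hol_unique h z l m : hol h z l -> hol h z m -> l = m.
Proof.
  intros H K. apply NNPP. intro N.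
  assert (N' : (l - m)%C <> RtoC 0) by (intro E; apply N; replace l with (l - m + m)%C by ring; rewrite E; ring).
  apply Cmod_gt_0 in N'. set (q := Cmod (l - m)) in *.
  destruct (H (q/4)) as [d1 [P1 Q1]]. lra. destruct (K (q/4)) as [d2 [P2 Q2]]. lra.
  set (d := Rmin d1 d2 / 2). assert (D : 0 < d) by (unfold d; assert (0 < Rmin d1 d2) by (apply Rmin_pos; auto); lra).
  assert (M : Cmod (z + RtoC d - z) = d).
  { replace (z + RtoC d - z)%C with (RtoC d) by ring. rewrite Cmod_R. apply Rabs_pos_eq; lra. }
  specialize (Q1 (z + RtoC d)%C). specialize (Q2 (z + RtoC d)%C). rewrite M in *.
  assert (d < d1) by (unfold d in *; generalize (Rmin_l d1 d2); lra).
  assert (d < d2) by (unfold d in *; generalize (Rmin_r d1 d2); lra).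
  specialize (Q1 (conj D H0)). specialize (Q2 (conj D H1)).
  assert (X : Cmod ((l - m) * RtoC d) <= q/4 * d + q/4*d).
  { replace ((l - m) * RtoC d)%C with (- (h (z + RtoC d)%C - h z - l * (z + RtoC d - z)) + (h (z + RtoC d)%C - h z - m * (z + RtoC d - z)))%C by ring.
    eapply Rle_trans. apply Cmod_triangle. rewrite Cmod_opp. lra. }
  rewrite Cmod_mult, Cmod_R in X. fold q in X. rewrite Rabs_pos_eq in X by lra. nra.
Qed.

Lemma cder_hol_comp (h : C -> C) (g : R -> C) s l v : hol h (g s) l -> cder g s v ->
  cder (fun u => h (g u)) s (l * v)%C.
Proof.
  rewrite !cder_eps. intros H G e He.
  assert (Al : 0 <= Cmod l) by apply Cmod_ge_0.
  assert (Av : 0 <= Cmod v) by apply Cmod_ge_0.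
  set (e1 := e / (2 * (Cmod v + 1))).
  assert (E1 : 0 < e1) by (apply Rdiv_lt_0_compat; lra).
  set (e2 := Rmin 1 (e / (2 * (Cmod l + 1)))).
  assert (E2 : 0 < e2) by (apply Rmin_pos; [lra|apply Rdiv_lt_0_compat; lra]).
  assert (E3 : e2 <= 1) by apply Rmin_l.
  assert (E4 : e2 * (Cmod l + 1) <= e / 2).
  { apply Rle_trans with (e / (2 * (Cmod l + 1)) * (Cmod l + 1)). apply Rmult_le_compat_r. lra. apply Rmin_r.
    right. field. lra. }
  assert (E5 : e1 * (Cmod v + 1) = e / 2) by (unfold e1; field; lra).
  destruct (H e1 E1) as [d1 [P1 Q1]].
  destruct (G e2 E2) as [d2 [P2 Q2]].
  exists (Rmin d2 (d1 / (Cmod v + 1))). split. apply Rmin_pos; auto. apply Rdiv_lt_0_compat; lra.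
  intros u Hu.
  assert (Hu1 := Rlt_le_trans _ _ _ Hu (Rmin_l _ _)).
  assert (Hu2 := Rlt_le_trans _ _ _ Hu (Rmin_r _ _)).
  specialize (Q2 u Hu1). set (D := Rabs (u - s)) in *.
  assert (D0 : 0 <= D) by apply Rabs_pos.
  assert (GD : Cmod (g u - g s) <= (Cmod v + 1) * D).
  { replace (g u - g s)%C with (g u - g s - v * RtoC (u - s) + v * RtoC (u - s))%C by ring.
    eapply Rle_trans. apply Cmod_triangle. rewrite Cmod_mult, Cmod_R. fold D. nra. }
  assert (GD1 : Cmod (g u - g s) < d1).
  { eapply Rle_lt_trans. apply GD. apply Rmult_lt_compat_l with (r := Cmod v + 1) in Hu2; [|lra].
    replace ((Cmod v + 1) * (d1 / (Cmod v + 1))) with d1 in Hu2 by (field; lra). lra. }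
  assert (T : Cmod (h (g u) - h (g s) - l * (g u - g s)) <= e1 * Cmod (g u - g s)).
  (* [hol] only speaks of points other than the centre, so the case g u = g s is separate. *)
  { destruct (Req_dec (Cmod (g u - g s)) 0) as [E|E].
    - apply Cmod_eq_0 in E. assert (GE : g u = g s) by (replace (g u) with (g u - g s + g s)%C by ring; rewrite E; ring).
      rewrite GE. replace (_ - _)%C with (RtoC 0) at 1 by ring. rewrite Cmod_0.
      apply Rmult_le_pos. lra. apply Cmod_ge_0.
    - apply Q1. split; auto. generalize (Cmod_ge_0 (g u - g s)%C); lra. }
  replace (_ - _)%C with (h (g u) - h (g s) - l * (g u - g s) + l * (g u - g s - v * RtoC (u - s)))%C by ring.
  eapply Rle_trans. apply Cmod_triangle. rewrite Cmod_mult.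
  assert (T2 : Cmod l * Cmod (g u - g s - v * RtoC (u - s)) <= Cmod l * (e2 * D)).
  { apply Rmult_le_compat_l; auto. }
  assert (T3 : e1 * Cmod (g u - g s) <= e1 * ((Cmod v + 1) * D)) by (apply Rmult_le_compat_l; lra).
  assert (T4 : e1 * ((Cmod v + 1) * D) = e / 2 * D) by (rewrite <- E5; ring).
  assert (T5 : Cmod l * (e2 * D) <= e / 2 * D).
  { apply Rle_trans with (e2 * (Cmod l + 1) * D). nra. apply Rmult_le_compat_r; auto. }
  lra.
Qed.

(** * Cauchy's estimate *)

Definition cis (a : R) : C := (cos a, sin a).
Lemma Cmod_cis a : Cmod (cis a) = 1.
Proof.
  unfold Cmod, cis; simpl. replace (_ + _) with 1. apply sqrt_1.
  generalize (sin2_cos2 a). unfold Rsqr. lra.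
Qed.
Lemma cder_cis a : cder cis a (Ci * cis a)%C.
Proof. split; unfold cis, Re, Im; simpl; auto_derive; auto; ring. Qed.
Lemma is_derive_Rconst (c x : R) : is_derive (fun _ : R => c) x 0.
Proof. apply (is_derive_const (K := R_AbsRing) (V := R_NormedModule)). Qed.
Lemma is_derive_Rid (x : R) : is_derive (fun u : R => u) x 1.
Proof. apply (is_derive_id (K := R_AbsRing)). Qed.
Lemma cder_const c s : cder (fun _ => c) s (RtoC 0).
Proof. split; simpl; apply is_derive_Rconst. Qed.
Lemma cder_plus h k s l m : cder h s l -> cder k s m -> cder (fun u => (h u + k u)%C) s (l + m)%C.
Proof.
  intros [H1 H2] [K1 K2]. split; simpl.
  - apply (is_derive_plus _ _ _ _ _ H1 K1).
  - apply (is_derive_plus _ _ _ _ _ H2 K2).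
Qed.
Lemma is_derive_Rmult (f g : R -> R) x a b : is_derive f x a -> is_derive g x b ->
  is_derive (fun u => f u * g u) x (a * g x + f x * b).
Proof. intros F G. apply (is_derive_mult f g x a b F G). intros; apply Rmult_comm. Qed.
Lemma is_derive_Rplus (f g : R -> R) x a b : is_derive f x a -> is_derive g x b ->
  is_derive (fun u => f u + g u) x (a + b).
Proof. intros F G. apply (is_derive_plus f g x a b F G). Qed.
Lemma is_derive_Rminus (f g : R -> R) x a b : is_derive f x a -> is_derive g x b ->
  is_derive (fun u => f u - g u) x (a - b).
Proof. intros F G. apply (is_derive_minus f g x a b F G). Qed.
Lemma is_derive_eq (f : R -> R) x a b : is_derive f x a -> a = b -> is_derive f x b.
Proof. intros H <-; auto. Qed.
Lemma cder_mult h k s l m : cder h s l -> cder k s m ->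
  cder (fun u => (h u * k u)%C) s (l * k s + h s * m)%C.
Proof.
  intros [H1 H2] [K1 K2]. unfold Re, Im in *. split; unfold Re, Im; simpl.
  - eapply is_derive_eq. apply is_derive_Rminus; apply is_derive_Rmult; eassumption. simpl. ring.
  - eapply is_derive_eq. apply is_derive_Rplus; apply is_derive_Rmult; eassumption. simpl. ring.
Qed.
Lemma cder_eq h s l m : cder h s l -> l = m -> cder h s m.
Proof. intros H <-; auto. Qed.

Lemma continuity_2d_polar (l : C -> C) (t0 : C) (x y : R) :
  ccont l (t0 + RtoC x * cis y)%C ->
  continuity_2d_pt (fun u v => Re (l (t0 + RtoC u * cis v)%C)) x y.
Proof.
  intros H eps.
  destruct (H eps (cond_pos eps)) as [d [P Q]].
  assert (Hd : 0 < d / 2) by lra.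
  assert (C1 : continuity_2d_pt (fun u v => u * cos v) x y).
  { apply continuity_2d_pt_mult. apply continuity_2d_pt_id1.
    apply continuity_1d_2d_pt_comp with (f := cos). apply continuity_cos. apply continuity_2d_pt_id2. }
  assert (C2 : continuity_2d_pt (fun u v => u * sin v) x y).
  { apply continuity_2d_pt_mult. apply continuity_2d_pt_id1.
    apply continuity_1d_2d_pt_comp with (f := sin). apply continuity_sin. apply continuity_2d_pt_id2. }
  specialize (C1 (mkposreal _ Hd)). specialize (C2 (mkposreal _ Hd)).
  generalize (locally_2d_and _ _ _ _ C1 C2). apply locally_2d_impl. apply locally_2d_forall.
  intros u v [A B]. simpl in A, B.
  assert (E : Cmod (t0 + RtoC u * cis v - (t0 + RtoC x * cis y)) < d).
  { eapply Rle_lt_trans. apply Cmod_le_ReIm. unfold Re, Im, cis; simpl.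
    replace (fst t0 + _ + - _) with (u * cos v - x * cos y) by ring.
    replace (snd t0 + _ + - _) with (u * sin v - x * sin y) by ring. lra. }
  specialize (Q _ E). eapply Rle_lt_trans; [|exact Q].
  eapply Rle_trans; [|apply Rabs_Re_le]. right. reflexivity.
Qed.

Section Cauchy.
Variables (h l : C -> C) (t0 : C) (R1 : R).
Hypothesis Hh : forall u, Cmod (u - t0) < R1 -> hol h u (l u).
Hypothesis Hl : forall u, Cmod (u - t0) < R1 -> ccont l u.
Let pol (u v : R) : C := (t0 + RtoC u * cis v)%C.
(** The factor e^{-iv} selects the first Fourier coefficient of h on the circle of radius u, which
    is h'(t0) u. It is computed without contour integrals: the integral I of [f] over v satisfies u
    I' = I. *)
Let f (u v : R) : R := Re (h (pol u v) * cis (- v)).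
Let gg (u v : R) : R := Im (h (pol u v) * cis (- v)).
Lemma pol_in u v : Rabs u < R1 -> Cmod (pol u v - t0) < R1.
Proof.
  intros H. unfold pol. replace (_ - _)%C with (RtoC u * cis v)%C by ring.
  rewrite Cmod_mult, Cmod_cis, Cmod_R, Rmult_1_r. auto.
Qed.
Lemma cis_opp v : (cis v * cis (- v))%C = RtoC 1.
Proof.
  unfold cis, Cmult, RtoC; simpl. rewrite cos_neg, sin_neg. apply injective_projections; simpl.
  - generalize (sin2_cos2 v). unfold Rsqr. lra.
  - ring.
Qed.
Lemma cder_cis_opp v : cder (fun w => cis (- w)) v (- (Ci * cis (- v)))%C.
Proof. split; unfold cis, Re, Im; simpl; auto_derive; auto; ring. Qed.
Lemma f_du u v : Rabs u < R1 -> is_derive (fun z => f z v) u (Re (l (pol u v))).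
Proof.
  intros H. assert (X : cder (fun z => (h (pol z v) * cis (- v))%C) u (l (pol u v))).
  { assert (P : cder (fun z => pol z v) u (cis v)).
    { eapply cder_eq. unfold pol. apply cder_plus. apply cder_const. apply cder_mult with (l := RtoC 1).
      split; unfold Re, Im; simpl. apply is_derive_Rid. apply is_derive_Rconst. apply cder_const. cbv beta; ring. }
    eapply cder_eq. apply cder_mult. apply cder_hol_comp with (v := cis v) (l := l (pol u v)). apply Hh. apply pol_in; auto.
    exact P. apply cder_const.
    cbv beta; rewrite <- Cmult_assoc, cis_opp. ring. }
  apply X.
Qed.
(** The v-derivative brings down i u h' from h and - i h e^{-iv} from the exponential; its imaginary
    part is the integrand of u J - I. *)
Lemma hc_dv u v : Rabs u < R1 ->
  cder (fun w => (h (pol u w) * cis (- w))%C) v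
    (Ci * (RtoC u * l (pol u v) - h (pol u v) * cis (- v)))%C.
Proof.
  intros H.
  eapply cder_eq. apply cder_mult. apply cder_hol_comp. apply Hh. apply pol_in; auto.
  unfold pol. apply cder_plus. apply cder_const. apply cder_mult. apply cder_const. apply cder_cis.
  apply cder_cis_opp. cbv beta. fold (pol u v).
  transitivity (Ci * (RtoC u * l (pol u v)) * (cis v * cis (-v)) + - (Ci * (h (pol u v) * cis (- v))))%C.
  ring. rewrite cis_opp. ring.
Qed.
Lemma gg_dv u v : Rabs u < R1 -> is_derive (fun w => gg u w) v (u * Re (l (pol u v)) - f u v).
Proof.
  intros H. destruct (hc_dv u v H) as [_ X]. eapply is_derive_eq. apply X.
  unfold f, Im, Re; simpl. ring.
Qed.
Lemma f_cont u v : Rabs u < R1 -> continuous (fun w => f u w) v.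
Proof. intros H. destruct (hc_dv u v H) as [X _]. apply (ex_derive_continuous (V := R_NormedModule)). eexists. apply X. Qed.
Lemma l_cont u v : Rabs u < R1 -> continuous (fun w => Re (l (pol u w))) v.
Proof.
  intros H. apply continuity_pt_filterlim. intros e He.
  destruct (continuity_2d_polar l t0 u v (Hl _ (pol_in u v H)) (mkposreal e He)) as [d D].
  exists d. split. apply cond_pos. intros w [_ W]. unfold R_dist in *. simpl in *. unfold R_dist in W.
  apply D. rewrite Rminus_diag, Rabs_R0. apply cond_pos. auto.
Qed.
Let I (u : R) : R := RInt (fun v => f u v) 0 (2 * PI).
Let J (u : R) : R := RInt (fun v => Re (l (pol u v))) 0 (2 * PI).
Lemma near_lt u : Rabs u < R1 -> locally u (fun z => Rabs z < R1).
Proof.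
  intros H. assert (P : 0 < R1 - Rabs u) by lra. exists (mkposreal _ P). intros z Z.
  unfold ball in Z; simpl in Z; unfold AbsRing_ball, abs, minus, plus, opp in Z; simpl in Z.
  replace z with (u + (z + - u)) by ring. eapply Rle_lt_trans. apply Rabs_triang. lra.
Qed.
(** Differentiation under the integral sign, justified by the joint continuity of Re l in polar
    coordinates. *)
Lemma I_der u : Rabs u < R1 -> is_derive I u (J u).
Proof.
  intros H.
  assert (D : forall z v, Rabs z < R1 -> Derive (fun w => f w v) z = Re (l (pol z v))).
  { intros z v Z. apply is_derive_unique. apply f_du; auto. }
  eapply is_derive_eq. apply (is_derive_RInt_param f 0 (2 * PI) u).
  - eapply filter_imp. 2: apply (near_lt u H). intros z Z v _. eexists. apply f_du; auto.
  - intros v _. apply continuity_2d_pt_ext_loc with (f := fun u v => Re (l (pol u v))).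
    + assert (P : 0 < R1 - Rabs u) by lra. exists (mkposreal _ P). intros z w Z _. simpl in Z. symmetry. apply D.
      replace z with (u + (z - u)) by ring. eapply Rle_lt_trans. apply Rabs_triang. lra.
    + apply continuity_2d_polar. apply Hl. apply (pol_in u v H).
  - eapply filter_imp. 2: apply (near_lt u H). intros z Z. apply (ex_RInt_continuous (V := R_CompleteNormedModule)).
    intros v _. apply f_cont; auto.
  - unfold J. apply RInt_ext. intros v _. apply D; auto.
Qed.
(** [gg] has period 2 PI in v, so its derivative integrates to zero over a period. *)
Lemma gg_int u : Rabs u < R1 -> u * J u = I u.
Proof.
  intros H.
  assert (E : is_RInt (fun v => u * Re (l (pol u v)) - f u v) 0 (2 * PI) (minus (gg u (2 * PI)) (gg u 0))).
  { apply (is_RInt_derive (V := R_CompleteNormedModule)).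
    - intros v _. apply gg_dv; auto.
    - intros v _. apply (continuous_minus (V := R_NormedModule)).
      apply (continuous_scal_r (K := R_AbsRing) (V := R_NormedModule)). apply l_cont; auto. apply f_cont; auto. }
  assert (G : gg u (2 * PI) = gg u 0).
  { unfold gg, pol, cis. rewrite !cos_neg, !sin_neg, cos_2PI, sin_2PI, cos_0, sin_0. auto. }
  rewrite G in E. apply (is_RInt_unique (V := R_CompleteNormedModule)) in E.
  assert (E1 : ex_RInt (fun v => f u v) 0 (2 * PI)).
  { apply (ex_RInt_continuous (V := R_CompleteNormedModule)). intros; apply f_cont; auto. }
  assert (E2 : ex_RInt (fun v => Re (l (pol u v))) 0 (2 * PI)).
  { apply (ex_RInt_continuous (V := R_CompleteNormedModule)). intros; apply l_cont; auto. }
  assert (E3 : RInt (fun v => u * Re (l (pol u v)) - f u v) 0 (2 * PI) = u * J u - I u).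
  { apply (is_RInt_unique (V := R_CompleteNormedModule)). apply (is_RInt_minus (V := R_NormedModule)).
    - apply (is_RInt_scal (V := R_NormedModule)). apply (RInt_correct (V := R_CompleteNormedModule)); auto.
    - apply (RInt_correct (V := R_CompleteNormedModule)); auto. }
  rewrite E3 in E. unfold minus, plus, opp in E; simpl in E. lra.
Qed.
(** By u I' = I the quotient I/u is constant for u > 0, and its limit at 0 is I'(0) = J 0. *)
Lemma I_lin R0 : 0 < R0 < R1 -> I R0 = J 0 * R0.
Proof.
  intros [P Q].
  assert (HI0 : I 0 = 0). { assert (E := gg_int 0). rewrite Rabs_R0 in E. specialize (E ltac:(lra)). lra. }
  assert (K : forall u, 0 < u <= R0 -> I u / u = I R0 / R0).
  { intros u [U1 U2]. destruct (Req_dec u R0) as [->|N]; auto.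
    destruct (MVT_gen (fun z => I z / z) u R0 (fun _ => 0)) as [c [_ E]].
    - rewrite Rmin_left, Rmax_right by lra. intros z [Z1 Z2].
      assert (Rabs z < R1) by (rewrite Rabs_pos_eq; lra).
      assert (Nz : z <> 0) by lra.
      assert (X := is_derive_div I (fun z => z) z (J z) 1 (I_der z H) (is_derive_Rid z) Nz).
      eapply is_derive_eq. exact X. rewrite <- (gg_int z H). match goal with |- ?a = ?b => change (@eq R a b) end. field. auto.
    - rewrite Rmin_left, Rmax_right by lra. intros z [Z1 Z2].
      assert (Rabs z < R1) by (rewrite Rabs_pos_eq; lra).
      apply continuity_pt_filterlim. apply (ex_derive_continuous (V := R_NormedModule) (fun z : R => I z / z) z).
      assert (Nz : z <> 0) by lra.
      assert (X := is_derive_div I (fun z => z) z (J z) 1 (I_der z H) (is_derive_Rid z) Nz).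
      exact (ex_intro _ _ X).
    - lra. }
  assert (D := I_der 0). rewrite Rabs_R0 in D. specialize (D ltac:(lra)). rewrite is_derive_eps in D.
  assert (X : I R0 / R0 = J 0).
  { apply NNPP. intro N. set (q := Rabs (I R0 / R0 - J 0)).
    assert (0 < q) by (apply Rabs_pos_lt; lra).
    destruct (D (q/2)) as [d [P1 Q1]]. lra.
    set (u := Rmin R0 (d / 2)). assert (U : 0 < u) by (apply Rmin_pos; lra).
    assert (U1 : u <= R0) by apply Rmin_l. assert (U2 : u <= d/2) by apply Rmin_r.
    specialize (Q1 u). rewrite Rminus_0_r, HI0 in Q1. rewrite Rabs_pos_eq in Q1 at 1 by lra.
    specialize (Q1 ltac:(lra)).
    replace (I u - 0 - J 0 * u) with ((I u / u - J 0) * u) in Q1 by (field; lra).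
    rewrite K in Q1 by lra. rewrite Rabs_mult in Q1. fold q in Q1.
    rewrite (Rabs_pos_eq u) in Q1 by lra. nra. }
  rewrite <- X. field. lra.
Qed.
Lemma cauchy_re R0 M : 0 < R0 < R1 -> (forall u, Cmod (u - t0) = R0 -> Cmod (h u) <= M) ->
  Re (l t0) * R0 <= M.
Proof.
  intros HR HM. generalize (I_lin R0 HR). intro E.
  assert (J0 : J 0 = 2 * PI * Re (l t0)).
  { unfold J. rewrite RInt_ext with (g := fun _ => Re (l t0)).
    rewrite RInt_const. unfold scal; simpl; unfold mult; simpl. ring.
    intros v _. unfold pol. f_equal. f_equal. ring. }
  assert (B : I R0 <= 2 * PI * M).
  { replace (2 * PI * M) with (RInt (fun _ => M) 0 (2 * PI)).
    2:{ rewrite RInt_const. unfold scal; simpl; unfold mult; simpl. ring. }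
    assert (Rabs R0 < R1) by (rewrite Rabs_pos_eq; lra).
    apply RInt_le. generalize PI_RGT_0; lra.
    apply (ex_RInt_continuous (V := R_CompleteNormedModule)). intros; apply f_cont; auto.
    apply ex_RInt_const.
    intros v _. unfold f. eapply Rle_trans. apply Rle_abs. eapply Rle_trans. apply Rabs_Re_le.
    rewrite Cmod_mult, Cmod_cis, Rmult_1_r. apply HM. unfold pol.
    replace (_ - _)%C with (RtoC R0 * cis v)%C by ring.
    rewrite Cmod_mult, Cmod_cis, Cmod_R, Rmult_1_r. apply Rabs_pos_eq; lra. }
  rewrite E, J0 in B. generalize PI_RGT_0; intro.
  apply Rmult_le_reg_l with (2 * PI); lra.
Qed.
End Cauchy.

Lemma cauchy_estimate (h l : C -> C) (t0 : C) (R1 R0 M : R) :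
  (forall u, Cmod (u - t0) < R1 -> hol h u (l u)) ->
  (forall u, Cmod (u - t0) < R1 -> ccont l u) ->
  0 < R0 < R1 -> (forall u, Cmod (u - t0) = R0 -> Cmod (h u) <= M) ->
  Cmod (l t0) * R0 <= M.
Proof.
  intros Hh Hl HR HM.
  destruct (Req_dec (Cmod (l t0)) 0) as [E|E].
  { rewrite E, Rmult_0_l. eapply Rle_trans. apply Cmod_ge_0. apply (HM (t0 + RtoC R0)%C).
    replace (_ - _)%C with (RtoC R0) by ring. rewrite Cmod_R. apply Rabs_pos_eq; lra. }
  assert (P : 0 < Cmod (l t0)) by (generalize (Cmod_ge_0 (l t0)); lra).
  (* Multiplying h by this unimodular number makes its derivative at t0 real and equal to its
     modulus, so the bound on the real part suffices. *)
  set (w := (Cconj (l t0) / RtoC (Cmod (l t0)))%C).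
  assert (NZ : RtoC (Cmod (l t0)) <> RtoC 0) by (intro Z; apply E; injection Z; auto).
  assert (W : Cmod w = 1).
  { unfold w. rewrite Cmod_div by auto. rewrite Cmod_conj, Cmod_R, Rabs_pos_eq by lra. field; auto. }
  replace (Cmod (l t0)) with (Re (w * l t0)).
  2:{ assert (X : (w * l t0)%C = RtoC (Cmod (l t0))).
      { unfold w. transitivity (l t0 * Cconj (l t0) / RtoC (Cmod (l t0)))%C. field; auto.
        rewrite <- Cmod2_conj. simpl. rewrite Rmult_1_r, RtoC_mult. field; auto. }
      rewrite X. reflexivity. }
  apply (cauchy_re (fun u => (w * h u)%C) (fun u => (w * l u)%C) t0 R1); auto.
  - intros u Hu. replace (w * l u)%C with (RtoC 0 * h u + w * l u)%C by ring.
    apply (hol_mult (fun _ => w) h). apply hol_const. auto.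
  - intros u Hu e He. destruct (Hl u Hu e He) as [d [P1 Q1]]. exists d; split; auto.
    intros z Z. replace (w * l z - w * l u)%C with (w * (l z - l u))%C by ring.
    rewrite Cmod_mult, W, Rmult_1_l. auto.
  - intros u Hu. rewrite Cmod_mult, W, Rmult_1_l. auto.
Qed.

(** * Contact along a family of tangent circles *)

Ltac rring := match goal with |- @eq _ ?a ?b => change (@eq R a b) end; cbv beta; ring.
Lemma is_derive_evR (F : pexpr R) (a b : R -> R) (u la lb : R) : is_derive a u la -> is_derive b u lb ->
  is_derive (fun w => evR F (a w) (b w)) u
    (evR (dxR F) (a u) (b u) * la + evR (dyR F) (a u) (b u) * lb).
Proof.
  intros Ha Hb. induction F; simpl.
  - eapply is_derive_eq. apply is_derive_Rconst. rring.
  - eapply is_derive_eq. exact Ha. rring.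
  - eapply is_derive_eq. exact Hb. rring.
  - eapply is_derive_eq. apply is_derive_Rplus; eassumption. rring.
  - eapply is_derive_eq. apply is_derive_Rmult; eassumption. rring.
Qed.
Lemma is_derive_ext_unique (f g : R -> R) (x a b : R) :
  (forall t, f t = g t) -> is_derive f x a -> is_derive g x b -> a = b.
Proof.
  intros E A B. rewrite <- (is_derive_unique _ _ _ A), <- (is_derive_unique _ _ _ B).
  apply Derive_ext; auto.
Qed.
(** The formal derivative computes the true partial derivative, which depends on the values only. *)
Lemma evR_ext_dx F G : (forall x y, evR F x y = evR G x y) -> forall x y, evR (dxR F) x y = evR (dxR G) x y.
Proof.
  intros H x y.
  assert (A := is_derive_evR F (fun u => u) (fun _ => y) x 1 0 (is_derive_Rid x) (is_derive_Rconst y x)).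
  assert (B := is_derive_evR G (fun u => u) (fun _ => y) x 1 0 (is_derive_Rid x) (is_derive_Rconst y x)).
  assert (E := is_derive_ext_unique (fun w => evR F w y) (fun w => evR G w y) _ _ _ (fun w => H w y) A B). lra.
Qed.
Lemma evR_ext_dy F G : (forall x y, evR F x y = evR G x y) -> forall x y, evR (dyR F) x y = evR (dyR G) x y.
Proof.
  intros H x y.
  assert (A := is_derive_evR F (fun _ => x) (fun u => u) y 0 1 (is_derive_Rconst x y) (is_derive_Rid y)).
  assert (B := is_derive_evR G (fun _ => x) (fun u => u) y 0 1 (is_derive_Rconst x y) (is_derive_Rid y)).
  assert (E := is_derive_ext_unique (fun w => evR F x w) (fun w => evR G x w) _ _ _ (fun w => H x w) A B). lra.
Qed.
Lemma evR_dxdy F x y : evR (dxR (dyR F)) x y = evR (dyR (dxR F)) x y.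
Proof. induction F; simpl; try reflexivity; rewrite ?IHF1, ?IHF2; ring. Qed.

(** * Smooth functions of s and jets in the angle *)

Lemma smooth_Derive f : smooth_fun f -> smooth_fun (Derive f).
Proof.
  intros H n s. apply ex_derive_ext with (f := Derive_n f (S n)).
  - intros t. change (Derive f) with (Derive_n f 1). rewrite Derive_n_comp. f_equal. lia.
  - apply H.
Qed.
Lemma smooth_ex f : smooth_fun f -> forall s, ex_derive f s.
Proof. intros H s. apply (H 0%nat s). Qed.
Lemma smooth_intro (f : R -> R) df : (forall s, is_derive f s (df s)) -> smooth_fun df -> smooth_fun f.
Proof.
  intros H D n s. destruct n. eexists; apply H.
  apply ex_derive_ext with (f := Derive_n df n).
  - intros t. assert (E : forall m t, Derive_n f (S m) t = Derive_n df m t).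
    { intro m. induction m; intro u. apply is_derive_unique, H.
      change (Derive (Derive_n f (S m)) u = Derive (Derive_n df m) u). apply Derive_ext. auto. }
    symmetry; apply E.
  - apply D.
Qed.
Lemma smooth_const c : smooth_fun (fun _ => c).
Proof.
  assert (Z : smooth_fun (fun _ => 0)).
  { intros n s. apply ex_derive_ext with (f := fun _ => 0). 2: eexists; apply is_derive_Rconst.
    intros t. symmetry. destruct n. reflexivity. apply Derive_n_const. }
  apply smooth_intro with (2 := Z). intros; apply is_derive_Rconst.
Qed.
Lemma smooth_scal c f : smooth_fun f -> smooth_fun (fun s => c * f s).
Proof.
  intros H n s. apply ex_derive_ext with (f := fun t => c * Derive_n f n t).
  intros t. symmetry. apply Derive_n_scal_l.
  apply ex_derive_scal. apply H.
Qed.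

(** Expressions in cos a, sin a and smooth functions of the curve parameter s, with the
    formal derivations in a and s. *)
Inductive sx : Type := SF (f : R -> R) | SC | SS | SA (a b : sx) | SM (a b : sx).
Fixpoint sev (e : sx) (s a : R) : R :=
  match e with
  | SF f => f s | SC => cos a | SS => sin a
  | SA e1 e2 => sev e1 s a + sev e2 s a
  | SM e1 e2 => sev e1 s a * sev e2 s a
  end.
Fixpoint Da (e : sx) : sx :=
  match e with
  | SF _ => SF (fun _ => 0) | SC => SM (SF (fun _ => -1)) SS | SS => SC
  | SA e1 e2 => SA (Da e1) (Da e2)
  | SM e1 e2 => SA (SM (Da e1) e2) (SM e1 (Da e2))
  end.
Fixpoint Ds (e : sx) : sx :=
  match e with
  | SF f => SF (Derive f) | SC => SF (fun _ => 0) | SS => SF (fun _ => 0)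
  | SA e1 e2 => SA (Ds e1) (Ds e2)
  | SM e1 e2 => SA (SM (Ds e1) e2) (SM e1 (Ds e2))
  end.
Fixpoint sx_smooth (e : sx) : Prop :=
  match e with
  | SF f => smooth_fun f | SC => True | SS => True
  | SA e1 e2 => sx_smooth e1 /\ sx_smooth e2
  | SM e1 e2 => sx_smooth e1 /\ sx_smooth e2
  end.
Lemma sx_smooth_Da e : sx_smooth e -> sx_smooth (Da e).
Proof. induction e; simpl; intuition auto using smooth_const. Qed.
Lemma sev_da e s a : is_derive (fun a => sev e s a) a (sev (Da e) s a).
Proof.
  induction e; simpl.
  - apply is_derive_Rconst.
  - auto_derive; auto; ring.
  - auto_derive; auto; ring.
  - apply is_derive_Rplus; auto.
  - apply is_derive_Rmult; auto.
Qed.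
Lemma sev_ds e (s a : R) : sx_smooth e -> is_derive (fun s => sev e s a) s (sev (Ds e) s a).
Proof.
  induction e; simpl; intros W.
  - apply Derive_correct. apply smooth_ex; auto.
  - apply is_derive_Rconst.
  - apply is_derive_Rconst.
  - apply (is_derive_Rplus (fun s => sev e1 s a) (fun s => sev e2 s a)); tauto.
  - apply (is_derive_Rmult (fun s => sev e1 s a) (fun s => sev e2 s a)); tauto.
Qed.
Lemma sev_DaDs e s a : sev (Da (Ds e)) s a = sev (Ds (Da e)) s a.
Proof.
  induction e; simpl; rewrite ?Derive_const; try ring.
  - rewrite IHe1, IHe2; ring.
  - rewrite IHe1, IHe2; ring.
Qed.
Definition sx_eq (e1 e2 : sx) : Prop := forall s a, sev e1 s a = sev e2 s a.
Lemma sx_eq_Da e1 e2 : sx_eq e1 e2 -> sx_eq (Da e1) (Da e2).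
Proof.
  intros H s a. apply (is_derive_ext_unique (fun a => sev e1 s a) (fun a => sev e2 s a) a); auto using sev_da.
Qed.
Lemma sx_eq_Ds e1 e2 : sx_smooth e1 -> sx_smooth e2 -> sx_eq e1 e2 -> sx_eq (Ds e1) (Ds e2).
Proof.
  intros W1 W2 H s a. apply (is_derive_ext_unique (fun s => sev e1 s a) (fun s => sev e2 s a) s); auto using sev_ds.
Qed.

Fixpoint jet (i : nat) (e : sx) (s : R) : R :=
  match i with O => sev e s 0 | S i => jet i (Da e) s end.
Lemma jet_ext i : forall e1 e2, sx_eq e1 e2 -> forall s, jet i e1 s = jet i e2 s.
Proof. induction i; simpl; intros; auto. apply IHi. apply sx_eq_Da; auto. Qed.
Lemma jet_SA i : forall e1 e2 s, jet i (SA e1 e2) s = jet i e1 s + jet i e2 s.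
Proof. induction i; simpl; intros; auto. Qed.
Lemma jet_SF i : forall f e s, jet i (SM (SF f) e) s = f s * jet i e s.
Proof.
  induction i; simpl; intros; auto. rewrite <- IHi. apply jet_ext. intros u a; simpl. ring.
Qed.
Lemma jet_ds i : forall e s, sx_smooth e -> is_derive (fun s => jet i e s) s (jet i (Ds e) s).
Proof.
  induction i; simpl; intros e s W. apply sev_ds; auto.
  rewrite (jet_ext i (Da (Ds e)) (Ds (Da e))). apply IHi. apply sx_smooth_Da; auto.
  intros u a; apply sev_DaDs.
Qed.
Definition jets_vanish (m : nat) (e : sx) : Prop := forall i, (i < m)%nat -> forall s, jet i e s = 0.
Lemma jets_vanish_le m n e : (m <= n)%nat -> jets_vanish n e -> jets_vanish m e.
Proof. intros L H i Hi. apply H. lia. Qed.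
Lemma jets_vanish_Da m e : jets_vanish (S m) e -> jets_vanish m (Da e).
Proof. intros H i Hi. apply (H (S i)). lia. Qed.
Lemma jets_vanish_Ds m e : sx_smooth e -> jets_vanish m e -> jets_vanish m (Ds e).
Proof.
  intros W H i Hi s. apply (is_derive_ext_unique (fun s => jet i e s) (fun _ => 0) s); auto using jet_ds, is_derive_Rconst.
Qed.
Lemma jets_vanish_SA m e1 e2 : jets_vanish m e1 -> jets_vanish m e2 -> jets_vanish m (SA e1 e2).
Proof. intros A B i Hi s. rewrite jet_SA, A, B by auto. ring. Qed.
Lemma jets_vanish_SF m f e : jets_vanish m e -> jets_vanish m (SM (SF f) e).
Proof. intros A i Hi s. rewrite jet_SF, A by auto. ring. Qed.
Lemma jets_vanish_ext m e1 e2 : sx_eq e1 e2 -> jets_vanish m e1 -> jets_vanish m e2.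
Proof. intros E A i Hi s. rewrite <- (jet_ext i _ _ E). auto. Qed.

Lemma jet_S_SC i e s : jet (S i) (SM SC e) s = - jet i (SM SS e) s + jet i (SM SC (Da e)) s.
Proof.
  simpl. rewrite jet_SA. f_equal.
  rewrite <- (Rmult_1_l (jet i (SM SS e) s)), <- Ropp_mult_distr_l_reverse, <- (jet_SF i (fun _ => -1)).
  apply jet_ext. intros u a; simpl; ring.
Qed.
Lemma jet_S_SS i e s : jet (S i) (SM SS e) s = jet i (SM SC e) s + jet i (SM SS (Da e)) s.
Proof. simpl. rewrite jet_SA. auto. Qed.

(** cos a = 1 + O(a^2) preserves the first two jets that may be nonzero, while sin a = a + O(a^3)
    shifts them by one order and multiplies them by the new order. Only these two jets enter the
    contact relations. *)
Lemma jet_SC_SS m : forall e, jets_vanish m e ->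
  jets_vanish m (SM SC e) /\ jets_vanish (S m) (SM SS e) /\
  forall s, jet m (SM SC e) s = jet m e s /\ jet (S m) (SM SC e) s = jet (S m) e s /\
    jet (S m) (SM SS e) s = INR (S m) * jet m e s /\
    jet (S (S m)) (SM SS e) s = INR (S (S m)) * jet (S m) e s.
Proof.
  induction m; intros e H.
  - assert (A0 : forall e s, jet 0 (SM SC e) s = jet 0 e s) by (intros; simpl; rewrite cos_0; ring).
    assert (B0 : forall e s, jet 0 (SM SS e) s = 0) by (intros; simpl; rewrite sin_0; ring).
    assert (A1 : forall e s, jet 1 (SM SC e) s = jet 1 e s).
    { intros. rewrite jet_S_SC, A0, B0. simpl. ring. }
    assert (B1 : forall e s, jet 1 (SM SS e) s = jet 0 e s).
    { intros. rewrite jet_S_SS, A0, B0. ring. }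
    split; [|split]. intros i Hi; lia. intros i Hi s. replace i with 0%nat by lia. apply B0.
    intros s. repeat split; auto. rewrite B1. simpl. ring.
    rewrite jet_S_SS, A1, B1. simpl. ring.
  - assert (Hm : jets_vanish m e) by (apply jets_vanish_le with (2 := H); lia).
    assert (Hd := jets_vanish_Da _ _ H).
    destruct (IHm e Hm) as [C1 [S1 J1]]. destruct (IHm (Da e) Hd) as [C2 [S2 J2]].
    assert (VC : jets_vanish (S m) (SM SC e)).
    { intros i Hi s. destruct i. simpl. generalize (H 0%nat Hi s). simpl. intros ->. ring.
      rewrite jet_S_SC, S1, C2 by lia. ring. }
    assert (Z : forall s, jet m e s = 0) by (intros; apply H; lia).
    split; auto. split.
    { intros i Hi s. destruct i. simpl. rewrite sin_0; ring.
      rewrite jet_S_SS, VC, S2 by lia. ring. }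
    intros s. destruct (J1 s) as [a1 [a2 [a3 a4]]]. destruct (J2 s) as [b1 [b2 [b3 b4]]].
    assert (E1 : jet (S m) (SM SC e) s = jet (S m) e s).
    { rewrite jet_S_SC, b1, S1 by lia. simpl. ring. }
    assert (E2 : jet (S (S m)) (SM SC e) s = jet (S (S m)) e s).
    { rewrite jet_S_SC, b2, a3, Z by lia. simpl. ring. }
    repeat split; auto.
    rewrite jet_S_SS, E2, b4. change (jet (S m) (Da e) s) with (jet (S (S m)) e s). rewrite !S_INR. ring.
Qed.
Lemma jets_vanish_SS_inv m e : jets_vanish (S m) (SM SS e) -> jets_vanish m e.
Proof.
  induction m; intros H. intros i Hi; lia.
  assert (V : jets_vanish m e) by (apply IHm; apply jets_vanish_le with (2 := H); lia).
  intros i Hi s. destruct (Nat.eq_dec i m) as [->|N]. 2: apply V; lia.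
  destruct (jet_SC_SS m e V) as [_ [_ J]]. destruct (J s) as [_ [_ [E _]]].
  rewrite (H (S m)) in E by lia. assert (INR (S m) <> 0) by (apply not_0_INR; lia).
  symmetry in E. apply Rmult_integral in E. tauto.
Qed.

(** * Polynomials along the families of circles *)

Fixpoint ssub (F : pexpr R) (cx cy : sx) : sx :=
  match F with
  | PC c => SF (fun _ => c) | PX => cx | PY => cy
  | PA a b => SA (ssub a cx cy) (ssub b cx cy)
  | PM a b => SM (ssub a cx cy) (ssub b cx cy)
  end.
Lemma sev_ssub F cx cy s a : sev (ssub F cx cy) s a = evR F (sev cx s a) (sev cy s a).
Proof. induction F; simpl; congruence. Qed.
Lemma sx_smooth_ssub F cx cy : sx_smooth cx -> sx_smooth cy -> sx_smooth (ssub F cx cy).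
Proof. intros; induction F; simpl; auto using smooth_const. Qed.
Lemma Da_ssub F cx cy s a : sev (Da (ssub F cx cy)) s a =
  evR (dxR F) (sev cx s a) (sev cy s a) * sev (Da cx) s a +
  evR (dyR F) (sev cx s a) (sev cy s a) * sev (Da cy) s a.
Proof. induction F; simpl; rewrite ?IHF1, ?IHF2, ?sev_ssub; ring. Qed.
Lemma Ds_ssub F cx cy s a : sev (Ds (ssub F cx cy)) s a =
  evR (dxR F) (sev cx s a) (sev cy s a) * sev (Ds cx) s a +
  evR (dyR F) (sev cx s a) (sev cy s a) * sev (Ds cy) s a.
Proof. induction F; simpl; rewrite ?Derive_const, ?IHF1, ?IHF2, ?sev_ssub; ring. Qed.

(** The Frenet equations of a curve parametrised by arc length, with tangent (t1, t2), normal (- t2,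
    t1) and curvature kk. The curvature will be differentiated once. *)
Record frame (z1 z2 t1 t2 kk : R -> R) : Prop := {
  fr_s1 : smooth_fun z1; fr_s2 : smooth_fun z2;
  fr_z1 : forall s, is_derive z1 s (t1 s);
  fr_z2 : forall s, is_derive z2 s (t2 s);
  fr_t1 : forall s, is_derive t1 s (- kk s * t2 s);
  fr_t2 : forall s, is_derive t2 s (kk s * t1 s);
  fr_u : forall s, t1 s ^ 2 + t2 s ^ 2 = 1;
  fr_k : forall s, ex_derive kk s
}.

Section Curve.
Variables (z1 z2 t1 t2 kk : R -> R) (r : R).
Hypothesis Fr : frame z1 z2 t1 t2 kk.
Hypothesis r0 : 0 < r.

Lemma smooth_t1 : smooth_fun t1.
Proof.
  intros n s. apply ex_derive_ext with (f := Derive_n (Derive z1) n).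
  intros t. apply Derive_n_ext. intros u. apply is_derive_unique, Fr.
  apply smooth_Derive, Fr.
Qed.
Lemma smooth_t2 : smooth_fun t2.
Proof.
  intros n s. apply ex_derive_ext with (f := Derive_n (Derive z2) n).
  intros t. apply Derive_n_ext. intros u. apply is_derive_unique, Fr.
  apply smooth_Derive, Fr.
Qed.
Lemma D_z1 s : Derive z1 s = t1 s. Proof. apply is_derive_unique, Fr. Qed.
Lemma D_z2 s : Derive z2 s = t2 s. Proof. apply is_derive_unique, Fr. Qed.
Lemma D_t1 s : Derive t1 s = - kk s * t2 s. Proof. apply is_derive_unique, Fr. Qed.
Lemma D_t2 s : Derive t2 s = kk s * t1 s. Proof. apply is_derive_unique, Fr. Qed.
Let n1 (s : R) := -1 * t2 s.
Lemma D_n1 s : Derive n1 s = - kk s * t1 s.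
Proof. unfold n1. rewrite Derive_scal, D_t2. ring. Qed.
Lemma smooth_n1 : smooth_fun n1.
Proof. apply smooth_scal, smooth_t2. Qed.

Section Side.
Variable ep : R.
Hypothesis ep2 : ep * ep = 1.

(** For a velocity at angle a to the tangent, (cx, cy) is its positive Larmor centre if ep = 1, and
    the negative Larmor centre of the reflected velocity if ep = -1. *)
Definition cx : sx := SA (SF z1) (SA (SM (SF (fun _ => r * ep)) (SM (SF n1) SC)) (SM (SF (fun _ => - r)) (SM (SF t1) SS))).
Definition cy : sx := SA (SF z2) (SA (SM (SF (fun _ => r * ep)) (SM (SF t1) SC)) (SM (SF (fun _ => - r)) (SM (SF t2) SS))).
Lemma sx_smooth_cx : sx_smooth cx.
Proof. simpl. generalize smooth_t1 smooth_t2 smooth_n1 (fr_s1 _ _ _ _ _ Fr). intuition auto using smooth_const. Qed.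
Lemma sx_smooth_cy : sx_smooth cy.
Proof. simpl. generalize smooth_t1 smooth_t2 smooth_n1 (fr_s2 _ _ _ _ _ Fr). intuition auto using smooth_const. Qed.

Lemma sev_cx s a : sev cx s a = z1 s + r * (ep * n1 s * cos a - t1 s * sin a).
Proof. simpl. ring. Qed.
Lemma sev_cy s a : sev cy s a = z2 s + r * (ep * t1 s * cos a - t2 s * sin a).
Proof. simpl. ring. Qed.
Lemma Da_cx s a : sev (Da cx) s a = - r * (ep * sin a * n1 s + cos a * t1 s).
Proof. simpl. ring. Qed.
Lemma Da_cy s a : sev (Da cy) s a = - r * (ep * sin a * t1 s + cos a * t2 s).
Proof. simpl. ring. Qed.
(** The frame turns at rate kk as s grows; changing the angle at rate ep kk undoes the turning, and
    only the translation along the tangent remains. *)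
Lemma Ds_cx s a : sev (Ds cx) s a - ep * kk s * sev (Da cx) s a = t1 s.
Proof.
  rewrite Da_cx. simpl. rewrite !Derive_const, D_z1, D_n1, D_t1. unfold n1.
  replace (r * ep * (- kk s * t1 s * cos a + -1 * t2 s * 0)) with (- (r * ep * kk s * t1 s * cos a)) by ring.
  replace (- ep * kk s) with (- (ep * kk s)) by ring.
  transitivity (t1 s + (ep * ep - 1) * r * kk s * sin a * n1 s).
  unfold n1. ring. rewrite ep2. ring.
Qed.
Lemma Ds_cy s a : sev (Ds cy) s a - ep * kk s * sev (Da cy) s a = t2 s.
Proof.
  rewrite Da_cy. simpl. rewrite !Derive_const, D_z2, D_t1, D_t2.
  transitivity (t2 s + (ep * ep - 1) * r * kk s * sin a * t1 s).
  ring. rewrite ep2. ring.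
Qed.

Local Opaque cx cy.

(** Along the circle [(cx, cy)]: the [j]-th derivative of [F] in the direction of the normal
    [(n1, t1)], and in [CTt] one further derivative in the direction of the tangent. *)
Fixpoint CT (j : nat) (F : pexpr R) : sx :=
  match j with
  | O => ssub F cx cy
  | S j => SA (SM (SF n1) (CT j (dxR F))) (SM (SF t1) (CT j (dyR F)))
  end.
Definition CTt (j : nat) (F : pexpr R) : sx :=
  SA (SM (SF t1) (CT j (dxR F))) (SM (SF t2) (CT j (dyR F))).
(** This arises when the j normals are differentiated in s: n' = - kk t replaces one of them by a
    tangent, whence the factor j in [CT_Ds]. *)
Definition CTp (j : nat) (F : pexpr R) : sx :=
  match j with O => SF (fun _ => 0) | S i => CTt i F end.
Lemma sx_smooth_CT j : forall F, sx_smooth (CT j F).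
Proof.
  induction j; intro F; simpl.
  - apply sx_smooth_ssub. apply sx_smooth_cx. apply sx_smooth_cy.
  - generalize smooth_t1 smooth_n1. intuition auto.
Qed.
Lemma CT_ext j : forall F G, (forall x y, evR F x y = evR G x y) -> sx_eq (CT j F) (CT j G).
Proof.
  induction j; intros F G H s a; simpl.
  - rewrite !sev_ssub. auto.
  - rewrite (IHj (dxR F) (dxR G) (evR_ext_dx _ _ H)), (IHj (dyR F) (dyR G) (evR_ext_dy _ _ H)). auto.
Qed.
Lemma CT_Da j : forall F s a, sev (Da (CT j F)) s a =
  - r * (ep * sin a * sev (CT (S j) F) s a + cos a * sev (CTt j F) s a).
Proof.
  induction j; intros F s a.
  - simpl CT. rewrite Da_ssub, Da_cx, Da_cy. simpl. rewrite !sev_ssub. ring.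
  - assert (E1 := IHj (dxR F) s a). assert (E2 := IHj (dyR F) s a).
    assert (S1 := CT_ext j _ _ (evR_dxdy F) s a).
    unfold CTt in *. simpl in E1, E2, S1 |- *. rewrite E1, E2, S1. ring.
Qed.
Lemma CT_Ds j : forall F s a, sev (Ds (CT j F)) s a - ep * kk s * sev (Da (CT j F)) s a =
  sev (CTt j F) s a - INR j * kk s * sev (CTp j F) s a.
Proof.
  induction j; intros F s a.
  - simpl CT. rewrite Da_ssub, Ds_ssub. simpl CTt.
    transitivity (evR (dxR F) (sev cx s a) (sev cy s a) * (sev (Ds cx) s a - ep * kk s * sev (Da cx) s a)
      + evR (dyR F) (sev cx s a) (sev cy s a) * (sev (Ds cy) s a - ep * kk s * sev (Da cy) s a)).
    ring. rewrite Ds_cx, Ds_cy. unfold CTt. simpl. rewrite !sev_ssub. ring.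
  - assert (E1 := IHj (dxR F) s a). assert (E2 := IHj (dyR F) s a).
    assert (S1 := CT_ext j _ _ (evR_dxdy F) s a).
    assert (P : sev (CTp (S j) F) s a = t1 s * sev (CT j (dxR F)) s a + t2 s * sev (CT j (dyR F)) s a) by reflexivity.
    rewrite P. rewrite S_INR. unfold CTt in *. simpl in E1, E2, S1 |- *. rewrite D_n1, D_t1.
    assert (Q : INR j * (n1 s * sev (CTp j (dxR F)) s a + t1 s * sev (CTp j (dyR F)) s a)
      = INR j * (t1 s * sev (CT j (dxR F)) s a + t2 s * sev (CT j (dyR F)) s a)).
    { destruct j. simpl; ring. f_equal. simpl.
      assert (S2 := CT_ext j _ _ (evR_dxdy F) s a). rewrite S2. ring. }
    transitivity (- kk s * t1 s * sev (CT j (dxR F)) s a - kk s * t2 s * sev (CT j (dyR F)) s a +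
      n1 s * (sev (Ds (CT j (dxR F))) s a - ep * kk s * sev (Da (CT j (dxR F))) s a) +
      t1 s * (sev (Ds (CT j (dyR F))) s a - ep * kk s * sev (Da (CT j (dyR F))) s a)).
    ring. rewrite E1, E2.
    transitivity (- kk s * t1 s * sev (CT j (dxR F)) s a - kk s * t2 s * sev (CT j (dyR F)) s a +
      (n1 s * (t1 s * sev (CT j (dxR (dxR F))) s a + t2 s * sev (CT j (dyR (dxR F))) s a) +
      t1 s * (t1 s * sev (CT j (dxR (dyR F))) s a + t2 s * sev (CT j (dyR (dyR F))) s a)) -
      kk s * (INR j * (n1 s * sev (CTp j (dxR F)) s a + t1 s * sev (CTp j (dyR F)) s a))).
    ring. rewrite Q, S1. ring.
Qed.

(** Eliminating [CTt] between [CT_Da] and [CT_Ds] leaves [- r ep sin a * CT (S j) F]; hence two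
    orders of contact at [a = 0] are traded for one normal derivative. *)
Definition sin_CT (j : nat) (F : pexpr R) : sx :=
  SA (Da (CT j F)) (SM (SF (fun _ => r)) (SM SC (SA (Ds (CT j F))
    (SA (SM (SF (fun s => - (ep * kk s))) (Da (CT j F))) (SM (SF (fun s => INR j * kk s)) (CTp j F)))))).
Lemma sin_CT_eq j F : sx_eq (SM (SF (fun _ => - (r * ep))) (SM SS (CT (S j) F))) (sin_CT j F).
Proof.
  intros s a. assert (E := CT_Da j F s a). assert (E' := CT_Ds j F s a).
  transitivity (sev (Da (CT j F)) s a + r * (cos a * (
    (sev (Ds (CT j F)) s a - ep * kk s * sev (Da (CT j F)) s a) + INR j * kk s * sev (CTp j F) s a))).
  - rewrite E', E. simpl sev. ring.
  - unfold sin_CT. simpl. ring.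
Qed.
Lemma CTt_eq j F : sx_eq (SA (Ds (CT j F))
    (SA (SM (SF (fun s => - (ep * kk s))) (Da (CT j F))) (SM (SF (fun s => INR j * kk s)) (CTp j F)))) (CTt j F).
Proof. intros s a. assert (E' := CT_Ds j F s a). simpl in *. lra. Qed.

(** The signed speed of the parallel curve, whose s-derivative is [lam s] times the unit tangent.
    For ep = 1 or -1 it is nonzero as soon as r kk > 1. *)
Definition lam (s : R) : R := 1 - ep * r * kk s.

Lemma jets_vanish_CTt m j F : jets_vanish (S m) (CT j F) -> jets_vanish m (CTp j F) -> jets_vanish m (CTt j F).
Proof.
  intros H P. eapply jets_vanish_ext. apply CTt_eq. repeat apply jets_vanish_SA.
  - apply jets_vanish_Ds. apply sx_smooth_CT. apply jets_vanish_le with (2 := H); lia.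
  - apply jets_vanish_SF. apply jets_vanish_Da; auto.
  - apply jets_vanish_SF. auto.
Qed.
(** The a-derivative of [CT j F] occurs twice in [sin_CT], to leading order with weights 1 and - ep
    r kk, which add up to [lam]. The s-derivative first contributes at order m, and the [CTp] term
    only beyond it. *)
Lemma jets_sin_CT m j F : jets_vanish m (CT j F) -> jets_vanish (S m) (CTp j F) -> forall s,
  jet m (sin_CT j F) s = lam s * jet (S m) (CT j F) s + r * jet m (Ds (CT j F)) s /\
  (m <> 0%nat -> jet (m - 1) (sin_CT j F) s = lam s * jet m (CT j F) s) /\
  (forall i, (S i < m)%nat -> jet i (sin_CT j F) s = 0).
Proof.
  intros H P s. unfold sin_CT.
  set (X := SA (Ds (CT j F)) _).
  assert (VDs := jets_vanish_Ds _ _ (sx_smooth_CT j F) H).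
  assert (JX : forall i, jet i X s = jet i (Ds (CT j F)) s - ep * kk s * jet (S i) (CT j F) s + INR j * kk s * jet i (CTp j F) s).
  { intro i. unfold X. rewrite !jet_SA, !jet_SF. simpl. ring. }
  assert (VX : jets_vanish (m - 1) X).
  { destruct m. intros i Hi; lia. unfold X. repeat apply jets_vanish_SA. apply jets_vanish_le with (2 := VDs). lia.
    apply jets_vanish_SF, jets_vanish_Da. replace (S (S m - 1)) with (S m) by lia. auto.
    apply jets_vanish_SF. apply jets_vanish_le with (2 := P). lia. }
  assert (JN : forall i, jet i (SA (Da (CT j F)) (SM (SF (fun _ => r)) (SM SC X))) s =
     jet (S i) (CT j F) s + r * jet i (SM SC X) s).
  { intro i. rewrite jet_SA, jet_SF. reflexivity. }
  destruct (jet_SC_SS _ _ VX) as [V1 [_ J1]]. destruct (J1 s) as [A1 [A2 _]].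
  repeat split.
  - rewrite JN. assert (E : jet m (SM SC X) s = jet m X s).
    { destruct m. apply A1. replace (S (S m - 1)) with (S m) in A2 by lia. exact A2. }
    rewrite E, JX. rewrite (P m) by lia. unfold lam. ring.
  - intros Hm. rewrite JN, A1, JX. rewrite (VDs (m-1)%nat), (P (m-1)%nat) by lia.
    replace (S (m - 1)) with m by lia. unfold lam. ring.
  - intros i Hi. rewrite JN, (H (S i)), (V1 i) by lia. ring.
Qed.
(** The same jets read from the other side of [sin_CT_eq], where sin a supplies the order as a
    factor. *)
Lemma jets_sin_CT_top m j F s : jets_vanish m (CT (S j) F) ->
  jet (S m) (sin_CT j F) s = - (r * ep) * (INR (S m) * jet m (CT (S j) F) s) /\
  jet (S (S m)) (sin_CT j F) s = - (r * ep) * (INR (S (S m)) * jet (S m) (CT (S j) F) s).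
Proof.
  intros H. rewrite <- !(jet_ext _ _ _ (sin_CT_eq j F)), !jet_SF.
  destruct (jet_SC_SS _ _ H) as [_ [_ J]]. destruct (J s) as [_ [_ [-> ->]]]. auto.
Qed.
Lemma jet0_sin_CT j F s : jet 0 (sin_CT j F) s = 0.
Proof. rewrite <- !(jet_ext _ _ _ (sin_CT_eq j F)), !jet_SF. simpl. rewrite sin_0. ring. Qed.

(** One order is lost to the a-derivative in [sin_CT], the other to the division by sin a. *)
Lemma contact_order_step m j F : jets_vanish (S (S m)) (CT j F) -> jets_vanish (S (S (S m))) (CTp j F) ->
  jets_vanish m (CT (S j) F) /\ jets_vanish (S m) (CTp (S j) F).
Proof.
  intros H P. split.
  - apply jets_vanish_SS_inv. intros i Hi s.
    destruct (jets_sin_CT _ _ _ H P s) as [_ [_ Z]].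
    specialize (Z i ltac:(lia)). rewrite <- (jet_ext _ _ _ (sin_CT_eq j F)), jet_SF in Z.
    apply Rmult_integral in Z. destruct Z as [Z|Z]; auto. exfalso.
    assert (ep <> 0) by (intro E; clear - E ep2; rewrite E in ep2; lra).
    apply Ropp_eq_0_compat in Z. rewrite Ropp_involutive in Z. apply Rmult_integral in Z. destruct Z; lra.
  - simpl CTp. apply jets_vanish_CTt; auto. apply jets_vanish_le with (2 := P). lia.
Qed.

(** Holds when the even number [m] is the order of contact; stated for both signs of [ep] it
    determines the leading jet up to a constant. *)
Definition jet_relation (m : nat) (e : sx) (s : R) : Prop :=
  3 * lam s ^ 2 * jet (S m) e s + r * (INR m + 1) *
    (3 * lam s * jet m (Ds e) s + INR m * jet m e s * (- (ep * r) * Derive kk s)) = 0.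

Lemma ep_nz : ep <> 0.
Proof. intro E; rewrite E in ep2; lra. Qed.

(** The induction passes from [CT j] at order 2i to [CT (S j)] at order 2i - 2, and each passage
    multiplies the leading jet by [lam] and a nonzero constant. At order 0 the relation is read off
    at a = 0, where the side containing sin a vanishes. *)
Lemma even_jet_relation i : (forall s, lam s <> 0) -> forall j F, jets_vanish (2 * i) (CT j F) -> jets_vanish (S (2 * i)) (CTp j F) ->
  (exists c, c <> 0 /\ forall s, jet 0 (CT (j + i) F) s = c * lam s ^ i * jet (2 * i) (CT j F) s) /\
  (forall s, jet_relation (2 * i) (CT j F) s) /\
  (forall i' s, (i' < i)%nat -> jet 0 (CT (j + i') F) s = 0).
Proof.
  intros L. induction i; intros j F H P.
  - split; [|split].
    + exists 1. split. lra. intros s. rewrite Nat.add_0_r. simpl. ring.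
    + intros s. unfold jet_relation. destruct (jets_sin_CT _ _ _ H P s) as [A _]. rewrite jet0_sin_CT in A.
      change (2 * 0)%nat with 0%nat in *.
      transitivity (3 * lam s * (lam s * jet 1 (CT j F) s + r * jet 0 (Ds (CT j F)) s)).
      simpl INR. ring. rewrite <- A. ring.
    + intros; lia.
  - replace (2 * S i)%nat with (S (S (2 * i))) in * by lia.
    destruct (contact_order_step _ _ _ H P) as [H' P'].
    destruct (IHi (S j) F H' P') as [[c [c0 Hc]] [HR HZ]].
    assert (rz : r * ep <> 0) by (apply Rmult_integral_contrapositive; split; [lra|apply ep_nz]).
    assert (N1 : INR (S (2 * i)) <> 0) by (apply not_0_INR; lia).
    assert (N2 : INR (S (S (2 * i))) <> 0) by (apply not_0_INR; lia).
    (* Lowest jets on the two sides of [sin_CT_eq]. The next order gives [EB], and [ED] is the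
       s-derivative of the present identity. *)
    assert (EA : forall s, jet (2 * i) (CT (S j) F) s = / (- (r * ep) * INR (S (2 * i))) * (lam s * jet (S (S (2 * i))) (CT j F) s)).
    { intro s. destruct (jets_sin_CT _ _ _ H P s) as [_ [B _]]. specialize (B ltac:(lia)).
      replace (S (S (2 * i)) - 1)%nat with (S (2 * i)) in B by lia.
      destruct (jets_sin_CT_top _ _ _ s H') as [C _]. rewrite <- B, C. assert (Ez := ep_nz). assert (Rz : r <> 0) by lra. field. repeat split; auto. }
    assert (EB : forall s, - (r * ep) * (INR (S (S (2 * i))) * jet (S (2 * i)) (CT (S j) F) s) =
       lam s * jet (S (S (S (2 * i)))) (CT j F) s + r * jet (S (S (2 * i))) (Ds (CT j F)) s).
    { intro s. destruct (jets_sin_CT _ _ _ H P s) as [B _].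
      destruct (jets_sin_CT_top _ _ _ s H') as [_ C]. rewrite <- B, C. ring. }
    split; [|split].
    + exists (c * / (- (r * ep) * INR (S (2 * i)))). split.
      * apply Rmult_integral_contrapositive; split; auto. apply Rinv_neq_0_compat.
        apply Rmult_integral_contrapositive; split; auto. lra.
      * intro s. replace (j + S i)%nat with (S j + i)%nat by lia. rewrite Hc, EA. simpl pow. ring.
    + intro s. specialize (HR s). unfold jet_relation in *.
      assert (ED : jet (2 * i) (Ds (CT (S j) F)) s = / (- (r * ep) * INR (S (2 * i))) *
         (- (ep * r) * Derive kk s * jet (S (S (2 * i))) (CT j F) s + lam s * jet (S (S (2 * i))) (Ds (CT j F)) s)).
      { eapply is_derive_ext_unique. exact EA. apply jet_ds. apply sx_smooth_CT.
        eapply is_derive_eq. apply (is_derive_Rmult (fun _ => / (- (r * ep) * INR (S (2 * i))))). apply is_derive_Rconst.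
        apply is_derive_Rmult. 2: apply jet_ds, sx_smooth_CT.
        unfold lam. apply is_derive_Rminus. apply is_derive_Rconst. apply (is_derive_Rmult (fun _ => ep * r)).
        apply is_derive_Rconst. apply Derive_correct, (fr_k _ _ _ _ _ Fr). rring. }
      rewrite EA, ED in HR. specialize (EB s).
      set (A := jet (S (S (2 * i))) (CT j F) s) in *.
      set (A' := jet (S (S (2 * i))) (Ds (CT j F)) s) in *.
      set (B := jet (S (S (S (2 * i)))) (CT j F) s) in *.
      set (B2 := jet (S (2 * i)) (CT (S j) F) s) in *.
      rewrite !S_INR in *. set (M := INR (2 * i)) in *.
      assert (EB2 : B2 = / (- (r * ep) * (M + 1 + 1)) * (lam s * B + r * A')).
      { rewrite <- EB. field. assert (Ez := ep_nz). assert (Rz : r <> 0) by lra. repeat split; auto. }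
      rewrite EB2 in HR.
      assert (M2 : M + 1 + 1 <> 0) by auto.
      (* After the substitutions the relation at order 2i is the one at order 2i + 2 up to this
         constant and a factor [lam]. *)
      apply Rmult_eq_compat_l with (r := - (r * ep) * (M + 1 + 1)) in HR. rewrite Rmult_0_r in HR.
      apply Rmult_eq_reg_l with (lam s); auto. rewrite Rmult_0_r, <- HR. field.
      assert (Ez := ep_nz). assert (Rz : r <> 0) by lra. repeat split; auto.
    + intros i' s Hi. destruct i'. rewrite Nat.add_0_r. apply H. lia.
      replace (j + S i')%nat with (S j + i')%nat by lia. apply HZ. lia.
Qed.

(** The descent by two orders now ends at order 1, where the identity at a = 0 says that [lam] times
    the first jet is zero. *)
Lemma odd_jet_vanishes i : (forall s, lam s <> 0) -> forall j F, jets_vanish (S (2 * i)) (CT j F) -> jets_vanish (S (S (2 * i))) (CTp j F) ->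
  forall s, jet (S (2 * i)) (CT j F) s = 0.
Proof.
  intros L. induction i; intros j F H P s.
  - destruct (jets_sin_CT _ _ _ H P s) as [_ [B _]]. specialize (B ltac:(lia)). simpl (1 - 1)%nat in B.
    simpl (2 * 0)%nat in *. simpl (1 - 1)%nat in B. rewrite jet0_sin_CT in B. symmetry in B. apply Rmult_integral in B. destruct B as [B|B]; auto. destruct (L s B).
  - replace (2 * S i)%nat with (S (S (2 * i))) in * by lia.
    destruct (contact_order_step _ _ _ H P) as [H' P'].
    destruct (jets_sin_CT _ _ _ H P s) as [_ [B _]]. specialize (B ltac:(lia)).
    replace (S (S (S (2 * i))) - 1)%nat with (S (S (2 * i))) in B by lia.
    destruct (jets_sin_CT_top _ _ _ s H') as [C _]. rewrite C, IHi in B by auto.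
    rewrite !Rmult_0_r in B. symmetry in B. apply Rmult_integral in B. destruct B as [B|B]; auto. destruct (L s B).
Qed.
End Side.
End Curve.

(** * Polynomials flat along a parallel curve *)

Lemma derive_zero_const (f : R -> R) : (forall x, is_derive f x 0) -> forall x y, f x = f y.
Proof.
  intros H x y. destruct (MVT_gen f x y (fun _ => 0)) as [c [_ E]].
  - intros; auto.
  - intros z _. apply continuity_pt_filterlim. apply (ex_derive_continuous (V := R_NormedModule) f z). exists 0. apply H.
  - lra.
Qed.

(** Degree less than d, expressed by derivatives so that no normal form of the expression is
    needed. *)
Fixpoint nil_derivs (d : nat) (e : pexpr R) : Prop :=
  match d with
  | O => forall x y, evR e x y = 0
  | S d => nil_derivs d (dxR e) /\ nil_derivs d (dyR e)
  end.
Lemma nil_derivs_zero d : forall e, (forall x y, evR e x y = 0) -> nil_derivs d e.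
Proof.
  induction d; simpl; intros e H. auto.
  split; apply IHd; intros x y.
  - apply (evR_ext_dx e (PC 0) H x y).
  - apply (evR_ext_dy e (PC 0) H x y).
Qed.
Lemma nil_derivs_S d : forall e, nil_derivs d e -> nil_derivs (S d) e.
Proof. induction d; intros e H. apply nil_derivs_zero; auto. destruct H. split; apply IHd; auto. Qed.
Lemma nil_derivs_le d d' e : (d <= d')%nat -> nil_derivs d e -> nil_derivs d' e.
Proof. induction 1; auto. intros; apply nil_derivs_S; auto. Qed.
Lemma nil_derivs_add d : forall e e', nil_derivs d e -> nil_derivs d e' -> nil_derivs d (PA e e').
Proof. induction d; simpl; intros e e' H H'. intros; rewrite H, H'; ring. intuition. Qed.
(** Leibniz: of d + d' derivatives, at least d fall on the first factor or at least d' on the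
    second. *)
Lemma nil_derivs_mul n : forall d d' e e', (d + d' = n)%nat -> nil_derivs d e -> nil_derivs d' e' -> nil_derivs n (PM e e').
Proof.
  induction n; intros d d' e e' E H H'.
  - destruct d; [|lia]. simpl in *. intros; rewrite H; ring.
  - destruct d.
    + apply nil_derivs_zero. intros; simpl in *; rewrite H; ring.
    + destruct d'.
      * apply nil_derivs_zero. intros; simpl in *; rewrite H'; ring.
      * destruct H as [A B]. destruct H' as [A' B'].
        split; simpl; apply nil_derivs_add.
        apply (IHn d (S d')); [lia|auto|simpl; auto]. apply (IHn (S d) d'); [lia|simpl; auto|auto].
        apply (IHn d (S d')); [lia|auto|simpl; auto]. apply (IHn (S d) d'); [lia|simpl; auto|auto].
Qed.
Lemma nil_derivs_exists e : exists d, nil_derivs d e.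
Proof.
  induction e.
  - exists 1%nat; simpl; auto.
  - exists 2%nat; simpl; auto.
  - exists 2%nat; simpl; auto.
  - destruct IHe1 as [d H]. destruct IHe2 as [d' H']. exists (d + d')%nat.
    apply nil_derivs_add. apply nil_derivs_le with (2 := H); lia. apply nil_derivs_le with (2 := H'); lia.
  - destruct IHe1 as [d H]. destruct IHe2 as [d' H']. exists (d + d')%nat. eapply nil_derivs_mul; eauto.
Qed.
Lemma evR_const e : (forall x y, evR (dxR e) x y = 0) -> (forall x y, evR (dyR e) x y = 0) ->
  forall x y x' y', evR e x y = evR e x' y'.
Proof.
  intros A B x y x' y'. transitivity (evR e x' y).
  - apply (derive_zero_const (fun u => evR e u y)). intros u. eapply is_derive_eq.
    apply (is_derive_evR e (fun u => u) (fun _ => y)). apply is_derive_Rid. apply is_derive_Rconst.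
    cbv beta; rewrite A, B; rring.
  - apply (derive_zero_const (fun u => evR e x' u)). intros u. eapply is_derive_eq.
    apply (is_derive_evR e (fun _ => x') (fun u => u)). apply is_derive_Rconst. apply is_derive_Rid.
    cbv beta; rewrite A, B; rring.
Qed.

Section Vanishing.
Variables (z1 z2 t1 t2 kk : R -> R) (r ep : R).
Hypothesis Fr : frame z1 z2 t1 t2 kk.
Hypothesis ep2 : ep * ep = 1.
Hypothesis r0 : 0 < r.
Hypothesis lam0 : forall s, lam kk r ep s <> 0.
Let ct := CT z1 z2 t1 t2 r ep.
Let ctt := CTt z1 z2 t1 t2 r ep.

Fixpoint vanish_to_order (j : nat) (G : pexpr R) : Prop :=
  match j with
  | O => True
  | S j => (forall s, sev (ct 0 G) s 0 = 0) /\ vanish_to_order j (dxR G) /\ vanish_to_order j (dyR G)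
  end.
(** A polynomial that is zero on the parallel curve has zero derivative along it, and the speed
    [lam] can be cancelled. For larger i this is applied to both partial derivatives and the results
    are recombined. *)
Lemma tangential_vanishes i : forall G, vanish_to_order (S i) G -> forall s, sev (ctt i G) s 0 = 0.
Proof.
  induction i; intros G H s.
  - destruct H as [H _].
    assert (A := CT_Ds z1 z2 t1 t2 kk r Fr ep ep2 0 G s 0).
    assert (B := CT_Da z1 z2 t1 t2 r ep 0 G s 0). rewrite B, sin_0, cos_0 in A. simpl INR in A.
    assert (Z : sev (Ds (ct 0 G)) s 0 = 0).
    { apply (is_derive_ext_unique (fun s => sev (ct 0 G) s 0) (fun _ => 0) s); auto using is_derive_Rconst.
      apply sev_ds. apply (sx_smooth_CT z1 z2 t1 t2 kk r Fr). }
    fold ct ctt in A. rewrite Z in A.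
    assert (L : lam kk r ep s * sev (ctt 0 G) s 0 = 0) by (unfold lam; lra).
    apply Rmult_integral in L. destruct L as [L|L]; auto. destruct (lam0 _ L).
  - destruct H as [_ [A B]]. assert (IA := IHi _ A s). assert (IB := IHi _ B s).
    assert (S1 := CT_ext z1 z2 t1 t2 r ep i _ _ (evR_dxdy G) s 0).
    unfold ctt, CTt in *. simpl in *. rewrite S1 in *.
    transitivity (- t2 s * (t1 s * sev (CT z1 z2 t1 t2 r ep i (dxR (dxR G))) s 0 + t2 s * sev (CT z1 z2 t1 t2 r ep i (dyR (dxR G))) s 0)
      + t1 s * (t1 s * sev (CT z1 z2 t1 t2 r ep i (dyR (dxR G))) s 0 + t2 s * sev (CT z1 z2 t1 t2 r ep i (dyR (dyR G))) s 0)).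
    ring. rewrite IA, IB. ring.
Qed.
(** Derivatives with a tangent among their directions vanish already, so the pure normal derivative
    decides the next order. *)
Lemma vanish_to_order_succ j : forall G, vanish_to_order j G -> (forall s, sev (ct j G) s 0 = 0) -> vanish_to_order (S j) G.
Proof.
  induction j; intros G H Z. simpl; auto.
  assert (T := tangential_vanishes j G H).
  destruct H as [H0 [HA HB]]. split; auto.
  assert (X : forall s, sev (ct j (dxR G)) s 0 = 0 /\ sev (ct j (dyR G)) s 0 = 0).
  { intros s. specialize (Z s). specialize (T s). unfold ct, ctt, CTt in *. simpl in Z, T.
    generalize (fr_u _ _ _ _ _ Fr s). intro U.
    set (a := sev (CT z1 z2 t1 t2 r ep j (dxR G)) s 0) in *. set (b := sev (CT z1 z2 t1 t2 r ep j (dyR G)) s 0) in *.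
    split.
    - transitivity ((t1 s ^ 2 + t2 s ^ 2) * a). rewrite U; ring.
      transitivity (t1 s * (t1 s * a + t2 s * b) - t2 s * (-1 * t2 s * a + t1 s * b)). ring. rewrite Z, T; ring.
    - transitivity ((t1 s ^ 2 + t2 s ^ 2) * b). rewrite U; ring.
      transitivity (t2 s * (t1 s * a + t2 s * b) + t1 s * (-1 * t2 s * a + t1 s * b)). ring. rewrite Z, T; ring. }
  split; apply IHj; auto; intros; apply X.
Qed.
(** By induction on the degree both partial derivatives are zero, so G is a constant, and it
    vanishes at a point of the curve. *)
Lemma all_normals_vanish_zero G : (forall j s, sev (ct j G) s 0 = 0) -> forall x y, evR G x y = 0.
Proof.
  intros H. assert (V : forall j, vanish_to_order j G).
  { induction j. simpl; auto. apply vanish_to_order_succ; auto. }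
  clear H. destruct (nil_derivs_exists G) as [d D]. revert G D V. induction d; intros G D V. auto.
  destruct D as [D1 D2].
  assert (X := IHd _ D1 (fun j => proj1 (proj2 (V (S j))))).
  assert (Y := IHd _ D2 (fun j => proj2 (proj2 (V (S j))))).
  intros x y. destruct (V 1%nat) as [V0 _]. specialize (V0 0). unfold ct in V0. simpl in V0.
  rewrite sev_ssub in V0. rewrite <- V0. apply evR_const; auto.
Qed.
(** [even_jet_relation] converts every two orders of flatness in the angle into one vanishing normal
    derivative. *)
Lemma jets_zero G : (forall m, jets_vanish m (ct 0 G)) -> forall x y, evR G x y = 0.
Proof.
  intros H. apply all_normals_vanish_zero. intros j s.
  assert (P : jets_vanish (S (2 * S j)) (CTp z1 z2 t1 t2 r ep 0 G)).
  { intros i _ u. simpl. transitivity (jet i (SM (SF (fun _ => 0)) SC) u).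
    apply jet_ext. intros v a; simpl; ring. rewrite jet_SF. ring. }
  destruct (even_jet_relation z1 z2 t1 t2 kk r Fr r0 ep ep2 (S j) lam0 0 G (H _) P) as [_ [_ Z]].
  apply (Z j s). lia.
Qed.

Fixpoint dir_deriv (b1 b2 : C) (i : nat) (F : pexpr R) (x y : R) : C :=
  match i with
  | O => RtoC (evR F x y)
  | S i => Cplus (b1 * dir_deriv b1 b2 i (dxR F) x y)%C (b2 * dir_deriv b1 b2 i (dyR F) x y)%C
  end.
(** At a zero of order j the j-th differential kills every tangent, so a direction counts only
    through its product with the normal. *)
Lemma directional_of_normal b1 b2 j : forall F, vanish_to_order j F -> forall s,
  dir_deriv b1 b2 j F (z1 s + r * ep * - t2 s) (z2 s + r * ep * t1 s) =
  ((b1 * RtoC (- t2 s) + b2 * RtoC (t1 s)) ^ j * RtoC (sev (ct j F) s 0))%C.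
Proof.
  induction j; intros F H s.
  - simpl. unfold ct. simpl. rewrite sev_ssub, sev_cx, sev_cy, sin_0, cos_0.
    replace (z1 s + r * (ep * (-1 * t2 s) * 1 - t1 s * 0)) with (z1 s + r * ep * - t2 s) by ring.
    replace (z2 s + r * (ep * t1 s * 1 - t2 s * 0)) with (z2 s + r * ep * t1 s) by ring.
    ring.
  - assert (T := tangential_vanishes j F H s). destruct H as [_ [HA HB]].
    simpl dir_deriv. rewrite IHj, IHj by auto.
    generalize (fr_u _ _ _ _ _ Fr s). intro U. unfold ct, ctt, CTt in *. simpl in T |- *.
    set (a := sev (CT z1 z2 t1 t2 r ep j (dxR F)) s 0) in *. set (b := sev (CT z1 z2 t1 t2 r ep j (dyR F)) s 0) in *.
    set (w := -1 * t2 s * a + t1 s * b).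
    assert (Ea : a = - t2 s * w).
    { transitivity ((t1 s ^ 2 + t2 s ^ 2) * a). rewrite U; ring.
      transitivity (t1 s * (t1 s * a + t2 s * b) - t2 s * w). unfold w; ring. rewrite T; ring. }
    assert (Eb : b = t1 s * w).
    { transitivity ((t1 s ^ 2 + t2 s ^ 2) * b). rewrite U; ring.
      transitivity (t2 s * (t1 s * a + t2 s * b) + t1 s * w). unfold w; ring. rewrite T; ring. }
    clearbody w. rewrite Ea, Eb. rewrite !RtoC_mult. ring.
Qed.
End Vanishing.

(** * The differential equation for the leading jet *)

Section Relation.
Variables (z1 z2 t1 t2 kk : R -> R) (r ep : R).
Hypothesis Fr : frame z1 z2 t1 t2 kk.
Hypothesis ep2 : ep * ep = 1.
Hypothesis r0 : 0 < r.
Hypothesis kbig : forall s, 1 < r * kk s.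
Let ct e := CT z1 z2 t1 t2 r e.

Lemma ep_cases : ep = 1 \/ ep = -1.
Proof. assert (H : (ep - 1) * (ep + 1) = 0) by lra. apply Rmult_integral in H. lra. Qed.
Lemma lam_nz e : e = 1 \/ e = -1 -> forall s, lam kk r e s <> 0.
Proof. intros H s. generalize (kbig s). unfold lam. destruct H as [-> | ->]; lra. Qed.
Lemma jets_vanish_CTp0 e m F : jets_vanish m (CTp z1 z2 t1 t2 r e 0 F).
Proof.
  intros i _ u. simpl. transitivity (jet i (SM (SF (fun _ => 0)) SC) u).
  apply jet_ext. intros v a; simpl; ring. rewrite jet_SF. ring.
Qed.

(** The relation for [F'] is one between jets of the common function of (s, a), hence between the
    jets of [F]; only the sign of ep differs. *)
Lemma two_sided_jet_relation F F' m : sx_eq (ct ep 0 F) (ct (- ep) 0 F') -> jets_vanish (2 * m) (ct ep 0 F) ->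
  forall s, jet_relation kk r ep (2 * m) (ct ep 0 F) s /\ jet_relation kk r (- ep) (2 * m) (ct ep 0 F) s.
Proof.
  intros E V s.
  assert (V' : jets_vanish (2 * m) (ct (- ep) 0 F')) by (apply jets_vanish_ext with (1 := E); auto).
  assert (L1 := lam_nz ep ep_cases).
  assert (C2 : - ep = 1 \/ - ep = -1) by (destruct ep_cases; lra).
  assert (ep2' : - ep * - ep = 1) by lra.
  assert (L2 := lam_nz (- ep) C2).
  destruct (even_jet_relation z1 z2 t1 t2 kk r Fr r0 ep ep2 m L1 0 F V (jets_vanish_CTp0 _ _ _)) as [_ [R1 _]].
  destruct (even_jet_relation z1 z2 t1 t2 kk r Fr r0 (- ep) ep2' m L2 0 F' V' (jets_vanish_CTp0 _ _ _)) as [_ [R2 _]].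
  split. apply R1.
  specialize (R2 s). unfold jet_relation in *. fold (ct (- ep) 0 F') in R2.
  assert (J : forall i, jet i (ct (- ep) 0 F') s = jet i (ct ep 0 F) s).
  { intro i. symmetry. apply jet_ext; auto. }
  rewrite !J in R2.
  assert (JD : jet (2 * m) (Ds (ct (- ep) 0 F')) s = jet (2 * m) (Ds (ct ep 0 F)) s).
  { symmetry. apply jet_ext. apply sx_eq_Ds; auto; apply (sx_smooth_CT z1 z2 t1 t2 kk r Fr). }
  rewrite JD in R2. exact R2.
Qed.

(** At order 0 the two relations read lam b + r a' = 0 with the same first jet b, the same
    derivative a' of the central value and two different values of lam; so b and a' are zero. *)
Lemma central_const F F' : sx_eq (ct ep 0 F) (ct (- ep) 0 F') ->
  exists c0, forall s, jet 0 (ct ep 0 F) s = c0.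
Proof.
  intros E. exists (jet 0 (ct ep 0 F) 0). intro s.
  apply (derive_zero_const (fun s => jet 0 (ct ep 0 F) s)). intro u.
  assert (D := jet_ds 0 (ct ep 0 F) u (sx_smooth_CT z1 z2 t1 t2 kk r Fr ep 0 F)).
  eapply is_derive_eq. exact D.
  destruct (two_sided_jet_relation F F' 0 E) with (s := u) as [R1 R2]. intros i Hi; lia.
  unfold jet_relation in *. simpl (2 * 0)%nat in *. simpl (INR 0) in *.
  assert (L1 := lam_nz ep ep_cases u). assert (L2 : lam kk r (- ep) u <> 0) by (apply lam_nz; destruct ep_cases; lra).
  set (b := jet 1 (ct ep 0 F) u) in *. set (a' := jet 0 (Ds (ct ep 0 F)) u) in *.
  assert (P1 : lam kk r ep u * b + r * a' = 0).
  { apply Rmult_eq_reg_l with (3 * lam kk r ep u). rewrite Rmult_0_r, <- R1. ring.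
    intro Z. apply Rmult_integral in Z. destruct Z; lra. }
  assert (P2 : lam kk r (- ep) u * b + r * a' = 0).
  { apply Rmult_eq_reg_l with (3 * lam kk r (- ep) u). rewrite Rmult_0_r, <- R2. ring.
    intro Z. apply Rmult_integral in Z. destruct Z; lra. }
  assert (Hb : b = 0).
  { generalize (kbig u); intro K. unfold lam in P1, P2.
    assert (Z : (ep * (r * kk u)) * b = 0) by lra. apply Rmult_integral in Z. destruct Z as [Z|Z]; auto.
    apply Rmult_integral in Z. destruct ep_cases; lra. }
  rewrite Hb in P1. assert (Z : r * a' = 0) by lra. apply Rmult_integral in Z. destruct Z; lra.
Qed.

Definition normal_deriv (k : nat) (G : pexpr R) (s : R) : R := sev (ct ep k G) s 0.

(** The first order whose jet is not identically zero in s. One good value of s is enough to make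
    the constant in [curve_relation] nonzero. *)
Lemma nonvanishing_order G : (exists x y, evR G x y <> 0) ->
  exists m, jets_vanish m (ct ep 0 G) /\ exists s, jet m (ct ep 0 G) s <> 0.
Proof.
  intros [x [y H]]. apply NNPP. intro N. apply H.
  apply (jets_zero z1 z2 t1 t2 kk r ep Fr ep2 r0 (lam_nz ep ep_cases)).
  intro m. induction m. intros i Hi; lia.
  intros i Hi s. destruct (Nat.eq_dec i m) as [->|Ne]. 2: apply IHm; lia.
  apply NNPP. intro J. apply N. exists m. split; auto. exists s. auto.
Qed.

Lemma curve_relation F F' :
  sx_eq (ct ep 0 F) (ct (- ep) 0 F') ->
  ~ (exists c, forall x y, evR F x y = c) ->
  exists (c0 : R) (k : nat) (C : R), (1 <= k)%nat /\ C <> 0 /\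
    vanish_to_order z1 z2 t1 t2 r ep k (PA F (PC (- c0))) /\
    forall s, normal_deriv k (PA F (PC (- c0))) s ^ 3 * lam kk r (- ep) s ^ (2 * k)
      = C * (r * kk s) ^ (2 * k) * lam kk r ep s ^ k.
Proof.
  intros E NC. destruct (central_const F F' E) as [c0 Hc0].
  set (G := PA F (PC (- c0))). set (G' := PA F' (PC (- c0))).
  assert (E' : sx_eq (ct ep 0 G) (ct (- ep) 0 G')).
  { intros s a. specialize (E s a). unfold ct in *. simpl in *. rewrite E. auto. }
  assert (NG : exists x y, evR G x y <> 0).
  { apply NNPP. intro N. apply NC. exists c0. intros x y. apply NNPP. intro N2. apply N. exists x, y.
    simpl. lra. }
  destruct (nonvanishing_order G NG) as [m [Vm [s0 Hs0]]].
  assert (J0 : forall s, jet 0 (ct ep 0 G) s = 0).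
  { intro s. specialize (Hc0 s). unfold ct in *. simpl in *. lra. }
  assert (L1 := lam_nz ep ep_cases).
  assert (C2 : - ep = 1 \/ - ep = -1) by (destruct ep_cases; lra).
  assert (L2 := lam_nz (- ep) C2).
  (* Odd orders are excluded by [odd_jet_vanishes], and order 0 by the choice of [c0]. *)
  destruct (Nat.Even_or_Odd m) as [[k ->]|[k ->]].
  2:{ exfalso. apply Hs0. replace (2 * k + 1)%nat with (S (2 * k)) in * by lia.
      apply (odd_jet_vanishes z1 z2 t1 t2 kk r Fr r0 ep ep2 k L1 0 G Vm (jets_vanish_CTp0 _ _ _)). }
  assert (Hk : (1 <= k)%nat).
  { destruct k; [|lia]. exfalso. apply Hs0. apply J0. }
  destruct (even_jet_relation z1 z2 t1 t2 kk r Fr r0 ep ep2 k L1 0 G Vm (jets_vanish_CTp0 _ _ _)) as [[c [cn Hc]] [_ HZ]].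
  assert (VNk : vanish_to_order z1 z2 t1 t2 r ep k G).
  { assert (X : forall j, (j <= k)%nat -> vanish_to_order z1 z2 t1 t2 r ep j G).
    { induction j; intros Hj. simpl; auto. apply (vanish_to_order_succ z1 z2 t1 t2 kk r ep Fr ep2 L1). apply IHj; lia.
      intros s. apply (HZ j s). lia. }
    apply X; auto. }
  set (mu := fun s => r * kk s).
  assert (Dmu : forall s, is_derive mu s (r * Derive kk s)).
  { intro s. eapply is_derive_eq. apply (is_derive_Rmult (fun _ => r)). apply is_derive_Rconst.
    apply Derive_correct. apply (fr_k _ _ _ _ _ Fr). rring. }
  assert (LL : forall s, lam kk r ep s * lam kk r (- ep) s = 1 - mu s ^ 2).
  { intro s. unfold lam, mu. transitivity (1 - (ep * ep) * (r * kk s) ^ 2). ring. rewrite ep2. ring. }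
  set (a := fun s => jet (2 * k) (ct ep 0 G) s).
  (* A first integral, because mu / (1 - mu^2) has logarithmic derivative (1 + mu^2) mu' / (mu (1 -
     mu^2)). *)
  set (V := fun s => a s ^ 3 * (1 - mu s ^ 2) ^ (2 * k) / mu s ^ (2 * k)).
  assert (mu1 : forall s, 1 < mu s) by (intro; apply kbig).
  assert (DV : forall s, is_derive V s 0).
  { intro s.
    assert (Da' := jet_ds (2 * k) (ct ep 0 G) s (sx_smooth_CT z1 z2 t1 t2 kk r Fr ep 0 G)).
    destruct (two_sided_jet_relation G G' k E' Vm s) as [R1 R2]. unfold jet_relation in R1, R2.
    fold (a s) in R1, R2. set (a' := jet (2 * k) (Ds (ct ep 0 G)) s) in *.
    set (b := jet (S (2 * k)) (ct ep 0 G) s) in *.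
    assert (Key : 3 * mu s * (1 - mu s ^ 2) * a' = INR (2 * k) * a s * (r * Derive kk s) * (1 + mu s ^ 2)).
    { set (M := INR (2 * k)) in *.
      assert (Mp : 0 <= M) by apply pos_INR.
      (* The combination l'^2 [R1] - l^2 [R2] cancels the next jet [b]. *)
      assert (Q : ep * (r * (M + 1)) * 2 * (3 * mu s * (1 - mu s ^ 2) * a' - M * a s * (r * Derive kk s) * (1 + mu s ^ 2)) = 0).
      { set (l := lam kk r ep s) in *. set (l' := lam kk r (- ep) s) in *.
        assert (El : l = 1 - ep * mu s) by (unfold l, lam, mu; ring).
        assert (El' : l' = 1 + ep * mu s) by (unfold l', lam, mu; ring).
        transitivity (l' ^ 2 * (3 * l ^ 2 * b + r * (M + 1) * (3 * l * a' + M * a s * (- (ep * r) * Derive kk s)))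
          - l ^ 2 * (3 * l' ^ 2 * b + r * (M + 1) * (3 * l' * a' + M * a s * (- (- ep * r) * Derive kk s)))).
        2:{ rewrite R1, R2. ring. }
        transitivity (r * (M + 1) * (3 * a' * (l * l') * (l' - l) - M * a s * (ep * r * Derive kk s) * (l' ^ 2 + l ^ 2))).
        2: ring.
        assert (LLs : l * l' = 1 - mu s ^ 2) by apply LL. rewrite LLs.
        assert (D1 : l' - l = 2 * (ep * mu s)) by (rewrite El, El'; ring).
        assert (D2 : l' ^ 2 + l ^ 2 = 2 * (1 + mu s ^ 2)).
        { rewrite El, El'. transitivity (2 * (1 + (ep * ep) * mu s ^ 2)). ring. rewrite ep2. ring. }
        rewrite D1, D2. ring. }
      apply Rmult_integral in Q. destruct Q as [Q|Q]. exfalso.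
      - assert (Q' : ep * (r * (M + 1)) = 0) by lra. apply Rmult_integral in Q'.
        destruct Q' as [Q'|Q']. destruct ep_cases; lra. apply Rmult_integral in Q'. destruct Q'; lra.
      - lra. }
    assert (mz : mu s <> 0) by (generalize (mu1 s); lra).
    destruct k as [|k']; [lia|]. set (M := (2 * S k')%nat) in *.
    assert (HM : M = S (2 * k' + 1)) by (unfold M; lia).
    eapply is_derive_eq.
    unfold V. apply is_derive_div.
    - apply (is_derive_Rmult (fun s => a s ^ 3)).
      apply (is_derive_pow a 3). exact Da'.
      apply (is_derive_pow (fun s => 1 - mu s ^ 2) M).
      apply is_derive_Rminus. apply is_derive_Rconst. apply (is_derive_pow mu 2). apply Dmu.
    - apply (is_derive_pow mu M). apply Dmu.
    - apply pow_nonzero; auto.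
    - match goal with |- ?x = ?y => change (@eq R x y) end. fold a'.
      unfold Rdiv. apply Rmult_eq_0_compat_r.
      rewrite HM in *. simpl pred.
      set (P := (1 - mu s ^ 2)) in *. set (q := (2 * k' + 1)%nat) in *.
      change ((P) ^ S q) with (P * P ^ q). change (mu s ^ S q) with (mu s * mu s ^ q).
      simpl (INR 3). simpl (INR 2). set (N := INR (S q)) in *. simpl (pow _ 2). simpl (pow _ 1).
      transitivity (a s ^ 2 * P ^ q * mu s ^ q * (3 * mu s * P * a' - N * a s * (r * Derive kk s) * (1 + mu s ^ 2))).
      2:{ rewrite Key. ring. }
      replace (k' + (k' + 0) + 1)%nat with q by (unfold q; lia).
      generalize (P ^ q) (mu s ^ q). intros Pq mq. unfold P. ring. }
  assert (CV : forall s, V s = V s0) by (intro; apply derive_zero_const; auto).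
  assert (HV : forall s, a s ^ 3 * (1 - mu s ^ 2) ^ (2 * k) = V s0 * mu s ^ (2 * k)).
  { intro s. rewrite <- (CV s). unfold V. field. apply pow_nonzero. generalize (mu1 s); lra. }
  (* The normal derivative is c lam^k times the leading jet, so c^3 multiplies the value of the
     first integral. *)
  exists c0, k, (c ^ 3 * V s0). split; auto. split.
  { apply Rmult_integral_contrapositive. split. apply pow_nonzero; auto.
    unfold V. apply Rmult_integral_contrapositive_currified.
    apply Rmult_integral_contrapositive_currified. apply (pow_nonzero _ 3); auto.
    apply pow_nonzero. rewrite <- LL. apply Rmult_integral_contrapositive; split; auto.
    apply Rinv_neq_0_compat. apply pow_nonzero. generalize (mu1 s0); lra. }
  split; auto.
  intro s. specialize (HV s). rewrite <- LL in HV. unfold normal_deriv. fold G.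
  assert (EW : sev (ct ep k G) s 0 = c * lam kk r ep s ^ k * a s) by apply (Hc s). rewrite EW.
  fold (mu s). rewrite Rpow_mult_distr in HV.
  transitivity (c ^ 3 * lam kk r ep s ^ k * (a s ^ 3 * (lam kk r ep s ^ (2 * k) * lam kk r (- ep) s ^ (2 * k)))).
  { replace (2 * k)%nat with (k + k)%nat by lia. rewrite !pow_add. ring. }
  rewrite HV. ring.
Qed.
End Relation.

(** * Integrals as polynomials of the Larmor centre *)

(** Polynomial functions of degree at most n in Horner form; only degree and zeros matter, so no
    coefficient list is kept. *)
Fixpoint Pol (n : nat) (f : C -> C) : Prop :=
  match n with
  | O => exists c, forall z, f z = c
  | S n => exists c g, Pol n g /\ forall z, f z = Cplus c (z * g z)%C
  end.
Lemma Pol_ext n f g : (forall z, f z = g z) -> Pol n f -> Pol n g.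
Proof.
  destruct n; simpl; intros E.
  - intros [c H]. exists c. intros; rewrite <- E; auto.
  - intros [c [h [P H]]]. exists c, h. split; auto. intros; rewrite <- E; auto.
Qed.
Lemma Pol_const n c : Pol n (fun _ => c).
Proof.
  revert c; induction n; intro c; simpl. exists c; auto.
  exists c, (fun _ => RtoC 0). split; auto. intros; ring.
Qed.
Lemma Pol_S n : forall f, Pol n f -> Pol (S n) f.
Proof.
  induction n; intros f H.
  - destruct H as [c H]. exists c, (fun _ => RtoC 0). split. apply Pol_const. intros; rewrite H; ring.
  - destruct H as [c [g [P H]]]. exists c, g. split; auto.
Qed.
Lemma Pol_le n m f : (n <= m)%nat -> Pol n f -> Pol m f.
Proof. induction 1; auto. intro; apply Pol_S; auto. Qed.
Lemma Pol_add n : forall f g, Pol n f -> Pol n g -> Pol n (fun z => (f z + g z)%C).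
Proof.
  induction n; intros f g.
  - intros [c H] [d K]. exists (c + d)%C. intros; rewrite H, K; auto.
  - intros [c [h [P H]]] [d [k [Q K]]]. exists (c + d)%C, (fun z => (h z + k z)%C). split; auto.
    intros; rewrite H, K; ring.
Qed.
Lemma Pol_scal n a : forall f, Pol n f -> Pol n (fun z => (a * f z)%C).
Proof.
  induction n; intros f.
  - intros [c H]. exists (a * c)%C. intros; rewrite H; auto.
  - intros [c [h [P H]]]. exists (a * c)%C, (fun z => (a * h z)%C). split; auto.
    intros; rewrite H; ring.
Qed.
Lemma Pol_mulz n f : Pol n f -> Pol (S n) (fun z => (z * f z)%C).
Proof. intros H. exists (RtoC 0), f. split; auto. intros; ring. Qed.
Lemma Pol_mul n : forall m f g, Pol n f -> Pol m g -> Pol (n + m) (fun z => (f z * g z)%C).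
Proof.
  induction n; intros m f g.
  - intros [c H] K. simpl. apply Pol_ext with (2 := Pol_scal m c g K). intros; rewrite H; auto.
  - intros [c [h [P H]]] K. simpl plus.
    apply Pol_ext with (f := fun z => (c * g z + z * (h z * g z))%C).
    intros; rewrite H; ring.
    apply Pol_add. apply Pol_le with m. lia. apply Pol_scal; auto. apply Pol_mulz. auto.
Qed.
Lemma Pol_pow n f k : Pol n f -> Pol (k * n) (fun z => (f z ^ k)%C).
Proof.
  intro H; induction k; simpl. apply (Pol_const 0 (RtoC 1)). apply Pol_mul; auto.
Qed.
Lemma Pol_id : Pol 1 (fun z => z).
Proof. exists (RtoC 0), (fun _ => RtoC 1). split. apply Pol_const. intros; ring. Qed.
Lemma Pol_diff n : forall f a, Pol (S n) f -> exists g, Pol n g /\ forall z, f z = (f a + (z - a) * g z)%C.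
Proof.
  induction n; intros f a [c [g [P H]]].
  - destruct P as [d D]. exists (fun _ => d). split. apply Pol_const. intros z; rewrite !H, !D; ring.
  - destruct (IHn g a P) as [h [Q K]]. exists (fun z => (g a + z * h z)%C). split.
    exists (g a), h. auto.
    intros z. rewrite !H. rewrite (K z). ring.
Qed.
Lemma Pol_root n f a : Pol (S n) f -> f a = RtoC 0 -> exists g, Pol n g /\ forall z, f z = ((z - a) * g z)%C.
Proof. intros P E. destruct (Pol_diff n f a P) as [g [Q K]]. exists g. split; auto. intros z; rewrite K, E; ring. Qed.
Lemma Cminus_nz a b : a <> b -> (a - b)%C <> RtoC 0.
Proof. intros N E. apply N. replace a with (a - b + b)%C by ring. rewrite E. ring. Qed.
Lemma Cmult_integral a b : (a * b)%C = RtoC 0 -> a = RtoC 0 \/ b = RtoC 0.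
Proof. intros H. apply NNPP. intro N. apply not_or_and in N. apply (Cmult_neq_0 a b); tauto. Qed.
Lemma Pol_zero n : forall f (u : nat -> C), (forall i j, u i = u j -> i = j) -> Pol n f ->
  (forall i, f (u i) = RtoC 0) -> forall z, f z = RtoC 0.
Proof.
  induction n; intros f u I P Z z.
  - destruct P as [c P]. rewrite P, <- (P (u 0%nat)). auto.
  - destruct (Pol_root n f (u 0%nat) P (Z 0%nat)) as [g [Q K]].
    rewrite K, (IHn g (fun i => u (S i))); auto. ring.
    + intros i j E. apply I in E. lia.
    + intros i. assert (E := Z (S i)). rewrite K in E. apply Cmult_integral in E. destruct E as [E|E]; auto.
      exfalso. apply (Cminus_nz (u (S i)) (u 0%nat)); auto. intro F. apply I in F. lia.
Qed.

(** * Polynomials in w and its conjugate, restricted to circles *)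

Inductive wpoly : (C -> C) -> Prop :=
| wp_const c : wpoly (fun _ => c)
| wp_id : wpoly (fun w => w)
| wp_conj : wpoly Cconj
| wp_add f g : wpoly f -> wpoly g -> wpoly (fun w => (f w + g w)%C)
| wp_mul f g : wpoly f -> wpoly g -> wpoly (fun w => (f w * g w)%C)
| wp_ext f g : (forall w, f w = g w) -> wpoly f -> wpoly g.

Lemma wp_pow f k : wpoly f -> wpoly (fun w => (f w ^ k)%C).
Proof. intro H; induction k; simpl. apply wp_const. apply wp_mul; auto. Qed.
Lemma wp_affine f a b : wpoly f -> wpoly (fun w => f (a * w + b)%C).
Proof.
  induction 1.
  - apply wp_const.
  - apply wp_add. apply wp_mul. apply wp_const. apply wp_id. apply wp_const.
  - apply wp_ext with (f := fun w => (Cconj a * Cconj w + Cconj b)%C).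
    intros; rewrite Cplus_conj, Cmult_conj; auto.
    apply wp_add. apply wp_mul. apply wp_const. apply wp_conj. apply wp_const.
  - apply wp_add; auto.
  - apply wp_mul; auto.
  - apply wp_ext with (2 := IHwpoly). auto.
Qed.
Lemma wpoly_real G : wpoly G -> exists u v : pexpr R, forall w : C,
  G w = (evR u (fst w) (snd w), evR v (fst w) (snd w)).
Proof.
  induction 1.
  - exists (PC (fst c)), (PC (snd c)). intros; destruct c; auto.
  - exists PX, PY. intros [a b]; auto.
  - exists PX, (PM (PC (-1)) PY). intros [a b]; unfold Cconj; simpl. f_equal; ring.
  - destruct IHwpoly1 as [u [v H1]]. destruct IHwpoly2 as [u' [v' H2]].
    exists (PA u u'), (PA v v'). intros; rewrite H1, H2; auto.
  - destruct IHwpoly1 as [u [v H1]]. destruct IHwpoly2 as [u' [v' H2]].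
    exists (PA (PM u u') (PM (PC (-1)) (PM v v'))), (PA (PM u v') (PM v u')). intros; rewrite H1, H2.
    unfold Cmult; simpl. f_equal; ring.
  - destruct IHwpoly as [u [v K]]. exists u, v. intros; rewrite <- H; auto.
Qed.

Lemma unit_conj z : Cmod z = 1 -> (z * Cconj z)%C = RtoC 1.
Proof. intro H. rewrite <- Cmod2_conj, H. simpl. apply injective_projections; simpl; ring. Qed.
Lemma unit_nz z : Cmod z = 1 -> z <> RtoC 0.
Proof. intro H. apply Cmod_gt_0. lra. Qed.

(** [P] is a polynomial in [w] and [Cconj w] whose restriction to every unit circle is a Laurent
    polynomial with exponents between [-b] and [a]. *)
Definition laurent_bounded (a b : nat) (P : C -> C) : Prop := wpoly P /\
  forall d, exists p, Pol (a + b) p /\ forall z, Cmod z = 1 -> (z ^ b * P (z + d)%C)%C = p z.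
(** On the unit circle 1/z is [Cconj z], so negative powers are extended as powers of the conjugate.
    A shift by d does not raise the degrees in w and in its conjugate, which gives the same bounds a
    and b on every unit circle. *)
Lemma laurent b : forall a p, Pol (a + b) p -> exists P, laurent_bounded a b P /\
  forall z, Cmod z = 1 -> (z ^ b * P z)%C = p z.
Proof.
  induction b.
  - induction a; intros p H.
    + destruct H as [c H]. exists (fun _ => c). split; [split|].
      * apply wp_const.
      * intros d. exists (fun _ => c). split. apply Pol_const. intros; simpl; ring.
      * intros z _. rewrite H. simpl; ring.
    + destruct H as [c [g [Q H]]]. destruct (IHa g Q) as [P [[WP SP] EP]].
      exists (fun w => (c + w * P w)%C). split; [split|].
      * apply wp_add. apply wp_const. apply wp_mul. apply wp_id. auto.
      * intros d. destruct (SP d) as [p' [Pp' Ep']].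
        exists (fun z => (c + (z * p' z + d * p' z))%C). split.
        apply (Pol_add (S (a + 0)) (fun _ => c)). apply Pol_const. apply Pol_add. apply Pol_mulz; auto. apply Pol_S, Pol_scal; auto.
        intros z Hz. rewrite <- Ep' by auto. simpl. ring.
      * intros z Hz. rewrite H, <- EP by auto. simpl. ring.
  - intros a p H. replace (a + S b)%nat with (S (a + b)) in H by lia.
    destruct H as [c [g [Q H]]]. destruct (IHb a g Q) as [P [[WP SP] EP]].
    exists (fun w => (c * Cconj w ^ (S b) + P w)%C). split; [split|].
    + apply wp_add; auto. apply wp_mul. apply wp_const. apply wp_pow, wp_conj.
    + intros d. destruct (SP d) as [p' [Pp' Ep']].
      exists (fun z => (c * (RtoC 1 + z * Cconj d) ^ (S b) + z * p' z)%C). split.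
      * replace (a + S b)%nat with (S (a + b)) by lia.
        apply Pol_add. 2: apply Pol_mulz; auto.
        apply Pol_scal. apply Pol_le with (S b * 1)%nat. lia. apply Pol_pow.
        apply Pol_add. apply Pol_const. exists (RtoC 0), (fun _ => Cconj d). split. apply Pol_const. intros; ring.
      * intros z Hz. rewrite <- Ep' by auto. rewrite <- (unit_conj z Hz).
        replace (z * Cconj z + z * Cconj d)%C with (z * Cconj (z + d))%C.
        2:{ rewrite Cplus_conj. ring. }
        rewrite Cpow_mult_l. rewrite (Cpow_S z). ring.
    + intros z Hz. rewrite H, <- EP by auto.
      transitivity (c * (z * Cconj z) ^ (S b) + z * (z ^ b * P z))%C.
      rewrite Cpow_mult_l, (Cpow_S z). ring.
      rewrite unit_conj by auto. rewrite Cpow_1_l. ring.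
Qed.
Lemma wpoly_circle G : wpoly G -> forall x r, exists M n p, Pol n p /\
  forall z, Cmod z = 1 -> (z ^ M * G (x + r * z)%C)%C = p z.
Proof.
  induction 1; intros x r.
  - exists 0%nat, 0%nat, (fun _ => c). split. apply Pol_const. intros; simpl; ring.
  - exists 0%nat, 1%nat, (fun z => (x + r * z)%C). split.
    apply Pol_add. apply Pol_const. apply Pol_scal, Pol_id. intros; simpl; ring.
  - exists 1%nat, 1%nat, (fun z => (Cconj x * z + Cconj r)%C). split.
    apply Pol_add. apply Pol_scal, Pol_id. apply Pol_const.
    intros z Hz. rewrite Cplus_conj, Cmult_conj.
    transitivity (Cconj x * z + Cconj r * (z * Cconj z))%C. simpl; ring.
    rewrite unit_conj by auto. ring.
  - destruct (IHwpoly1 x r) as [M [n [p [P E]]]]. destruct (IHwpoly2 x r) as [M' [n' [p' [P' E']]]].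
    exists (M + M')%nat, ((M' * 1 + n) + (M * 1 + n'))%nat, (fun z => (z ^ M' * p z + z ^ M * p' z)%C).
    split. apply Pol_add.
    apply Pol_le with (M' * 1 + n)%nat. lia. apply Pol_mul; auto. apply (Pol_pow 1 (fun z => z)), Pol_id.
    apply Pol_le with (M * 1 + n')%nat. lia. apply Pol_mul; auto. apply (Pol_pow 1 (fun z => z)), Pol_id.
    intros z Hz. rewrite <- E, <- E' by auto. rewrite Cpow_add_r. ring.
  - destruct (IHwpoly1 x r) as [M [n [p [P E]]]]. destruct (IHwpoly2 x r) as [M' [n' [p' [P' E']]]].
    exists (M + M')%nat, (n + n')%nat, (fun z => (p z * p' z)%C).
    split. apply Pol_mul; auto.
    intros z Hz. rewrite <- E, <- E' by auto. rewrite Cpow_add_r. ring.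
  - destruct (IHwpoly x r) as [M [n [p [P E]]]]. exists M, n, p. split; auto. intros; rewrite <- H; auto.
Qed.

(** The point common to the unit circles centred at 0 and d, on the left of d. *)
Definition zint (d : C) : C := (d * (1 / 2, sqrt (/ (Cmod d ^ 2) - 1 / 4))%R)%C.
Lemma Cmod_sq (z : C) : Cmod z ^ 2 = fst z ^ 2 + snd z ^ 2.
Proof. apply Cmod2_alt. Qed.
Lemma Cmod_unit_iff (z : C) : fst z ^ 2 + snd z ^ 2 = 1 -> Cmod z = 1.
Proof. intros H. unfold Cmod. rewrite H. apply sqrt_1. Qed.
Lemma sqrt_zint d : 0 < Cmod d < 2 -> sqrt (/ (Cmod d ^ 2) - 1 / 4) ^ 2 = / (Cmod d ^ 2) - 1 / 4 /\ 0 < sqrt (/ (Cmod d ^ 2) - 1 / 4).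
Proof.
  intros [P Q]. assert (X : 0 < / Cmod d ^ 2 - 1 / 4).
  { assert (1 / 4 < / Cmod d ^ 2).
    { replace (1/4) with (/ 4) by lra. apply Rinv_lt_contravar; nra. } lra. }
  split. apply pow2_sqrt. lra. apply sqrt_lt_R0. auto.
Qed.
Lemma zint_spec d : 0 < Cmod d < 2 -> Cmod (zint d) = 1 /\ Cmod (zint d - d) = 1 /\
  Re (zint d * Cconj d) = Cmod d ^ 2 / 2.
Proof.
  intros H. destruct (sqrt_zint d H) as [E _]. unfold zint.
  set (h := sqrt (/ (Cmod d ^ 2) - 1 / 4)) in *.
  assert (D : Cmod d ^ 2 <> 0) by (apply pow_nonzero; lra).
  rewrite Cmod_sq in E. rewrite Cmod_sq in D.
  assert (N : (1 / 4 + h ^ 2) * (fst d ^ 2 + snd d ^ 2) = 1) by (rewrite E; field; auto).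
  rewrite Cmod_sq. destruct d as [a b]. clearbody h. unfold fst, snd in N.
  split; [|split].
  - apply Cmod_unit_iff. refine (eq_trans _ N). simpl. field.
  - apply Cmod_unit_iff. refine (eq_trans _ N). simpl. field.
  - unfold Re; simpl. field.
Qed.

(** * Circles in general position *)

Lemma Cmod_sym a b : Cmod (a - b) = Cmod (b - a).
Proof. rewrite <- Cmod_opp. f_equal. ring. Qed.
Lemma Cmod_tri3 a b c : Cmod (a - c) <= Cmod (a - b) + Cmod (b - c).
Proof. replace (a - c)%C with (a - b + (b - c))%C by ring. apply Cmod_triangle. Qed.
Lemma Cmod_minus_self a : Cmod (a - a) = 0.
Proof. replace (a - a)%C with (RtoC 0) by ring. apply Cmod_0. Qed.
Lemma RtoC_nz x : x <> 0 -> RtoC x <> RtoC 0.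
Proof. intros H E. injection E. auto. Qed.

(** If b lies on the circle, moving it outwards by d/2 leaves a disc of radius d/2 free of the
    circle; otherwise the distance from b to the circle limits the radius. *)
Lemma avoid_circle (e : C) (rho : R) (b : C) (d : R) : 0 < d -> exists b' d', 0 < d' /\
  (forall x, Cmod (x - b') < d' -> Cmod (x - b) < d) /\
  forall x, Cmod (x - b') < d' -> Cmod (x - e) <> rho.
Proof.
  intros Hd. destruct (Req_dec (Cmod (b - e)) rho) as [E|N].
  - assert (U : exists u, Cmod u = 1 /\ Cmod (b + RtoC (d / 2) * u - e) = rho + d / 2).
    (* A circle of radius 0 has no preferred outward direction at its point; any unit vector
       serves. *)
    { destruct (Req_dec (Cmod (b - e)) 0) as [Z|Z].
      - exists (RtoC 1). split. rewrite Cmod_1; auto. apply Cmod_eq_0 in Z.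
        replace (_ - e)%C with (b - e + RtoC (d / 2))%C by ring. rewrite Z in *.
        rewrite Cmod_0 in E. rewrite Cplus_0_l, Cmod_R, Rabs_pos_eq by lra. lra.
      - assert (P : 0 < Cmod (b - e)) by (generalize (Cmod_ge_0 (b - e)%C); lra).
        assert (Zc := RtoC_nz _ Z).
        exists ((b - e) / RtoC (Cmod (b - e)))%C. split.
        rewrite Cmod_div, Cmod_R, Rabs_pos_eq by (auto; lra). field; auto.
        replace (_ - e)%C with ((b - e) * RtoC (1 + d / 2 / Cmod (b - e)))%C.
        rewrite Cmod_mult, Cmod_R, Rabs_pos_eq. rewrite E. field. lra.
        assert (0 < d / 2 / Cmod (b - e)) by (repeat apply Rdiv_lt_0_compat; lra). lra.
        rewrite RtoC_plus, (RtoC_div _ (Cmod (b - e))) by auto. field. auto. }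
    destruct U as [u [U1 U2]]. exists (b + RtoC (d / 2) * u)%C, (d / 2).
    split. lra. split.
    + intros x Hx. eapply Rle_lt_trans. apply Cmod_tri3 with (b := (b + RtoC (d / 2) * u)%C).
      replace (b + RtoC (d / 2) * u - b)%C with (RtoC (d / 2) * u)%C by ring.
      rewrite Cmod_mult, U1, Cmod_R, Rabs_pos_eq by lra. lra.
    + intros x Hx Ex. generalize (Cmod_tri3 (b + RtoC (d / 2) * u)%C x e). rewrite U2, Ex.
      rewrite Cmod_sym in Hx. lra.
  - assert (Q : 0 < Rabs (Cmod (b - e) - rho)) by (apply Rabs_pos_lt; lra).
    exists b, (Rmin d (Rabs (Cmod (b - e) - rho))). split. apply Rmin_pos; auto. split.
    + intros x Hx. eapply Rlt_le_trans. apply Hx. apply Rmin_l.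
    + intros x Hx Ex. assert (Hx' := Rlt_le_trans _ _ _ Hx (Rmin_r _ _)).
      assert (A := Cmod_tri3 b x e). assert (B := Cmod_tri3 x b e). rewrite (Cmod_sym b x) in A.
      apply (Rlt_not_le _ _ Hx'). apply Rabs_le. lra.
Qed.
Lemma avoid_circles (l : list (C * R)) : forall (b : C) (d : R), 0 < d -> exists b' d', 0 < d' /\
  (forall x, Cmod (x - b') < d' -> Cmod (x - b) < d) /\
  forall x, Cmod (x - b') < d' -> forall c, In c l -> Cmod (x - fst c) <> snd c.
Proof.
  induction l as [|c l IH]; intros b d Hd.
  - exists b, d. split; auto.
  - destruct (IH b d Hd) as [b1 [d1 [P1 [Q1 S1]]]].
    destruct (avoid_circle (fst c) (snd c) b1 d1 P1) as [b2 [d2 [P2 [Q2 S2]]]].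
    exists b2, d2. split; auto. split; auto.
    intros x Hx c' [<-|Hc]; auto.
Qed.
(** With d = e - x and q = |d|^2, a common point is x + d (1/2 + i t/q), and the two equations
    determine t^2. *)
Lemma two_circles (r : R) (x e : C) : x <> e -> exists l : list C, forall w,
  Cmod (w - x) = r -> Cmod (w - e) = r -> In w l.
Proof.
  intros N. set (d := (e - x)%C).
  assert (D : d <> RtoC 0) by (apply Cminus_nz; auto).
  apply Cmod_gt_0 in D. set (q := Cmod d ^ 2). assert (q0 : 0 < q) by (unfold q; nra).
  set (K := sqrt (r ^ 2 * q - q ^ 2 / 4)).
  set (pt_ := fun t : R => (x + d * (1 / 2, t / q)%R)%C).
  exists (pt_ K :: pt_ (- K) :: nil). intros w H1 H2.
  assert (Q : q = fst d ^ 2 + snd d ^ 2) by apply Cmod_sq.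
  assert (E1 := Cmod_sq (w - x)%C). rewrite H1 in E1.
  assert (E2 := Cmod_sq (w - e)%C). rewrite H2 in E2.
  set (v := (w - x)%C) in *.
  assert (Ev : (w - e)%C = (v - d)%C) by (unfold v, d; ring). rewrite Ev in E2.
  assert (W : w = (x + v)%C) by (unfold v; ring).
  destruct v as [v1 v2]. destruct d as [d1 d2] eqn:Ed. simpl fst in *. simpl snd in *.
  set (t := v2 * d1 - v1 * d2).
  assert (A : 2 * (v1 * d1 + v2 * d2) = q) by nra.
  assert (B : t ^ 2 = r ^ 2 * q - q ^ 2 / 4).
  { replace (q ^ 2 / 4) with ((v1 * d1 + v2 * d2) ^ 2) by (rewrite <- A; field).
    rewrite E1, Q. unfold t. ring. }
  assert (K2 : K ^ 2 = t ^ 2).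
  { unfold K. rewrite <- B. apply pow2_sqrt. apply pow2_ge_0. }
  assert (T : t = K \/ t = - K).
  { assert (Z : (t - K) * (t + K) = 0) by nra. apply Rmult_integral in Z. lra. }
  assert (P : w = pt_ t).
  { rewrite W. unfold pt_. f_equal.
    apply injective_projections; simpl; apply Rmult_eq_reg_r with q; try lra.
    - transitivity (d1 * (q / 2) - d2 * t). 2: field; lra. rewrite <- A at 2. rewrite Q. unfold t. field.
    - transitivity (d1 * t + d2 * (q / 2)). 2: field; lra. rewrite <- A at 2. rewrite Q. unfold t. field. }
  rewrite P. destruct T as [-> | ->]; simpl; auto.
Qed.
Lemma list_circles_meet (r : R) (x : C) (T : list C) : (forall e, In e T -> x <> e) ->
  exists l : list C, forall e w, In e T -> Cmod (w - x) = r -> Cmod (w - e) = r -> In w l.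
Proof.
  induction T as [|e T IH]; intros H.
  - exists nil. intros e w [].
  - destruct IH as [l Hl]. intros; apply H; simpl; auto.
    destruct (two_circles r x e) as [l' Hl']. apply H; simpl; auto.
    exists (l' ++ l). intros e' w [<-|He] A B; apply in_or_app; eauto.
Qed.
(** General position for [local_polynomial]: x1 avoids T, so its circle meets those of T in finitely
    many points, and x is kept off the circles around these points. Radius 0 in a list encodes
    avoiding a point. *)
Lemma choose_centre (r : R) (b : C) (d : R) (T : list C) : 0 < d -> exists x1 b' d',
  Cmod (x1 - b) < d /\ 0 < d' /\ (forall x, Cmod (x - b') < d' -> Cmod (x - b) < d) /\
  forall x, Cmod (x - b') < d' -> x <> x1 /\
    forall w, Cmod (w - x) = r -> Cmod (w - x1) = r -> forall e, In e T -> Cmod (w - e) <> r.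
Proof.
  intros Hd.
  destruct (avoid_circles (map (fun e => (e, 0)) T) b d Hd) as [x1 [d1 [P1 [Q1 S1]]]].
  assert (X1 : Cmod (x1 - x1) < d1) by (rewrite Cmod_minus_self; auto).
  assert (NT : forall e, In e T -> x1 <> e).
  { intros e He E. apply (S1 x1 X1 (e, 0)). apply in_map_iff. exists e; auto. simpl. rewrite E. apply Cmod_minus_self. }
  destruct (list_circles_meet r x1 T NT) as [l Hl].
  destruct (avoid_circles ((x1, 0) :: map (fun p => (p, r)) l) b d Hd) as [b' [d' [P2 [Q2 S2]]]].
  exists x1, b', d'. split; auto. split; auto. split; auto.
  intros x Hx. split.
  - intros E. apply (S2 x Hx (x1, 0)). simpl; auto. simpl. rewrite E. apply Cmod_minus_self.
  - intros w A B e He F. apply (S2 x Hx (w, r)).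
    right. apply in_map_iff. exists w. split; auto. eapply Hl; eauto.
    simpl. rewrite Cmod_sym. auto.
Qed.

(** The values [p x z] for different centres [x] of circles of radius [r] come from one function
    of the point [x + r z], except at points at distance [r] from [T]. *)
Definition consistent (r : R) (N : nat) (b : C) (d : R) (T : list C) (p : C -> C -> C) : Prop :=
  forall x x' z z', Cmod (x - b) < d -> Cmod (x' - b) < d -> Cmod z = 1 -> Cmod z' = 1 ->
    (x + RtoC r * z)%C = (x' + RtoC r * z')%C ->
    (forall e, In e T -> Cmod (x + RtoC r * z - e) <> r) ->
    (z' ^ N * p x z)%C = (z ^ N * p x' z')%C.

(** * Functions that are Laurent polynomials on all circles of one radius *)

Lemma Cmult_reg_l a b c : a <> RtoC 0 -> (a * b)%C = (a * c)%C -> b = c.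
Proof.
  intros H E. transitivity (/ a * (a * b))%C. field; auto. rewrite E. field; auto.
Qed.

(** Since [Cconj z] is 1/z, the equation of the circle around x1, restricted to the circle around x,
    becomes quadratic after multiplication by z; its roots give the two intersection points. *)
Lemma circle_quadratic (r : R) (x x1 : C) : 0 < r -> x <> x1 -> Cmod (x - x1) < 2 * r ->
  exists z1 z2, let d := ((x - x1) / RtoC r)%C in z1 <> z2 /\
    Cmod z1 = 1 /\ Cmod z2 = 1 /\ Cmod (z1 + d) = 1 /\ Cmod (z2 + d) = 1 /\
    forall z, Cmod z = 1 ->
      (z * ((x + RtoC r * z - x1) * Cconj (x + RtoC r * z - x1) - RtoC (r ^ 2)))%C
      = (RtoC (r ^ 2) * Cconj d * ((z - z1) * (z - z2)))%C.
Proof.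
  intros r0 N L. assert (rz := RtoC_nz r ltac:(lra)).
  set (d := ((x - x1) / RtoC r)%C).
  assert (Dm : Cmod d = Cmod (x - x1) / r).
  { unfold d. rewrite Cmod_div, Cmod_R, Rabs_pos_eq; auto. lra. }
  assert (Dp : 0 < Cmod (x - x1)) by (apply Cmod_gt_0, Cminus_nz; auto).
  assert (DR : 0 < Cmod d < 2).
  { rewrite Dm. split. apply Rdiv_lt_0_compat; auto. apply Rmult_lt_reg_r with r; auto.
    unfold Rdiv. rewrite Rmult_assoc, Rinv_l; lra. }
  destruct (sqrt_zint d DR) as [E H0]. set (h := sqrt (/ (Cmod d ^ 2) - 1 / 4)) in *.
  assert (D2 : Cmod d ^ 2 <> 0) by (apply pow_nonzero; lra).
  rewrite Cmod_sq in E. rewrite Cmod_sq in D2.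
  assert (Nn : (1 / 4 + h ^ 2) * (fst d ^ 2 + snd d ^ 2) = 1) by (rewrite E; field; auto).
  exists (- (d * (1 / 2, h)%R))%C, (- (d * (1 / 2, - h)%R))%C. cbv zeta. fold d.
  assert (X : (RtoC r * d)%C = (x - x1)%C) by (unfold d; field; auto).
  split.
  { intro F. assert (G : (d * (1/2, h)%R)%C = (d * (1/2, -h)%R)%C).
    { replace (d * (1/2, h)%R)%C with (- - (d * (1/2, h)%R))%C by ring. rewrite F. ring. }
    apply Cmult_reg_l in G. injection G. lra. apply Cmod_gt_0. tauto. }
  clear E. destruct d as [a b] eqn:Ed. clearbody h. unfold fst, snd in Nn.
  repeat split; try (apply Cmod_unit_iff; refine (eq_trans _ Nn); simpl; field).
  intros z Hz.
  replace (x + RtoC r * z - x1)%C with (RtoC r * ((a, b)%R + z))%C.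
  2:{ transitivity (RtoC r * (a, b)%R + RtoC r * z)%C. ring. rewrite X. ring. }
  assert (Z1 : fst z ^ 2 + snd z ^ 2 = 1) by (rewrite <- Cmod_sq, Hz; ring).
  assert (S1 : (- ((a, b)%R * (1 / 2, h)%R) + - ((a, b)%R * (1 / 2, - h)%R))%C = (- (a, b)%R)%C).
  { apply injective_projections; simpl; field. }
  assert (S2 : (Cconj (a, b) * (- ((a, b)%R * (1 / 2, h)%R) * - ((a, b)%R * (1 / 2, - h)%R)))%C = (a, b)).
  { transitivity ((a, b)%R * RtoC ((1 / 4 + h ^ 2) * (a ^ 2 + b ^ 2)))%C.
    apply injective_projections; simpl; field. rewrite Nn. ring. }
  set (z1 := (- ((a, b)%R * (1 / 2, h)%R))%C) in *. set (z2 := (- ((a, b)%R * (1 / 2, - h)%R))%C) in *.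
  set (dd := (a, b) : C) in *.
  transitivity (RtoC (r ^ 2) * (Cconj dd * (z * z) + dd * Cconj dd * z + dd))%C.
  - rewrite !Cmult_conj, !Cplus_conj. rewrite RtoC_pow.
    replace (Cconj (RtoC r)) with (RtoC r) by (apply injective_projections; simpl; ring).
    transitivity (RtoC r ^ 2 * (Cconj dd * (z * z) + dd * Cconj dd * z + (dd * (z * Cconj z) + z * (z * Cconj z - RtoC 1))))%C.
    ring. rewrite (unit_conj z Hz). ring.
  - transitivity (RtoC (r ^ 2) * (Cconj dd * (z * z) - Cconj dd * z * (z1 + z2) + Cconj dd * (z1 * z2)))%C.
    rewrite S1, S2. ring. ring.
Qed.

(** Induction on N. The data on the circle of x1 are extended to the plane and subtracted. On any
    other circle the difference vanishes at the two points shared with that of x1, so it is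
    divisible by the equation [q1] of that circle, and the quotient belongs to N - 1. On the circle
    of x1 the quotient is not controlled, so x1 joins the exceptional list T. *)
Lemma local_polynomial (r : R) (r0 : 0 < r) (N : nat) : forall b d T p, 0 < d <= r ->
  (forall x, Cmod (x - b) < d -> Pol (2 * N) (p x)) -> consistent r N b d T p ->
  exists G b' d', wpoly G /\ 0 < d' /\ (forall x, Cmod (x - b') < d' -> Cmod (x - b) < d) /\
    forall x z, Cmod (x - b') < d' -> Cmod z = 1 ->
      p x z = (z ^ N * G (x + RtoC r * z)%C)%C.
Proof.
  assert (rz := RtoC_nz r ltac:(lra)).
  induction N; intros b d T p [d0 dr] HP HC;
  destruct (choose_centre r b d T d0) as [x1 [b' [d' [X1 [P' [Q' S']]]]]].
  all: assert (near : forall x, Cmod (x - b') < d' -> x <> x1 /\ Cmod (x - x1) < 2 * r)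
    by (intros x Hx; split; [apply S'; auto|]; eapply Rle_lt_trans; [apply Cmod_tri3 with (b := b)|];
        rewrite (Cmod_sym b x1); specialize (Q' x Hx); lra).
  (* For N = 0 each circle carries one constant, and it is compared at a point shared with the
     circle of x1. *)
  - destruct (HP x1 X1) as [c Hc]. exists (fun _ => c), b', d'. split. apply wp_const. split; auto. split; auto.
    intros x z Hx Hz. destruct (near x Hx) as [Nx Lx].
    destruct (circle_quadratic r x x1 r0 Nx Lx) as [z1 [z2 [_ [U1 [_ [V1 _]]]]]].
    destruct (HP x (Q' x Hx)) as [cx Hcx].
    assert (WE : (x + RtoC r * z1)%C = (x1 + RtoC r * (z1 + (x - x1) / RtoC r))%C) by (field; auto).
    assert (M := HC x x1 z1 _ (Q' x Hx) X1 U1 V1 WE).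
    rewrite Hcx, Hc in M. rewrite Hcx. simpl in M |- *. rewrite !Cmult_1_l in M. rewrite Cmult_1_l. apply M.
    intros e He. apply (proj2 (S' x Hx)); auto.
    replace (_ - x)%C with (RtoC r * z1)%C by ring. rewrite Cmod_mult, U1, Cmod_R, Rabs_pos_eq; lra.
    rewrite WE. replace (_ - x1)%C with (RtoC r * (z1 + (x - x1) / RtoC r))%C by ring.
    rewrite Cmod_mult, V1, Cmod_R, Rabs_pos_eq; lra.
  - assert (HP1 := HP x1 X1). replace (2 * S N)%nat with (S N + S N)%nat in HP1 by lia.
    destruct (laurent _ _ _ HP1) as [P [[WP SP] EP]].
    set (P1 := fun w => P (/ RtoC r * w + - (x1 / RtoC r))%C).
    assert (WP1 : wpoly P1) by (apply wp_affine; auto).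
    assert (E1 : forall x z, P1 (x + RtoC r * z)%C = P (z + (x - x1) / RtoC r)%C).
    { intros. unfold P1. f_equal. field. auto. }
    assert (E11 : forall z, Cmod z = 1 -> (z ^ (S N) * P1 (x1 + RtoC r * z)%C)%C = p x1 z).
    { intros. rewrite E1, <- EP by auto. do 2 f_equal. field. auto. }
    set (q1 := fun w => ((w - x1) * Cconj (w - x1) - RtoC (r ^ 2))%C).
    assert (Wq : wpoly q1).
    { apply wp_ext with (f := fun w => ((w + - x1) * (Cconj w + Cconj (- x1)) + - RtoC (r ^ 2))%C).
      intros w. unfold q1. rewrite <- Cplus_conj. reflexivity.
      repeat first [apply wp_add | apply wp_mul | apply wp_id | apply wp_conj | apply wp_const]. }
    assert (EX : forall x, exists g, Cmod (x - b') < d' -> Pol (2 * N) g /\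
       forall z, Cmod z = 1 -> p x z = (z ^ (S N) * P1 (x + RtoC r * z)%C + z * q1 (x + RtoC r * z)%C * g z)%C).
    { intros x. destruct (Rlt_dec (Cmod (x - b')) d') as [Hx|Hx].
      2:{ exists (fun _ => RtoC 0). intros; contradiction. }
      destruct (near x Hx) as [Nx Lx].
      destruct (circle_quadratic r x x1 r0 Nx Lx) as [z1 [z2 [Z12 [U1 [U2 [V1 [V2 QE]]]]]]].
      set (dd := ((x - x1) / RtoC r)%C) in *.
      destruct (SP dd) as [p1 [Pp1 Ep1]].
      set (f := fun z => (p x z + RtoC (-1) * p1 z)%C).
      assert (Pf : Pol (S (S (2 * N))) f).
      { apply Pol_add. replace (S (S (2 * N))) with (2 * S N)%nat by lia. apply HP; auto.
        apply Pol_scal. replace (S (S (2 * N))) with (S N + S N)%nat by lia. auto. }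
      assert (Rt : forall zi, Cmod zi = 1 -> Cmod (zi + dd) = 1 -> f zi = RtoC 0).
      { intros zi Ui Vi.
        assert (WE : (x + RtoC r * zi)%C = (x1 + RtoC r * (zi + dd))%C) by (unfold dd; field; auto).
        assert (M := HC x x1 zi _ (Q' x Hx) X1 Ui Vi WE).
        rewrite <- E11 in M by auto. rewrite <- WE, E1 in M. fold dd in M.
        unfold f. rewrite <- Ep1 by auto.
        assert (p x zi = (zi ^ (S N) * P (zi + dd)%C)%C).
        { apply Cmult_reg_l with ((zi + dd) ^ (S N))%C. apply Cpow_nz, unit_nz; auto.
          rewrite M. ring.
          intros e He. apply (proj2 (S' x Hx)); auto.
          replace (_ - x)%C with (RtoC r * zi)%C by ring. rewrite Cmod_mult, Ui, Cmod_R, Rabs_pos_eq; lra.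
          rewrite WE. replace (_ - x1)%C with (RtoC r * (zi + dd))%C by ring.
          rewrite Cmod_mult, Vi, Cmod_R, Rabs_pos_eq; lra. }
        rewrite H. ring. }
      destruct (Pol_root _ _ z1 Pf (Rt z1 U1 V1)) as [g1 [Pg1 Eg1]].
      assert (R2 := Rt z2 U2 V2). rewrite Eg1 in R2. apply Cmult_integral in R2.
      destruct R2 as [R2|R2]. { exfalso. apply (Cminus_nz z2 z1); auto. }
      destruct (Pol_root _ _ z2 Pg1 R2) as [g2 [Pg2 Eg2]].
      assert (dz : Cconj dd <> RtoC 0).
      { apply Cmod_gt_0. rewrite Cmod_conj. apply Cmod_gt_0. unfold dd. intro F.
        apply (Cminus_nz x x1 Nx). replace (x - x1)%C with (RtoC r * ((x - x1) / RtoC r))%C by (field; auto).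
        rewrite F. ring. }
      assert (r2z : RtoC (r ^ 2) <> RtoC 0) by (apply RtoC_nz, pow_nonzero; lra).
      exists (fun z => (/ (RtoC (r ^ 2) * Cconj dd) * g2 z)%C). intros _. split.
      apply Pol_scal; auto.
      intros z Hz. fold (q1 (x + RtoC r * z)%C) in QE.
      specialize (QE z Hz). unfold q1. rewrite QE. rewrite E1. fold dd.
      transitivity (p1 z + f z)%C. unfold f. ring.
      rewrite Eg1, Eg2. f_equal. symmetry; apply Ep1; auto. field. auto. }
    (* The quotients are chosen circle by circle; that they are consistent follows from [HC] by
       cancelling [q1]. *)
    set (p' := fun x => epsilon (inhabits (fun _ : C => RtoC 0)) (fun g => Cmod (x - b') < d' -> Pol (2 * N) g /\
       forall z, Cmod z = 1 -> p x z = (z ^ (S N) * P1 (x + RtoC r * z)%C + z * q1 (x + RtoC r * z)%C * g z)%C)).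
    assert (HP' : forall x, Cmod (x - b') < d' -> Pol (2 * N) (p' x) /\
       forall z, Cmod z = 1 -> p x z = (z ^ (S N) * P1 (x + RtoC r * z)%C + z * q1 (x + RtoC r * z)%C * p' x z)%C).
    { intro x. apply (epsilon_spec (inhabits (fun _ : C => RtoC 0)) _ (EX x)). }
    assert (D' : 0 < Rmin d' r <= r) by (split; [apply Rmin_pos; auto | apply Rmin_r]).
    assert (sub : forall x, Cmod (x - b') < Rmin d' r -> Cmod (x - b') < d').
    { intros x Hx. eapply Rlt_le_trans. apply Hx. apply Rmin_l. }
    destruct (IHN b' (Rmin d' r) (x1 :: T) p' D') as [G [b2 [d2 [WG [P2 [Q2 S2]]]]]].
    + intros x Hx. apply HP'; auto.
    + intros x x' z z' Hx Hx' Hz Hz' WE HT. apply sub in Hx, Hx'.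
      assert (M := HC x x' z z' (Q' x Hx) (Q' x' Hx') Hz Hz' WE (fun e He => HT e (or_intror He))).
      rewrite (proj2 (HP' x Hx) z Hz), (proj2 (HP' x' Hx') z' Hz') in M. rewrite <- WE in M.
      set (w := (x + RtoC r * z)%C) in *.
      assert (qn : q1 w <> RtoC 0).
      { intro F. apply (HT x1). simpl; auto. unfold q1 in F.
        assert (F' : RtoC (Cmod (w - x1) ^ 2) = RtoC (r ^ 2)).
        { rewrite Cmod2_conj. replace ((w - x1) * _)%C with (q1 w + RtoC (r ^ 2))%C by (unfold q1; ring).
          unfold q1. rewrite F. ring. }
        injection F' as F'. assert (0 <= Cmod (w - x1)) by apply Cmod_ge_0.
        assert (Z : (Cmod (w - x1) - r) * (Cmod (w - x1) + r) = 0) by lra.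
        apply Rmult_integral in Z. lra. }
      apply Cmult_reg_l with (q1 w * (z * z'))%C.
      repeat apply Cmult_neq_0; auto; apply unit_nz; auto.
      transitivity (z' ^ (S N) * (z ^ (S N) * P1 w + z * q1 w * p' x z) - z' ^ (S N) * z ^ (S N) * P1 w)%C.
      simpl; ring. rewrite M. simpl; ring.
    + exists (fun w => (P1 w + q1 w * G w)%C), b2, d2.
      split. apply wp_add; auto. apply wp_mul; auto. split; auto. split; auto.
      intros x z Hx Hz. rewrite (proj2 (HP' x (sub x (Q2 x Hx))) z Hz), (S2 x z Hx Hz). simpl. ring.
Qed.

(** The circle of x meets the circles of infinitely many centres near y, on which the formula is
    known; two Laurent polynomials on the circle of x therefore agree at infinitely many points. *)
Lemma spread (r : R) (r0 : 0 < r) (N : nat) b d p G y ep : 0 < d <= r ->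
  (forall x, Cmod (x - b) < d -> Pol (2 * N) (p x)) -> consistent r N b d nil p -> wpoly G ->
  Cmod (y - b) < d -> 0 < ep ->
  (forall x z, Cmod (x - y) < ep -> Cmod (x - b) < d -> Cmod z = 1 ->
      p x z = (z ^ N * G (x + RtoC r * z)%C)%C) ->
  forall x z, Cmod (x - b) < d -> Cmod z = 1 ->
      p x z = (z ^ N * G (x + RtoC r * z)%C)%C.
Proof.
  assert (rz := RtoC_nz r ltac:(lra)).
  intros [d0 dr] HP HC WG Hy He Hf x z Hx Hz.
  destruct (classic (x = y)) as [->|Nxy].
  { apply Hf; auto. rewrite Cmod_minus_self; auto. }
  set (L := Cmod (x - y)). assert (L0 : 0 < L) by (apply Cmod_gt_0, Cminus_nz; auto).
  set (s0 := Rmin (1 / 2) (ep / (2 * L))).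
  assert (S0 : 0 < s0) by (apply Rmin_pos; [lra|apply Rdiv_lt_0_compat; lra]).
  assert (S1 : s0 <= 1 / 2) by apply Rmin_l.
  assert (S2 : s0 * L < ep).
  { apply Rle_lt_trans with (ep / (2 * L) * L). apply Rmult_le_compat_r. lra. apply Rmin_r.
    replace (ep / (2 * L) * L) with (ep / 2) by (field; lra). lra. }
  (* Distinct fractions of the segment from y to x, small enough to keep the centres [xi i] within
     ep of y. *)
  set (s := fun i : nat => s0 / (INR i + 1)).
  assert (Sp : forall i, 0 < s i <= s0).
  { intro i. generalize (pos_INR i). intro. unfold s. split. apply Rdiv_lt_0_compat; lra.
    apply Rmult_le_reg_r with (INR i + 1). lra. unfold Rdiv. rewrite Rmult_assoc, Rinv_l by lra. nra. }
  set (xi := fun i => (y + RtoC (s i) * (x - y))%C).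
  set (e := ((y - x) / RtoC r)%C).
  set (di := fun i => (RtoC (1 - s i) * e)%C).
  assert (Xi : forall i, (x + RtoC r * di i)%C = xi i).
  { intro i. unfold di, xi, e. rewrite RtoC_minus. field. auto. }
  assert (Em : Cmod e = L / r).
  { unfold e. rewrite Cmod_div, Cmod_R, Rabs_pos_eq by (auto; lra). unfold L. rewrite (Cmod_sym x y). auto. }
  assert (Lr : L < 2 * r).
  { unfold L. eapply Rle_lt_trans. apply Cmod_tri3 with (b := b). rewrite (Cmod_sym b y). lra. }
  assert (Dm : forall i, 0 < Cmod (di i) < 2).
  { intro i. unfold di. rewrite Cmod_mult, Cmod_R, Em. specialize (Sp i). rewrite Rabs_pos_eq by lra.
    assert (0 < L / r) by (apply Rdiv_lt_0_compat; lra).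
    assert (L / r < 2). { apply Rmult_lt_reg_r with r. lra. unfold Rdiv. rewrite Rmult_assoc, Rinv_l; lra. }
    split. apply Rmult_lt_0_compat; lra. nra. }
  assert (Bi : forall i, Cmod (xi i - b) < d /\ Cmod (xi i - y) < ep).
  { intro i. specialize (Sp i). split.
    - unfold xi. replace (_ - b)%C with (RtoC (1 - s i) * (y - b) + RtoC (s i) * (x - b))%C.
      2:{ rewrite RtoC_minus. ring. }
      eapply Rle_lt_trans. apply Cmod_triangle. rewrite !Cmod_mult, !Cmod_R, !Rabs_pos_eq by lra. nra.
    - unfold xi. replace (_ - y)%C with (RtoC (s i) * (x - y))%C by ring.
      rewrite Cmod_mult, Cmod_R, Rabs_pos_eq by lra. fold L. nra. }
  destruct (wpoly_circle G WG x (RtoC r)) as [M [n [g [Pg Eg]]]].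
  set (f := fun w => (w ^ M * p x w + RtoC (-1) * (w ^ N * g w))%C).
  assert (Z : forall w, f w = RtoC 0).
  { apply (Pol_zero ((M * 1 + 2 * N) + (N * 1 + n)) f (fun i => zint (di i))).
    (* The intersection point remembers its centre: its product with e is (1 - s i) |e|^2 / 2. *)
    - intros i j E.
      destruct (zint_spec _ (Dm i)) as [_ [_ A]]. destruct (zint_spec _ (Dm j)) as [_ [_ B]].
      rewrite E in A. unfold di in A at 2. unfold di in B at 2.
      assert (A' : forall k w, Re (w * Cconj (RtoC (1 - s k) * e)) = (1 - s k) * Re (w * Cconj e)).
      { intros. unfold Re; simpl. ring. }
      rewrite A' in A, B. unfold di in A at 2. unfold di in B at 2.
      rewrite Cmod_mult, Cmod_R, Rabs_pos_eq in A by (specialize (Sp i); lra).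
      rewrite Cmod_mult, Cmod_R, Rabs_pos_eq in B by (specialize (Sp j); lra).
      set (q := Re (zint (di j) * Cconj e)) in *.
      assert (Ep : 0 < Cmod e) by (rewrite Em; apply Rdiv_lt_0_compat; lra).
      assert (Qi : q = (1 - s i) * Cmod e ^ 2 / 2).
      { apply Rmult_eq_reg_l with (1 - s i). rewrite A. field. specialize (Sp i); lra. }
      assert (Qj : q = (1 - s j) * Cmod e ^ 2 / 2).
      { apply Rmult_eq_reg_l with (1 - s j). rewrite B. field. specialize (Sp j); lra. }
      assert (Sij : s i = s j). { assert (0 < Cmod e ^ 2) by (apply pow_lt; auto). nra. }
      unfold s in Sij. apply INR_eq. generalize (pos_INR i) (pos_INR j). intros.
      assert (X : s0 * (INR j + 1) = s0 * (INR i + 1)).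
      { transitivity (s0 / (INR i + 1) * (INR i + 1) * (INR j + 1)). field; lra. rewrite Sij. field; lra. }
      nra.
    - unfold f. apply Pol_add. apply Pol_le with (M * 1 + 2 * N)%nat. lia. apply Pol_mul. apply (Pol_pow 1 (fun z => z)), Pol_id. apply HP; auto.
      apply Pol_scal. apply Pol_le with (N * 1 + n)%nat. lia. apply Pol_mul; auto. apply (Pol_pow 1 (fun z => z)), Pol_id.
    - intro i. destruct (zint_spec _ (Dm i)) as [A [B _]]. destruct (Bi i) as [B1 B2].
      set (w := zint (di i)) in *. set (w' := (w - di i)%C) in *.
      assert (WE : (x + RtoC r * w)%C = (xi i + RtoC r * w')%C).
      { rewrite <- Xi. unfold w'. ring. }
      assert (MM := HC x (xi i) w w' Hx B1 A B WE ltac:(intros e' [])).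
      rewrite (Hf (xi i) w' B2 B1 B), <- WE in MM.
      assert (E : p x w = (w ^ N * G (x + RtoC r * w)%C)%C).
      { apply Cmult_reg_l with (w' ^ N)%C. apply Cpow_nz, unit_nz; auto. rewrite MM. ring. }
      unfold f. rewrite E, <- Eg by auto. ring. }
  specialize (Z z). unfold f in Z. rewrite <- Eg in Z by auto.
  apply Cmult_reg_l with (z ^ M)%C. apply Cpow_nz, unit_nz; auto.
  transitivity (RtoC 0 + z ^ M * (z ^ N * G (x + RtoC r * z)%C))%C.
  rewrite <- Z. ring. ring.
Qed.

(** * From polynomials in the velocity to polynomials in the Larmor centre *)

Fixpoint csum (f : nat -> C) (n : nat) : C :=
  match n with O => f 0%nat | S m => Cplus (csum f m) (f (S m)) end.
Lemma RtoC_sum f n : RtoC (sum_f_R0 f n) = csum (fun k => RtoC (f k)) n.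
Proof. induction n; simpl; auto. rewrite RtoC_plus, IHn; auto. Qed.
Lemma csum_ext f g n : (forall k, (k <= n)%nat -> f k = g k) -> csum f n = csum g n.
Proof. intros H; induction n; simpl; rewrite ?IHn, ?H; auto. Qed.
Lemma csum_scal c f n : (c * csum f n)%C = csum (fun k => (c * f k)%C) n.
Proof. induction n; simpl; auto. rewrite <- IHn. ring. Qed.
Lemma Pol_csum m (f : nat -> C -> C) n : (forall k, (k <= n)%nat -> Pol m (f k)) ->
  Pol m (fun z => csum (fun k => f k z) n).
Proof. intros H; induction n; simpl. apply H; auto. apply Pol_add; auto. Qed.

Section Trig.
Variables (ep : R) (N : nat) (a : nat -> nat -> pt -> R).
(** With z = ep J v the velocity is (ep Im z, - ep Re z). On the unit circle z times these
    components are the polynomials [vz1] and [vz2]. *)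
Definition vz1 (z : C) : C := (RtoC ep * ((z * z - RtoC 1) * (0, - / 2)%R))%C.
Definition vz2 (z : C) : C := (RtoC (- ep / 2) * (z * z + RtoC 1))%C.
(** The power of z fills every monomial up to the common factor z^N, which bounds the degree in z by
    2N. *)
Definition ptrig (x : C) (z : C) : C :=
  csum (fun k => csum (fun l => (RtoC (a k l x) * (vz1 z ^ k * (vz2 z ^ l * z ^ (N - k - l))))%C) (N - k)) N.
Lemma vz1_unit z : Cmod z = 1 -> vz1 z = (z * RtoC (ep * Im z))%C.
Proof.
  intro H. assert (Z := Cmod_sq z). rewrite H in Z. destruct z as [u v]. unfold vz1, Im. simpl in *.
  apply injective_projections; simpl; try field.
  transitivity (ep * ((1 - u * u + v * v) / 2)). field. replace 1 with (u * (u * 1) + v * (v * 1)) at 1 by lra. field.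
Qed.
Lemma vz2_unit z : Cmod z = 1 -> vz2 z = (z * RtoC (- ep * Re z))%C.
Proof.
  intro H. assert (Z := Cmod_sq z). rewrite H in Z. destruct z as [u v]. unfold vz2, Re. simpl in *.
  apply injective_projections; simpl; try field.
  transitivity (- ep * ((u * u - v * v + 1) / 2)). field. replace 1 with (u * (u * 1) + v * (v * 1)) at 1 by lra. field.
Qed.
Lemma ptrig_Pol x : Pol (2 * N) (ptrig x).
Proof.
  assert (V1 : Pol 2 vz1).
  { apply Pol_scal. apply Pol_ext with (f := fun z => ((0, - / 2)%R * (z * z + RtoC (-1)))%C). intros; ring.
    apply Pol_scal, Pol_add. apply (Pol_mul 1 1 (fun z => z) (fun z => z)); apply Pol_id. apply Pol_const. }
  assert (V2 : Pol 2 vz2).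
  { apply Pol_scal, Pol_add. apply (Pol_mul 1 1 (fun z => z) (fun z => z)); apply Pol_id. apply Pol_const. }
  apply (Pol_csum (2 * N) (fun k z => csum _ (N - k))). intros k Hk.
  apply (Pol_csum (2 * N) (fun l z => (RtoC (a k l x) * (vz1 z ^ k * (vz2 z ^ l * z ^ (N - k - l))))%C)). intros l Hl.
  apply Pol_scal. apply Pol_le with (k * 2 + (l * 2 + (N - k - l) * 1))%nat. lia.
  apply Pol_mul. apply Pol_pow; auto. apply Pol_mul. apply Pol_pow; auto. apply (Pol_pow 1 (fun z => z)), Pol_id.
Qed.
Lemma ptrig_unit x z : Cmod z = 1 ->
  ptrig x z = (z ^ N * RtoC (polyPhi a N x (ep * Im z, - ep * Re z)%R))%C.
Proof.
  intro H. unfold ptrig, polyPhi. rewrite RtoC_sum, csum_scal. apply csum_ext. intros k Hk.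
  rewrite RtoC_sum, csum_scal. apply csum_ext. intros l Hl.
  rewrite vz1_unit, vz2_unit by auto. simpl fst; simpl snd.
  generalize (ep * Im z) (- ep * Re z). intros u v. rewrite !Cpow_mult_l, !RtoC_mult, !RtoC_pow.
  replace N with (k + (l + (N - k - l)))%nat at 2 by lia. rewrite !Cpow_add_r. ring.
Qed.
End Trig.

Lemma polar (u v : R) : u ^ 2 + v ^ 2 = 1 -> exists f, u = cos f /\ v = sin f.
Proof.
  intros H. assert (B : -1 <= u <= 1) by nra.
  destruct (Rle_dec 0 v).
  - exists (acos u). rewrite cos_acos, sin_acos by auto. split; auto.
    replace (1 - u²) with (v²) by (unfold Rsqr; lra). rewrite sqrt_Rsqr; auto.
  - exists (- acos u). rewrite cos_neg, sin_neg, cos_acos, sin_acos by auto. split; auto.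
    replace (1 - u²) with ((- v)²) by (unfold Rsqr; lra). rewrite sqrt_Rsqr; lra.
Qed.
Lemma polar_right (u v : R) : u ^ 2 + v ^ 2 = 1 -> 0 < u ->
  exists f, - (PI / 2) <= f <= PI / 2 /\ u = cos f /\ v = sin f.
Proof.
  intros H P. assert (B : -1 <= v <= 1) by nra.
  exists (asin v). split. apply asin_bound. rewrite cos_asin, sin_asin by auto. split; auto.
  replace (1 - v²) with (u²) by (unfold Rsqr; lra). rewrite sqrt_Rsqr; lra.
Qed.
Lemma cos_between x y t : - (PI / 2) <= x -> y <= PI / 2 -> x <= t <= y -> Rmin (cos x) (cos y) <= cos t.
Proof.
  intros A B [T1 T2]. generalize PI_RGT_0; intro P. destruct (Rle_dec 0 t).
  - apply Rle_trans with (cos y). apply Rmin_r. apply cos_decr_1; lra.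
  - apply Rle_trans with (cos x). apply Rmin_l. rewrite <- (cos_neg x), <- (cos_neg t). apply cos_decr_1; lra.
Qed.

(** The part of the circle inside the disc is given by a lower bound on the cosine of the angle to
    the direction of y, and d <= r makes that bound positive. So it is a single arc shorter than a
    half circle. *)
Lemma arc_in_disc (r d : R) (w y : C) (z z' : C) : 0 < d <= r -> Cmod z = 1 -> Cmod z' = 1 ->
  Cmod (w - RtoC r * z - y) < d -> Cmod (w - RtoC r * z' - y) < d ->
  exists f f', z = (- cis f)%C /\ z' = (- cis f')%C /\
   forall t, Rmin f f' <= t <= Rmax f f' -> Cmod (w + RtoC r * cis t - y) < d.
Proof.
  intros [d0 dr] Hz Hz' Hd Hd'.
  set (u := (y - w)%C). set (rho := Cmod u).
  assert (rho0 : 0 <= rho) by apply Cmod_ge_0.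
  assert (key : forall e : C, Cmod e = 1 -> Cmod (w + RtoC r * e - y) ^ 2 = r ^ 2 + rho ^ 2 - 2 * r * (fst u * fst e + snd u * snd e)).
  { intros e He. assert (E := Cmod_sq e). rewrite He in E. unfold rho. rewrite !Cmod_sq. unfold u.
    destruct e as [e1 e2], w as [w1 w2], y as [y1 y2]. simpl in *.
    transitivity (r ^ 2 * (e1 * (e1 * 1) + e2 * (e2 * 1)) + (y1 - w1) ^ 2 + (y2 - w2) ^ 2 - 2 * r * ((y1 - w1) * e1 + (y2 - w2) * e2)).
    ring. rewrite <- E. ring. }
  assert (sq : forall e : C, Cmod e = 1 -> (Cmod (w + RtoC r * e - y) < d <-> r ^ 2 + rho ^ 2 - d ^ 2 < 2 * r * (fst u * fst e + snd u * snd e))).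
  { intros e He. specialize (key e He). assert (G := Cmod_ge_0 (w + RtoC r * e - y)%C). split; intro H; nra. }
  set (e := (- z)%C). set (e' := (- z')%C).
  assert (He : Cmod e = 1) by (unfold e; rewrite Cmod_opp; auto).
  assert (He' : Cmod e' = 1) by (unfold e'; rewrite Cmod_opp; auto).
  assert (De : r ^ 2 + rho ^ 2 - d ^ 2 < 2 * r * (fst u * fst e + snd u * snd e)).
  { apply sq; auto. replace (w + RtoC r * e)%C with (w - RtoC r * z)%C by (unfold e; ring). auto. }
  assert (De' : r ^ 2 + rho ^ 2 - d ^ 2 < 2 * r * (fst u * fst e' + snd u * snd e')).
  { apply sq; auto. replace (w + RtoC r * e')%C with (w - RtoC r * z')%C by (unfold e'; ring). auto. }
  assert (U2 : rho ^ 2 = fst u ^ 2 + snd u ^ 2) by apply Cmod_sq.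
  assert (rhop : 0 < rho).
  { destruct (Req_dec rho 0) as [Z|Z]; [|lra]. exfalso. rewrite Z in U2.
    assert (fst u = 0) by nra. assert (snd u = 0) by nra. rewrite H, H0, Z in De. nra. }
  destruct (polar (fst u / rho) (snd u / rho)) as [f0 [F1 F2]].
  { transitivity ((fst u ^ 2 + snd u ^ 2) / rho ^ 2). field; lra. rewrite <- U2. field; lra. }
  assert (u1 : fst u = rho * cos f0) by (rewrite <- F1; field; lra).
  assert (u2 : snd u = rho * sin f0) by (rewrite <- F2; field; lra).
  assert (rot : forall e : C, Cmod e = 1 -> r ^ 2 + rho ^ 2 - d ^ 2 < 2 * r * (fst u * fst e + snd u * snd e) ->
     exists p, - (PI / 2) <= p <= PI / 2 /\ e = cis (f0 + p)).
  { intros q Hq Dq. assert (Eq := Cmod_sq q). rewrite Hq in Eq.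
    destruct (polar_right (cos f0 * fst q + sin f0 * snd q) (cos f0 * snd q - sin f0 * fst q)) as [p [Hp [P1 P2]]].
    - assert (T := sin2_cos2 f0). unfold Rsqr in T.
      transitivity ((sin f0 * sin f0 + cos f0 * cos f0) * (fst q ^ 2 + snd q ^ 2)). ring. rewrite T. lra.
    - rewrite u1, u2 in Dq. assert (0 < 2 * r * rho * (cos f0 * fst q + sin f0 * snd q)) by nra.
      apply Rmult_lt_reg_l with (2 * r * rho). apply Rmult_lt_0_compat; lra. lra.
    - exists p. split; auto. unfold cis. rewrite cos_plus, sin_plus, <- P1, <- P2.
      assert (T := sin2_cos2 f0). unfold Rsqr in T.
      apply injective_projections; simpl.
      transitivity ((sin f0 * sin f0 + cos f0 * cos f0) * fst q). rewrite T; ring. ring.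
      transitivity ((sin f0 * sin f0 + cos f0 * cos f0) * snd q). rewrite T; ring. ring. }
  destruct (rot e He De) as [p [Hp Ep]]. destruct (rot e' He' De') as [p' [Hp' Ep']].
  exists (f0 + p), (f0 + p'). split. rewrite <- Ep. unfold e. ring. split. rewrite <- Ep'. unfold e'. ring.
  intros t Ht. apply sq. apply Cmod_cis.
  assert (dotE : forall q, fst u * fst (cis (f0 + q)) + snd u * snd (cis (f0 + q)) = rho * cos q).
  { intro q. rewrite u1, u2. unfold cis. simpl. replace q with ((f0 + q) - f0) at 3 by ring. rewrite cos_minus. ring. }
  rewrite Ep, dotE in De. rewrite Ep', dotE in De'.
  replace t with (f0 + (t - f0)) by ring. rewrite dotE.
  assert (B : Rmin (cos p) (cos p') <= cos (t - f0)).
  { destruct (Rle_dec p p').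
    - apply cos_between; try lra. rewrite Rmin_left, Rmax_right in Ht by lra. lra.
    - rewrite Rmin_comm. apply cos_between; try lra. rewrite Rmin_right, Rmax_left in Ht by lra. lra. }
  assert (M : r ^ 2 + rho ^ 2 - d ^ 2 < 2 * r * (rho * Rmin (cos p) (cos p'))).
  { unfold Rmin; destruct Rle_dec; auto. }
  eapply Rlt_le_trans. apply M. apply Rmult_le_compat_l. lra. apply Rmult_le_compat_l; lra.
Qed.

(** The supremum of the parameters up to which [Good] holds on the segment is attained because
    [Good] is closed in [O], and equals 1 because [Good] is open. *)
Lemma segment_induction (O : pt -> Prop) (Good : pt -> Prop) (y0 : pt) : convex2 O -> O y0 -> Good y0 ->
  (forall y, Good y -> exists e, 0 < e /\ forall x, Cmod (x - y) < e -> Good x) ->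
  (forall y, O y -> exists d, 0 < d /\ forall x, O x -> Cmod (x - y) < d -> Good x -> Good y) ->
  forall x, O x -> Good x.
Proof.
  intros CV O0 G0 Hop Hcl x Ox.
  set (g := fun t : R => padd y0 (pscal t (padd x (pscal (-1) y0)))).
  assert (gO : forall t, 0 <= t <= 1 -> O (g t)) by (intros; apply CV; auto).
  assert (g0 : g 0 = y0). { unfold g, padd, pscal; destruct y0; simpl; f_equal; ring. }
  assert (g1 : g 1 = x). { unfold g, padd, pscal; destruct y0, x; simpl; f_equal; ring. }
  set (L := Cmod (x - y0)). assert (L0 : 0 <= L) by apply Cmod_ge_0.
  assert (gd : forall t t', Cmod (g t - g t') = Rabs (t - t') * L).
  { intros t t'. unfold L. rewrite <- Cmod_R, <- Cmod_mult. f_equal. unfold g, padd, pscal.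
    destruct y0, x; apply injective_projections; simpl; ring. }
  assert (near : forall e t t', 0 < e -> Rabs (t - t') < e / (L + 1) -> Cmod (g t - g t') < e).
  { intros e t t' He H. rewrite gd. apply Rmult_lt_compat_r with (r := L + 1) in H; [|lra].
    replace (e / (L + 1) * (L + 1)) with e in H by (field; lra). generalize (Rabs_pos (t - t')). nra. }
  set (E := fun t => 0 <= t <= 1 /\ forall s, 0 <= s <= t -> Good (g s)).
  assert (E0 : E 0). { split. lra. intros s Hs. replace s with 0 by lra. rewrite g0; auto. }
  destruct (completeness E) as [m [Hub Hlub]].
  { exists 1. intros t [Ht _]; lra. }
  { exists 0; auto. }
  assert (m0 : 0 <= m) by (apply Hub; auto).
  assert (m1 : m <= 1) by (apply Hlub; intros t [Ht _]; lra).
  assert (below : forall s, 0 <= s < m -> Good (g s)).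
  { intros s Hs. apply NNPP. intro N. assert (m <= s).
    { apply Hlub. intros t [Ht Gt]. apply Rnot_lt_le. intro. apply N. apply Gt. lra. } lra. }
  assert (Gm : Good (g m)).
  { destruct (Hcl (g m) (gO m (conj m0 m1))) as [d [d0 Hd]].
    destruct (Req_dec m 0) as [->|Nz]. rewrite g0; auto.
    assert (q : 0 < d / (L + 1)) by (apply Rdiv_lt_0_compat; lra).
    set (s := Rmax 0 (m - d / (L + 1) / 2)).
    assert (s0 : 0 <= s) by apply Rmax_l.
    assert (s1 : m - d / (L + 1) / 2 <= s) by apply Rmax_r.
    assert (s2 : s < m) by (unfold s; apply Rmax_lub_lt; lra).
    apply (Hd (g s)). apply gO; lra. apply near; auto. rewrite Rabs_left1; lra. apply below; lra. }
  destruct (Hop (g m) Gm) as [e [e0 He]].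
  assert (q : 0 < e / (L + 1)) by (apply Rdiv_lt_0_compat; lra).
  assert (up : forall s, 0 <= s <= m + e / (L + 1) / 2 -> Good (g s)).
  { intros s Hs. destruct (Rlt_dec s m). apply below; lra. apply He. apply near; auto. rewrite Rabs_pos_eq; lra. }
  assert (m = 1).
  { apply Rle_antisym; auto. apply Rnot_lt_le. intro Lt.
    assert (E (Rmin 1 (m + e / (L + 1) / 2))).
    { split. split. apply Rmin_glb; lra. apply Rmin_l. intros s Hs. apply up. split. lra.
      apply Rle_trans with (1 := proj2 Hs). apply Rmin_r. }
    apply Hub in H. assert (m < Rmin 1 (m + e / (L + 1) / 2)) by (apply Rmin_glb_lt; lra). lra. }
  rewrite <- g1. apply up. lra.
Qed.

(** In a small disc two positions on one Larmor circle are joined by an arc inside the disc, so the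
    integral is consistent as a function of the centre x + ep r J v. A polynomial found near one
    point is then carried over [O] by [spread]. *)
Theorem larmor_polynomial (ep r : R) (O : pt -> Prop) (N : nat) (a : nat -> nat -> pt -> R) :
  0 < r -> ep = 1 \/ ep = -1 -> is_open2 O -> convex2 O -> (exists x, O x) ->
  (forall (c : pt) f f', f <= f' ->
     (forall t, f <= t <= f' -> O (fst c + r * cos t, snd c + r * sin t)) ->
     polyPhi a N (fst c + r * cos f, snd c + r * sin f) (- ep * sin f, ep * cos f) =
     polyPhi a N (fst c + r * cos f', snd c + r * sin f') (- ep * sin f', ep * cos f')) ->
  exists F : pexpr R, forall x v, O x -> unit_vec v ->
    polyPhi a N x v = evR F (fst x - ep * r * snd v) (snd x + ep * r * fst v).
Proof.
  intros r0 Hep Op CV [y0 Oy0] HC.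
  set (p := ptrig ep N a).
  assert (PP : forall x, Pol (2 * N) (p x)) by (intro; apply ptrig_Pol).
  assert (ball : forall y, O y -> exists d, 0 < d <= r /\ (forall x, Cmod (x - y) < d -> O x) /\ consistent r N y d nil p).
  { intros y Oy. destruct (Op y Oy) as [e [e0 He]].
    set (d := Rmin e r). assert (D : 0 < d <= r) by (split; [apply Rmin_pos; auto|apply Rmin_r]).
    assert (DO : forall x, Cmod (x - y) < d -> O x).
    { intros x Hx. apply He. assert (Hx' := Rlt_le_trans _ _ _ Hx (Rmin_l e r)). rewrite Cmod_sym in Hx'. exact Hx'. }
    exists d. split; auto. split; auto.
    intros x x' z z' Hx Hx' Hz Hz' WE _.
    set (w := (x + RtoC r * z)%C) in *.
    assert (Xe : x = (w - RtoC r * z)%C) by (unfold w; ring).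
    assert (Xe' : x' = (w - RtoC r * z')%C) by (rewrite WE; ring).
    rewrite Xe in Hx. rewrite Xe' in Hx'.
    destruct (arc_in_disc r d w y z z' D Hz Hz' Hx Hx') as [f [f' [Ef [Ef' Arc]]]].
    unfold p. rewrite !ptrig_unit by auto.
    assert (EQ : polyPhi a N x (ep * Im z, - ep * Re z) = polyPhi a N x' (ep * Im z', - ep * Re z')).
    { assert (P : forall t, (w + RtoC r * cis t)%C = (fst w + r * cos t, snd w + r * sin t)).
      { intro t. apply injective_projections; simpl; ring. }
      assert (Q : forall t, (ep * Im (- cis t), - ep * Re (- cis t)) = (- ep * sin t, ep * cos t)).
      { intro t. unfold Im, Re. simpl. f_equal; ring. }
      rewrite Xe, Xe', Ef, Ef', !Q.
      replace (w - RtoC r * - cis f)%C with (w + RtoC r * cis f)%C by ring.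
      replace (w - RtoC r * - cis f')%C with (w + RtoC r * cis f')%C by ring.
      rewrite !P. destruct (Rle_dec f f').
      - rewrite Rmin_left, Rmax_right in Arc by lra. apply HC; auto.
        intros t Ht. rewrite <- P. apply DO. auto.
      - rewrite Rmin_right, Rmax_left in Arc by lra. symmetry. apply HC. lra.
        intros t Ht. rewrite <- P. apply DO. auto. }
    rewrite EQ. ring. }
  destruct (ball y0 Oy0) as [d [D [DO Cons]]].
  destruct (local_polynomial r r0 N y0 d nil p D (fun x _ => PP x) Cons) as [G [b [d' [WG [d'0 [Sub Fit]]]]]].
  set (Good := fun y : pt => exists e, 0 < e /\ forall x z : C, Cmod (x - y) < e -> Cmod z = 1 ->
     p x z = (z ^ N * G (x + RtoC r * z)%C)%C).
  assert (Ob : O b). { apply DO, Sub. rewrite Cmod_minus_self; auto. }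
  assert (All : forall x, O x -> Good x).
  { apply (segment_induction O Good b); auto.
    - exists d'. split; auto.
    - intros y [e [e0 He]]. exists (e / 2). split. lra. intros x Hx. exists (e / 2). split. lra.
      intros x' z Hx' Hz. apply He; auto. eapply Rle_lt_trans. apply Cmod_tri3 with (b := x). lra.
    - intros y Oy. destruct (ball y Oy) as [dy [Dy [DyO Cy]]]. exists dy. split. tauto.
      intros x Ox Hx [e [e0 He]]. exists dy. split. tauto.
      intros x' z Hx' Hz. apply (spread r r0 N y dy p G x e); auto. }
  (* The integral is real, so it equals the real part F of G. *)
  destruct (wpoly_real G WG) as [F [F' HF]]. exists F. intros x v Ox Hv.
  destruct (All x Ox) as [e [e0 He]].
  set (z := (- ep * snd v, ep * fst v) : C).
  assert (ep2 : ep * ep = 1) by (destruct Hep; subst; ring).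
  assert (Hz : Cmod z = 1).
  { apply Cmod_unit_iff. simpl. unfold unit_vec in Hv.
    transitivity (ep * ep * (fst v ^ 2 + snd v ^ 2)). ring. rewrite ep2, Hv. ring. }
  specialize (He x z). rewrite Cmod_minus_self in He. specialize (He e0 Hz).
  unfold p in He. rewrite ptrig_unit in He by auto.
  apply Cmult_reg_l in He. 2: apply Cpow_nz, unit_nz; auto.
  assert (VE : (ep * Im z, - ep * Re z) = v).
  { unfold z, Im, Re; simpl. destruct v as [v1 v2]; simpl. f_equal.
    transitivity (ep * ep * v1). ring. rewrite ep2; ring.
    transitivity (ep * ep * v2). ring. rewrite ep2; ring. }
  rewrite VE, HF in He. apply (f_equal fst) in He. simpl fst at 1 in He. rewrite He.
  unfold z. simpl. f_equal; ring.
Qed.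

(** * The relation along a parallel curve *)

Lemma frenet_algebra (a b u v : R) : u ^ 2 + v ^ 2 = 1 -> u * a + v * b = 0 ->
  a = - (u * b - v * a) * v /\ b = (u * b - v * a) * u.
Proof.
  intros H K. split.
  - transitivity ((u ^ 2 + v ^ 2) * a). rewrite H; ring.
    transitivity (u * (u * a + v * b) - (u * b - v * a) * v). ring. rewrite K. ring.
  - transitivity ((u ^ 2 + v ^ 2) * b). rewrite H; ring.
    transitivity (v * (u * a + v * b) + (u * b - v * a) * u). ring. rewrite K. ring.
Qed.
(** Differentiating the unit speed condition shows that the second derivative is orthogonal to the
    tangent, hence the curvature times the normal. *)
Lemma frame_of_curve (g : R -> pt) (L : R) : smooth_simple_closed_arclength g L ->
  frame (fun s => fst (g s)) (fun s => snd (g s)) (fun s => fst (d1 g s)) (fun s => snd (d1 g s)) (curvature g).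
Proof.
  intros [_ [S1 [S2 [_ [_ U]]]]].
  set (z1 := fun s => fst (g s)) in *. set (z2 := fun s => snd (g s)) in *.
  assert (D1 : forall s, is_derive (Derive z1) s (Derive_n z1 2 s)) by (intro; apply Derive_correct, (S1 1%nat)).
  assert (D2 : forall s, is_derive (Derive z2) s (Derive_n z2 2 s)) by (intro; apply Derive_correct, (S2 1%nat)).
  assert (Un : forall s, Derive z1 s ^ 2 + Derive z2 s ^ 2 = 1) by (intro; apply U).
  assert (Orth : forall s, Derive z1 s * Derive_n z1 2 s + Derive z2 s * Derive_n z2 2 s = 0).
  { intro s.
    assert (E : 2 * (Derive z1 s * Derive_n z1 2 s + Derive z2 s * Derive_n z2 2 s) = 0).
    { apply (is_derive_ext_unique (fun s => Derive z1 s * Derive z1 s + Derive z2 s * Derive z2 s) (fun _ => 1) s).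
      - intro t. generalize (Un t). lra.
      - eapply is_derive_eq. apply is_derive_Rplus; apply is_derive_Rmult; auto. rring.
      - apply is_derive_Rconst. }
    lra. }
  split.
  - exact S1.
  - exact S2.
  - intro s. apply Derive_correct. apply smooth_ex; auto.
  - intro s. apply Derive_correct. apply smooth_ex; auto.
  - intro s. eapply is_derive_eq. apply D1. apply (proj1 (frenet_algebra _ _ _ _ (Un s) (Orth s))).
  - intro s. eapply is_derive_eq. apply D2. apply (proj2 (frenet_algebra _ _ _ _ (Un s) (Orth s))).
  - exact Un.
  - intro s.
    assert (E1 : ex_derive (Derive_n z1 2) s) by apply (S1 2%nat).
    assert (E2 : ex_derive (Derive_n z2 2) s) by apply (S2 2%nat).
    destruct E1 as [l1 E1]. destruct E2 as [l2 E2].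
    assert (X := is_derive_Rminus _ _ _ _ _ (is_derive_Rmult _ _ _ _ _ (D1 s) E2) (is_derive_Rmult _ _ _ _ _ (D2 s) E1)).
    exact (ex_intro _ _ X).
Qed.

(** * Continuity up to the boundary *)

Definition rcont (O : pt -> Prop) (h : pt -> R) (x : pt) : Prop :=
  forall e, 0 < e -> exists d, 0 < d /\ forall y, in_closure2 O y -> dist2 x y < d -> Rabs (h y - h x) < e.
Lemma rcont_const O c x : rcont O (fun _ => c) x.
Proof. intros e He. exists 1. split. lra. intros. rewrite Rminus_diag, Rabs_R0. auto. Qed.
Lemma rcont_plus O h k x : rcont O h x -> rcont O k x -> rcont O (fun y => h y + k y) x.
Proof.
  intros H K e He. destruct (H (e/2)) as [d1 [P1 Q1]]. lra. destruct (K (e/2)) as [d2 [P2 Q2]]. lra.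
  exists (Rmin d1 d2). split. apply Rmin_pos; auto. intros y Oy Hy.
  specialize (Q1 y Oy (Rlt_le_trans _ _ _ Hy (Rmin_l _ _))).
  specialize (Q2 y Oy (Rlt_le_trans _ _ _ Hy (Rmin_r _ _))).
  replace (h y + k y - (h x + k x)) with ((h y - h x) + (k y - k x)) by ring.
  eapply Rle_lt_trans. apply Rabs_triang. lra.
Qed.
Lemma rcont_mult O h k x : rcont O h x -> rcont O k x -> rcont O (fun y => h y * k y) x.
Proof.
  intros H K e He.
  set (A := Rabs (h x) + Rabs (k x) + 2).
  assert (A2 : 2 <= A) by (unfold A; generalize (Rabs_pos (h x)) (Rabs_pos (k x)); lra).
  set (e1 := Rmin 1 (e / (2 * A))).
  assert (E0 : 0 < e1). { apply Rmin_pos. lra. apply Rdiv_lt_0_compat; lra. }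
  assert (E1 : e1 <= 1) by apply Rmin_l.
  assert (E2 : e1 * (2 * A) <= e).
  { apply Rle_trans with (e / (2*A) * (2*A)). apply Rmult_le_compat_r. lra. apply Rmin_r. right. field. lra. }
  destruct (H e1 E0) as [d1 [P1 Q1]]. destruct (K e1 E0) as [d2 [P2 Q2]].
  exists (Rmin d1 d2). split. apply Rmin_pos; auto. intros y Oy Hy.
  specialize (Q1 y Oy (Rlt_le_trans _ _ _ Hy (Rmin_l _ _))).
  specialize (Q2 y Oy (Rlt_le_trans _ _ _ Hy (Rmin_r _ _))).
  replace (h y * k y - h x * k x) with ((h y - h x) * (k x + (k y - k x)) + h x * (k y - k x)) by ring.
  eapply Rle_lt_trans. apply Rabs_triang. rewrite !Rabs_mult.
  assert (B : Rabs (k x + (k y - k x)) <= Rabs (k x) + 1).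
  { eapply Rle_trans. apply Rabs_triang. lra. }
  assert (T1 : Rabs (h y - h x) * Rabs (k x + (k y - k x)) <= e1 * (Rabs (k x) + 1)).
  { apply Rmult_le_compat; auto using Rabs_pos. lra. }
  assert (T2 : Rabs (h x) * Rabs (k y - k x) <= Rabs (h x) * e1).
  { apply Rmult_le_compat_l. apply Rabs_pos. lra. }
  assert (e1 * (Rabs (k x) + Rabs (h x) + 1) < e1 * (2 * A)).
  { apply Rmult_lt_compat_l; auto. unfold A. generalize (Rabs_pos (h x)) (Rabs_pos (k x)); lra. }
  lra.
Qed.
Lemma rcont_fst O x : rcont O (fun y => fst y) x.
Proof.
  intros e He. exists e. split; auto. intros y _ Hy. eapply Rle_lt_trans; [|apply Hy].
  rewrite Rabs_minus_sym. apply (Rabs_Re_le (x - y)%C).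
Qed.
Lemma rcont_snd O x : rcont O (fun y => snd y) x.
Proof.
  intros e He. exists e. split; auto. intros y _ Hy. eapply Rle_lt_trans; [|apply Hy].
  rewrite Rabs_minus_sym. apply (Rabs_Im_le (x - y)%C).
Qed.
Lemma rcont_sum O (h : nat -> pt -> R) n x : (forall k, (k <= n)%nat -> rcont O (h k) x) ->
  rcont O (fun y => sum_f_R0 (fun k => h k y) n) x.
Proof. intros H. induction n; simpl. apply H; auto. apply rcont_plus; auto. Qed.
Lemma rcont_evR O F (u v : pt -> R) x : rcont O u x -> rcont O v x -> rcont O (fun y => evR F (u y) (v y)) x.
Proof. intros U V; induction F; simpl; auto using rcont_const, rcont_plus, rcont_mult. Qed.
Lemma rcont_polyPhi O a N v x : coeffs_continuous_up_to_boundary O a N -> in_closure2 O x ->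
  rcont O (fun y => polyPhi a N y v) x.
Proof.
  intros H Hx. unfold polyPhi. apply (rcont_sum O (fun k y => sum_f_R0 (fun l => a k l y * fst v ^ k * snd v ^ l) (N - k))).
  intros k Hk. apply (rcont_sum O (fun l y => a k l y * fst v ^ k * snd v ^ l)). intros l Hl.
  apply rcont_mult. apply rcont_mult. 2,3: apply rcont_const.
  intros e He. destruct (H k l ltac:(lia) x Hx e He) as [d D]. exists d. auto.
Qed.

(** The reflection law lives on the boundary, while the formula in the Larmor centre is found
    inside; for fixed v continuity of the coefficients carries it over. *)
Lemma closure_extension (O : pt -> Prop) a N F ep r : coeffs_continuous_up_to_boundary O a N ->
  (forall x v, O x -> unit_vec v -> polyPhi a N x v = evR F (fst x - ep * r * snd v) (snd x + ep * r * fst v)) ->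
  forall x v, in_closure2 O x -> unit_vec v -> polyPhi a N x v = evR F (fst x - ep * r * snd v) (snd x + ep * r * fst v).
Proof.
  intros HC H x v Hx Hv.
  set (D := fun y : pt => polyPhi a N y v + -1 * evR F (fst y + - (ep * r * snd v)) (snd y + ep * r * fst v)).
  assert (CD : rcont O D x).
  { apply rcont_plus. apply rcont_polyPhi; auto. apply rcont_mult. apply rcont_const.
    apply rcont_evR; apply rcont_plus; auto using rcont_const, rcont_fst, rcont_snd. }
  assert (Z : D x = 0).
  { apply NNPP. intro N0. apply Rabs_pos_lt in N0. destruct (CD _ N0) as [d [d0 Hd]].
    destruct (Hx d d0) as [y [Oy Dy]].
    assert (D y = 0). { unfold D. rewrite H by auto. unfold Rminus. ring. }
    specialize (Hd y). rewrite H0 in Hd.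
    assert (in_closure2 O y). { intros e He. exists y. split; auto. unfold dist2. rewrite !Rminus_diag.
      replace (0 ^ 2 + 0 ^ 2) with 0 by ring. rewrite sqrt_0. auto. }
    specialize (Hd H1 Dy). replace (0 - D x) with (- D x) in Hd by ring. rewrite Rabs_Ropp in Hd. lra. }
  unfold D in Z. unfold Rminus. lra.
Qed.

(** * The two integrals of the billiard and the reflection law *)

Section Integral.
Variables (O : pt -> Prop) (g : R -> pt) (L beta : R) (N : nat) (a1 a2 : nat -> nat -> pt -> R).
Hypothesis Hsm : smooth_simple_closed_arclength g L.
Hypothesis Hdom : convex_domain_bounded_by O g.
Hypothesis Hb : 0 < beta.
Hypothesis Hk : forall s, beta < curvature g s.
Hypothesis Hpi : polynomial_integral beta g O N a1 a2.
Hypothesis Hnc : nonconstant_pair O N a1 a2.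
Let r := / beta.
Let z1 s := fst (g s).
Let z2 s := snd (g s).
Let t1 s := fst (d1 g s).
Let t2 s := snd (d1 g s).
Lemma Int_r0 : 0 < r. Proof. apply Rinv_0_lt_compat; auto. Qed.
Lemma Int_frame : frame z1 z2 t1 t2 (curvature g).
Proof. apply (frame_of_curve g L Hsm). Qed.
Lemma Int_kbig s : 1 < r * curvature g s.
Proof.
  unfold r. apply Rmult_lt_reg_l with beta; auto. rewrite <- Rmult_assoc, Rinv_r by lra.
  specialize (Hk s). lra.
Qed.

Lemma integrals_exist : exists F1 F2 : pexpr R,
  (forall x v, in_closure2 O x -> unit_vec v -> polyPhi a1 N x v = evR F1 (fst x - 1 * r * snd v) (snd x + 1 * r * fst v)) /\
  (forall x v, in_closure2 O x -> unit_vec v -> polyPhi a2 N x v = evR F2 (fst x - -1 * r * snd v) (snd x + -1 * r * fst v)).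
Proof.
  destruct Hdom as [Op [_ [CV [NE _]]]]. destruct Hpi as [C1 [C2 [P1 [P2 _]]]].
  assert (r0 := Int_r0).
  destruct (larmor_polynomial 1 r O N a1 r0 (or_introl eq_refl) Op CV NE) as [F1 H1].
  { intros c f f' Hf HO.
    assert (A : forall t, larmor_pos_x beta c f t = (fst c + r * cos (beta * t + f), snd c + r * sin (beta * t + f))) by reflexivity.
    specialize (P1 c f 0 ((f' - f) / beta)).
    rewrite !A in P1. unfold larmor_pos_v in P1.
    replace (beta * 0 + f) with f in P1 by ring. replace (beta * ((f' - f) / beta) + f) with f' in P1 by (field; lra).
    replace (- (1) * sin f) with (- sin f) by ring. replace (- (1) * sin f') with (- sin f') by ring.
    rewrite !Rmult_1_l. apply P1.
    apply Rmult_le_pos. lra. left; apply Rinv_0_lt_compat; auto.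
    intros t [T1 T2]. rewrite A. apply HO. split. nra.
    apply Rmult_le_compat_l with (r := beta) in T2; [|lra].
    replace (beta * ((f' - f) / beta)) with (f' - f) in T2 by (field; lra). lra. }
  destruct (larmor_polynomial (-1) r O N a2 r0 (or_intror eq_refl) Op CV NE) as [F2 H2].
  { intros c f f' Hf HO.
    (* Negative circles are run clockwise, so the motion starts at the larger angle [f']. *)
    assert (A : forall t, larmor_neg_x beta c f' t = (fst c + r * cos (- beta * t + f'), snd c + r * sin (- beta * t + f'))) by reflexivity.
    specialize (P2 c f' 0 ((f' - f) / beta)).
    rewrite !A in P2. unfold larmor_neg_v in P2.
    replace (- beta * 0 + f') with f' in P2 by ring. replace (- beta * ((f' - f) / beta) + f') with f in P2 by (field; lra).
    replace (- -1 * sin f) with (sin f) by ring. replace (- -1 * sin f') with (sin f') by ring.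
    replace (-1 * cos f) with (- cos f) by ring. replace (-1 * cos f') with (- cos f') by ring.
    symmetry. apply P2.
    apply Rmult_le_pos. lra. left; apply Rinv_0_lt_compat; auto.
    intros t [T1 T2]. rewrite A. apply HO.
    apply Rmult_le_compat_l with (r := beta) in T2; [|lra].
    replace (beta * ((f' - f) / beta)) with (f' - f) in T2 by (field; lra). split. nra. nra. }
  exists F1, F2. split; apply closure_extension; auto.
Qed.

Lemma curve_in_closure s : in_closure2 O (g s).
Proof.
  destruct Hdom as [_ [_ [_ [_ [B _]]]]]. apply (B (g s)). exists s; auto.
Qed.

Lemma CT0_identity F1 F2 :
  (forall x v, in_closure2 O x -> unit_vec v -> polyPhi a1 N x v = evR F1 (fst x - 1 * r * snd v) (snd x + 1 * r * fst v)) ->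
  (forall x v, in_closure2 O x -> unit_vec v -> polyPhi a2 N x v = evR F2 (fst x - -1 * r * snd v) (snd x + -1 * r * fst v)) ->
  sx_eq (CT z1 z2 t1 t2 r 1 0 F1) (CT z1 z2 t1 t2 r (-1) 0 F2).
Proof.
  intros H1 H2 s al. simpl. rewrite !sev_ssub, !sev_cx, !sev_cy.
  destruct Hpi as [_ [_ [_ [_ HB]]]].
  (* This velocity makes the angle [al] with the tangent, and its reflection the angle - [al]; their
     Larmor centres are the two circle points. *)
  set (v := (cos al * t1 s - sin al * t2 s, cos al * t2 s + sin al * t1 s)).
  assert (U := fr_u _ _ _ _ _ Int_frame s).
  assert (T := sin2_cos2 al). unfold Rsqr in T.
  assert (Uv : unit_vec v).
  { unfold unit_vec, v. simpl fst; simpl snd.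
    transitivity ((sin al * sin al + cos al * cos al) * (t1 s ^ 2 + t2 s ^ 2)). ring. rewrite T, U. ring. }
  specialize (HB s v Uv).
  assert (Rv : reflect_vec (Jrot (d1 g s)) v = (cos al * t1 s + sin al * t2 s, cos al * t2 s - sin al * t1 s)).
  { unfold reflect_vec, padd, pscal, dot, Jrot. fold (t1 s) (t2 s).
    assert (Dt : - t2 s * fst v + t1 s * snd v = sin al).
    { unfold v; simpl. transitivity (sin al * (t1 s ^ 2 + t2 s ^ 2)). ring. rewrite U. ring. }
    unfold fst at 1 3 5. unfold snd at 1 3 5. unfold t1, t2 in *. simpl in *. rewrite Dt. f_equal; ring. }
  rewrite Rv in HB.
  assert (Uv' : unit_vec (cos al * t1 s + sin al * t2 s, cos al * t2 s - sin al * t1 s)).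
  { unfold unit_vec. simpl fst; simpl snd.
    transitivity ((sin al * sin al + cos al * cos al) * (t1 s ^ 2 + t2 s ^ 2)). ring. rewrite T, U. ring. }
  rewrite H1, H2 in HB by (auto using curve_in_closure). unfold v in HB. simpl fst in HB; simpl snd in HB.
  fold (z1 s) (z2 s) in HB.
  transitivity (evR F1 (z1 s - 1 * r * (cos al * t2 s + sin al * t1 s)) (z2 s + 1 * r * (cos al * t1 s - sin al * t2 s))).
  f_equal; ring. rewrite HB. f_equal; ring.
Qed.

(** [F'] takes the value c on its whole family of circles, so F' - c is flat in the angle and zero
    by [jets_zero]. Hence each member of a nonconstant pair is nonconstant. *)
Lemma const_transfer e F F' c : e = 1 \/ e = -1 ->
  sx_eq (CT z1 z2 t1 t2 r e 0 F) (CT z1 z2 t1 t2 r (- e) 0 F') ->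
  (forall x y, evR F x y = c) -> forall x y, evR F' x y = c.
Proof.
  intros He E HF x y.
  assert (X : evR (PA F' (PC (- c))) x y = 0).
  2:{ simpl in X. lra. }
  revert x y.
  assert (e2 : - e * - e = 1) by (destruct He; subst; ring).
  apply (jets_zero z1 z2 t1 t2 (curvature g) r (- e) Int_frame e2 Int_r0).
  { apply lam_nz. apply Int_kbig. destruct He; lra. }
  intros m i _ s. transitivity (jet i (SM (SF (fun _ => 0)) SC) s).
  2: rewrite jet_SF; ring.
  apply jet_ext. intros u al. specialize (E u al). simpl in *. rewrite !sev_ssub in *. rewrite <- E, HF. ring.
Qed.

(** [curve_relation] concerns the polynomial on the side ep, so for ep = -1 the two integrals
    exchange roles. *)
Lemma parallel_relation ep : ep = 1 \/ ep = -1 -> exists (G : pexpr R) (k : nat) (C : R),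
  (1 <= k)%nat /\ C <> 0 /\ (exists x y, evR G x y <> 0) /\
  vanish_to_order z1 z2 t1 t2 r ep k G /\
  forall s, normal_deriv z1 z2 t1 t2 r ep k G s ^ 3 * lam (curvature g) r (- ep) s ^ (2 * k)
      = C * (r * curvature g s) ^ (2 * k) * lam (curvature g) r ep s ^ k.
Proof.
  intros Hep. destruct integrals_exist as [F1 [F2 [H1 H2]]].
  assert (E := CT0_identity F1 F2 H1 H2).
  assert (E' : sx_eq (CT z1 z2 t1 t2 r (-1) 0 F2) (CT z1 z2 t1 t2 r (- -1) 0 F1)).
  { intros s al. replace (- -1) with 1 by ring. symmetry. apply E. }
  assert (E1 : sx_eq (CT z1 z2 t1 t2 r 1 0 F1) (CT z1 z2 t1 t2 r (- (1)) 0 F2)) by exact E.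
  assert (cl : forall x, O x -> in_closure2 O x).
  { intros y Oy e He. exists y. split; auto. unfold dist2. rewrite !Rminus_diag.
      replace (0 ^ 2 + 0 ^ 2) with 0 by ring. rewrite sqrt_0. auto. }
  assert (NC : forall c, (forall x y, evR F1 x y = c) -> (forall x y, evR F2 x y = c) -> False).
  { intros c A B. apply Hnc. exists c, c. intros x v Ox Uv. rewrite H1, H2 by auto. auto. }
  assert (Main : forall F F', sx_eq (CT z1 z2 t1 t2 r ep 0 F) (CT z1 z2 t1 t2 r (- ep) 0 F') ->
     ~ (exists c, forall x y, evR F x y = c) -> exists (G : pexpr R) (k : nat) (C : R),
  (1 <= k)%nat /\ C <> 0 /\ (exists x y, evR G x y <> 0) /\
  vanish_to_order z1 z2 t1 t2 r ep k G /\
  forall s, normal_deriv z1 z2 t1 t2 r ep k G s ^ 3 * lam (curvature g) r (- ep) s ^ (2 * k)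
      = C * (r * curvature g s) ^ (2 * k) * lam (curvature g) r ep s ^ k).
  { intros F F' EF NF.
    destruct (curve_relation z1 z2 t1 t2 (curvature g) r ep Int_frame ltac:(destruct Hep; subst; ring) Int_r0 Int_kbig F F' EF NF)
      as [c0 [k [C [K1 [C0 [V Rl]]]]]].
    exists (PA F (PC (- c0))), k, C. repeat split; auto.
    apply NNPP. intro Nx. apply NF. exists c0. intros x y. apply NNPP. intro N2. apply Nx. exists x, y. simpl. lra. }
  destruct Hep as [-> | ->].
  - apply (Main F1 F2 E1). intros [c Hc]. apply (NC c Hc). apply (const_transfer 1 F1 F2 c); auto.
  - apply (Main F2 F1 E'). intros [c Hc]. apply (NC c); auto. apply (const_transfer (-1) F2 F1 c); auto.
Qed.
End Integral.

(** * Transfer to the Zariski closure *)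

Lemma eval_poly2_cons m P z : eval_poly2 (m :: P) z =
  (eval_poly2 P z + snd m * (fst z ^ (fst (fst m)) * snd z ^ (snd (fst m))))%C.
Proof. reflexivity. Qed.
Lemma eval_poly2_app P P' z : eval_poly2 (P ++ P') z = (eval_poly2 P z + eval_poly2 P' z)%C.
Proof.
  induction P as [|m P IH]. simpl. ring. rewrite <- app_comm_cons, !eval_poly2_cons, IH. ring.
Qed.
Lemma eval_poly2_mono i j c P : exists P', forall z,
  eval_poly2 P' z = (eval_poly2 P z * (c * (fst z ^ i * snd z ^ j)))%C.
Proof.
  induction P as [|[[i' j'] c'] P [P' H]].
  - exists nil. intros; simpl; ring.
  - exists (((i' + i)%nat, (j' + j)%nat, (c' * c)%C) :: P'). intros. rewrite !eval_poly2_cons, H. simpl.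
    rewrite !Cpow_add_r. ring.
Qed.
Lemma eval_poly2_mult P P2 : exists P', forall z, eval_poly2 P' z = (eval_poly2 P z * eval_poly2 P2 z)%C.
Proof.
  induction P2 as [|[[i j] c] P2 [P' H]].
  - exists nil. intros; simpl; ring.
  - destruct (eval_poly2_mono i j c P) as [P'' H'']. exists (P'' ++ P'). intros.
    rewrite eval_poly2_app, eval_poly2_cons, H, H''. simpl. ring.
Qed.
Lemma poly2_of_pexpr (e : pexpr C) : exists P : poly2, forall z, eval_poly2 P z = evC e (fst z) (snd z).
Proof.
  induction e.
  - exists ((0%nat, 0%nat, c) :: nil). intros; rewrite eval_poly2_cons; simpl. ring.
  - exists ((1%nat, 0%nat, RtoC 1) :: nil). intros; rewrite eval_poly2_cons; simpl. ring.
  - exists ((0%nat, 1%nat, RtoC 1) :: nil). intros; rewrite eval_poly2_cons; simpl. ring.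
  - destruct IHe1 as [P H]. destruct IHe2 as [P' H']. exists (P ++ P'). intros. rewrite eval_poly2_app, H, H'. auto.
  - destruct IHe1 as [P H]. destruct IHe2 as [P' H']. destruct (eval_poly2_mult P P') as [P2 H2].
    exists P2. intros. rewrite H2, H, H'. auto.
Qed.

(** Stated for functions, so that composite formulas such as [hess] are recognised as polynomials
    without writing their syntax. *)
Definition is_pexpr (g : C -> C -> C) : Prop := exists e : pexpr C, forall x y, evC e x y = g x y.
Lemma is_pexpr_const c : is_pexpr (fun _ _ => c). Proof. exists (PC c); auto. Qed.
Lemma is_pexpr_x : is_pexpr (fun x _ => x). Proof. exists PX; auto. Qed.
Lemma is_pexpr_y : is_pexpr (fun _ y => y). Proof. exists PY; auto. Qed.
Lemma is_pexpr_add g h : is_pexpr g -> is_pexpr h -> is_pexpr (fun x y => (g x y + h x y)%C).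
Proof. intros [a A] [b B]. exists (PA a b). intros; simpl; rewrite A, B; auto. Qed.
Lemma is_pexpr_mul g h : is_pexpr g -> is_pexpr h -> is_pexpr (fun x y => (g x y * h x y)%C).
Proof. intros [a A] [b B]. exists (PM a b). intros; simpl; rewrite A, B; auto. Qed.
Lemma is_pexpr_opp g : is_pexpr g -> is_pexpr (fun x y => (- g x y)%C).
Proof. intros [a A]. exists (PM (PC (RtoC (-1))) a). intros; simpl; rewrite A. ring. Qed.
Lemma is_pexpr_minus g h : is_pexpr g -> is_pexpr h -> is_pexpr (fun x y => (g x y - h x y)%C).
Proof. intros A B. apply is_pexpr_add; auto. apply is_pexpr_opp; auto. Qed.
Lemma is_pexpr_pow g n : is_pexpr g -> is_pexpr (fun x y => (g x y ^ n)%C).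
Proof. intros A. induction n; simpl. apply (is_pexpr_const (RtoC 1)). apply is_pexpr_mul; auto. Qed.
Lemma is_pexpr_evC e g h : is_pexpr g -> is_pexpr h -> is_pexpr (fun x y => evC e (g x y) (h x y)).
Proof. intros [a A] [b B]. exists (psubst e a b). intros; rewrite pev_psubst, A, B; auto. Qed.
Lemma is_pexpr_self e : is_pexpr (fun x y => evC e x y).
Proof. exists e; auto. Qed.
Ltac prove_pexpr := repeat first [apply is_pexpr_self | apply is_pexpr_const | apply is_pexpr_x | apply is_pexpr_y
  | apply is_pexpr_minus | apply is_pexpr_add | apply is_pexpr_mul | apply is_pexpr_opp | apply is_pexpr_pow ].

(** * Formal derivatives under substitution and complexification *)

Lemma evC_ext_dy F G : (forall x y, evC F x y = evC G x y) -> forall x y, evC (dyC F) x y = evC (dyC G) x y.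
Proof.
  intros H x y.
  assert (A := hol_pexpr F (fun _ => x) (fun u => u) y (RtoC 0) (RtoC 1) (hol_const x y) (hol_id y)).
  assert (B := hol_pexpr G (fun _ => x) (fun u => u) y (RtoC 0) (RtoC 1) (hol_const x y) (hol_id y)).
  apply hol_ext with (k := fun w => evC G x w) in A.
  2:{ exists 1. split. lra. intros; apply H. }
  assert (E := hol_unique _ _ _ _ A B). cbv beta in E.
  transitivity (evC (dxC F) x y * RtoC 0 + evC (dyC F) x y * RtoC 1)%C. ring. rewrite E. ring.
Qed.
Lemma evC_dxdy F x y : evC (dxC (dyC F)) x y = evC (dyC (dxC F)) x y.
Proof. induction F; simpl; try reflexivity; rewrite ?IHF1, ?IHF2; ring. Qed.
Lemma iter_ext i : forall F G, (forall x y, evC F x y = evC G x y) ->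
  forall x y, evC (Nat.iter i dyC F) x y = evC (Nat.iter i dyC G) x y.
Proof. induction i; intros F G H; simpl; auto. apply evC_ext_dy. auto. Qed.
Lemma iter_lin b c i : forall F G x y,
  evC (Nat.iter i dyC (PA (PM (PC b) F) (PM (PC c) G))) x y =
  (b * evC (Nat.iter i dyC F) x y + c * evC (Nat.iter i dyC G) x y)%C.
Proof.
  induction i; intros F G x y; simpl. auto.
  rewrite (evC_ext_dy _ (PA (PM (PC b) (Nat.iter i dyC F)) (PM (PC c) (Nat.iter i dyC G)))).
  simpl. ring. intros; rewrite IHi. reflexivity.
Qed.
Lemma evC_pmap F x y : evC (pmap RtoC F) (RtoC x) (RtoC y) = RtoC (evR F x y).
Proof. induction F; simpl; auto. rewrite IHF1, IHF2, RtoC_plus; auto. rewrite IHF1, IHF2, RtoC_mult; auto. Qed.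
Lemma pmap_dx F : pmap RtoC (dxR F) = dxC (pmap RtoC F).
Proof. induction F; simpl; congruence. Qed.
Lemma pmap_dy F : pmap RtoC (dyR F) = dyC (pmap RtoC F).
Proof. induction F; simpl; congruence. Qed.
Lemma dy_psubst e ex ey x y : evC (dyC (psubst e ex ey)) x y =
  (evC (dxC e) (evC ex x y) (evC ey x y) * evC (dyC ex) x y + evC (dyC e) (evC ex x y) (evC ey x y) * evC (dyC ey) x y)%C.
Proof.
  induction e; simpl; rewrite ?IHe1, ?IHe2, ?pev_psubst; ring.
Qed.

(** * Elimination of the square root *)

Lemma csqrt_exists (z : C) : exists w, (w * w)%C = z.
Proof.
  destruct (classic (z = RtoC 0)) as [->|N]. exists (RtoC 0). ring.
  apply Cmod_gt_0 in N. assert (E := Cmod_sq z).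
  destruct (polar (fst z / Cmod z) (snd z / Cmod z)) as [f [F1 F2]].
  { transitivity ((fst z ^ 2 + snd z ^ 2) / Cmod z ^ 2). field; lra. rewrite <- E. field; lra. }
  exists (RtoC (sqrt (Cmod z)) * cis (f / 2))%C.
  transitivity (RtoC (sqrt (Cmod z)) * RtoC (sqrt (Cmod z)) * (cis (f / 2) * cis (f / 2)))%C. ring.
  rewrite <- RtoC_mult, sqrt_sqrt by lra.
  assert (D : (cis (f / 2) * cis (f / 2))%C = cis f).
  { unfold cis. replace f with (f / 2 + f / 2) at 5 6 by field. rewrite cos_plus, sin_plus.
    apply injective_projections; simpl; ring. }
  rewrite D. unfold cis. rewrite <- F1, <- F2. destruct z as [a b]. unfold Cmult, RtoC. simpl fst; simpl snd in *. simpl.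
  simpl in N. apply injective_projections; simpl; field; lra.
Qed.

(** Every polynomial in K is [U(K^2) + K V(K^2)]. *)
Definition split_sqrt (g : C -> C -> C) : Prop := exists U V : pexpr C, forall H K,
  g H K = (evC U H (K * K)%C + K * evC V H (K * K)%C)%C.
Lemma split_mul g h : split_sqrt g -> split_sqrt h -> split_sqrt (fun H K => (g H K * h H K)%C).
Proof.
  intros [U [V E]] [U' [V' E']].
  exists (PA (PM U U') (PM PY (PM V V'))), (PA (PM U V') (PM V U')). intros. rewrite E, E'. simpl. ring.
Qed.
Lemma split_lin a b : split_sqrt (fun H K => (a * H + b * K)%C).
Proof. exists (PM (PC a) PX), (PC b). intros; simpl; ring. Qed.
Lemma split_pow g n : split_sqrt g -> split_sqrt (fun H K => (g H K ^ n)%C).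
Proof.
  intros A. induction n; simpl. exists (PC (RtoC 1)), (PC (RtoC 0)). intros; simpl; ring. apply split_mul; auto.
Qed.

(** Where f = 0 is a graph over x, the second derivative of y is - hess / f_y^3. *)
Definition hess (f : pexpr C) (x y : C) : C :=
  (evC (dxC (dxC f)) x y * (evC (dyC f) x y * evC (dyC f) x y) - RtoC 2 * (evC (dxC (dyC f)) x y * (evC (dxC f) x y * evC (dyC f) x y)) + evC (dyC (dyC f)) x y * (evC (dxC f) x y * evC (dxC f) x y))%C.
(** With the coefficients [qA], [qB], [qE] this is the squared gradient of f in the original
    coordinates, whose power 3/2 is the denominator of the curvature. *)
Definition qform (A B E : C) (f : pexpr C) (x y : C) : C :=
  (A * (evC (dxC f) x y * evC (dxC f) x y) + B * (evC (dxC f) x y * evC (dyC f) x y) + E * (evC (dyC f) x y * evC (dyC f) x y))%C.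
Lemma is_pexpr_hess f : is_pexpr (hess f). Proof. unfold hess. prove_pexpr. Qed.
Lemma is_pexpr_qform A B E f : is_pexpr (qform A B E f). Proof. unfold qform. prove_pexpr. Qed.

(** The curvature relation with the square root eliminated is a polynomial identity, so it passes
    from a set of points to every point where all polynomials vanishing on the set vanish. *)
Lemma relation_transfer (Z : C -> C -> Prop) (x0 y0 : C) (f D : pexpr C) (A B E kap re c1 : C) (k : nat) :
  (forall e : pexpr C, (forall x y, Z x y -> evC e x y = RtoC 0) -> evC e x0 y0 = RtoC 0) ->
  (forall x y, Z x y -> exists K, (K * K)%C = (kap * qform A B E f x y ^ 3)%C /\
     (evC D x y ^ 3 * ((RtoC 2 * re * hess f x y + RtoC (-1) * K) ^ (2 * k) * (re * hess f x y + RtoC (-1) * K) ^ k))%C =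
     (c1 * (hess f x y ^ (2 * k) * evC (dyC f) x y ^ (3 * k)))%C) ->
  exists K, (K * K)%C = (kap * qform A B E f x0 y0 ^ 3)%C /\
     (evC D x0 y0 ^ 3 * ((RtoC 2 * re * hess f x0 y0 + RtoC (-1) * K) ^ (2 * k) * (re * hess f x0 y0 + RtoC (-1) * K) ^ k))%C =
     (c1 * (hess f x0 y0 ^ (2 * k) * evC (dyC f) x0 y0 ^ (3 * k)))%C.
Proof.
  intros HI HZ.
  destruct (split_mul _ _ (split_pow _ (2 * k) (split_lin (RtoC 2 * re)%C (RtoC (-1)))) (split_pow _ k (split_lin re (RtoC (-1))))) as [U [V UV]].
  set (q := fun x y => (kap * qform A B E f x y ^ 3)%C).
  set (rhs := fun x y => (c1 * (hess f x y ^ (2 * k) * evC (dyC f) x y ^ (3 * k)))%C).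
  set (Ra := fun x y => (evC D x y ^ 3 * evC U (hess f x y) (q x y) - rhs x y)%C).
  set (Rb := fun x y => (evC D x y ^ 3 * evC V (hess f x y) (q x y))%C).
  assert (Bq : is_pexpr q) by (unfold q; prove_pexpr; apply is_pexpr_qform).
  assert (BR : is_pexpr (fun x y => (Ra x y * Ra x y - q x y * (Rb x y * Rb x y))%C)).
  { assert (X : is_pexpr Ra).
    { unfold Ra, rhs. apply is_pexpr_minus. apply is_pexpr_mul. prove_pexpr. apply is_pexpr_evC; auto. apply is_pexpr_hess. prove_pexpr. all: apply is_pexpr_hess. }
    assert (Y : is_pexpr Rb) by (unfold Rb; apply is_pexpr_mul; [prove_pexpr|apply is_pexpr_evC; auto; apply is_pexpr_hess]).
    apply is_pexpr_minus; apply is_pexpr_mul; auto. apply is_pexpr_mul; auto. }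
  destruct BR as [e He].
  assert (E0 : evC e x0 y0 = RtoC 0).
  { apply HI. intros x y Hxy. rewrite He. destruct (HZ x y Hxy) as [K [K2 R]].
    rewrite (UV (hess f x y) K), K2 in R. fold (q x y) (rhs x y) in R.
    assert (R' : Ra x y = (- (K * Rb x y))%C).
    { unfold Ra, Rb. rewrite <- R. ring. }
    rewrite R'. replace (q x y) with (K * K)%C by (rewrite K2; auto). ring. }
  rewrite He in E0.
  destruct (csqrt_exists (q x0 y0)) as [K HK]. rewrite <- HK in E0.
  assert (P : ((Ra x0 y0 + K * Rb x0 y0) * (Ra x0 y0 + - K * Rb x0 y0))%C = RtoC 0).
  { rewrite <- E0. ring. }
  assert (Fin : forall K', (K' * K')%C = q x0 y0 -> (Ra x0 y0 + K' * Rb x0 y0)%C = RtoC 0 ->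
    (evC D x0 y0 ^ 3 * ((RtoC 2 * re * hess f x0 y0 + RtoC (-1) * K') ^ (2 * k) * (re * hess f x0 y0 + RtoC (-1) * K') ^ k))%C = rhs x0 y0).
  { intros K' H1 H2. rewrite (UV (hess f x0 y0) K'), H1.
    transitivity (rhs x0 y0 + (Ra x0 y0 + K' * Rb x0 y0))%C. unfold Ra, Rb. ring. rewrite H2. ring. }
  (* Which of the two conjugate factors vanishes at the new point is not known; if it is the wrong
     one, K is replaced by - K. *)
  apply Cmult_integral in P. destruct P as [P|P].
  - exists K. split; auto.
  - exists (- K)%C. split. transitivity (K * K)%C. ring. exact HK.
    apply Fin; auto. rewrite <- HK. ring.
Qed.

Lemma cder_pexpr (f : pexpr C) (a b : R -> C) s la lb : cder a s la -> cder b s lb ->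
  cder (fun w => evC f (a w) (b w)) s
    (evC (dxC f) (a s) (b s) * la + evC (dyC f) (a s) (b s) * lb)%C.
Proof.
  intros Ha Hb. induction f; simpl.
  - eapply cder_eq. apply cder_const. ring.
  - eapply cder_eq. exact Ha. ring.
  - eapply cder_eq. exact Hb. ring.
  - eapply cder_eq. apply cder_plus; eassumption. ring.
  - eapply cder_eq. apply cder_mult; eassumption. cbv beta. ring.
Qed.
Lemma cder_unique h s l m : cder h s l -> cder h s m -> l = m.
Proof.
  intros [A B] [A' B'].
  assert (E1 := is_derive_ext_unique _ _ s _ _ (fun _ => eq_refl) A A').
  assert (E2 := is_derive_ext_unique _ _ s _ _ (fun _ => eq_refl) B B').
  destruct l, m; simpl in *; congruence.
Qed.
Lemma cder_ext h k s l : (forall u, h u = k u) -> cder h s l -> cder k s l.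
Proof.
  intros E [A B]. split.
  - apply is_derive_ext with (2 := A). intros; rewrite E; auto.
  - apply is_derive_ext with (2 := B). intros; rewrite E; auto.
Qed.
Lemma cder_RtoC (f : R -> R) s (l : R) : is_derive f s l -> cder (fun u => RtoC (f u)) s (RtoC l).
Proof. intros H. split; simpl. exact H. apply is_derive_Rconst. Qed.

(** * The relation in the affine coordinates of the branch *)

Section CurveC.
Variables (z1 z2 t1 t2 kk : R -> R) (r ep : R).
Hypothesis Fr : frame z1 z2 t1 t2 kk.
Hypothesis ep2 : ep * ep = 1.
Hypothesis r0 : 0 < r.
Hypothesis lam0 : forall s, lam kk r ep s <> 0.
Variables (m11 m12 m21 m22 q1 q2 : C).
Let Dl := (m11 * m22 - m12 * m21)%C.
Hypothesis Dl0 : Dl <> RtoC 0.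
Definition par1 (s : R) : R := z1 s + r * ep * - t2 s.
Definition par2 (s : R) : R := z2 s + r * ep * t1 s.
Definition Xc (u v : C) : C := (m11 * (u - q1) + m12 * (v - q2))%C.
Definition Yc (u v : C) : C := (m21 * (u - q1) + m22 * (v - q2))%C.
(** Inverse of the affine map (Xc, Yc), by which [tilde] rewrites a polynomial in the coordinates of
    the branch; ([dY_dir1], [dY_dir2]) is the vector d/dY in the original ones. *)
Definition old_x : pexpr C := PA (PC q1) (PM (PC (/ Dl)%C) (PA (PM (PC m22) PX) (PM (PC (- m12)%C) PY))).
Definition old_y : pexpr C := PA (PC q2) (PM (PC (/ Dl)%C) (PA (PM (PC (- m21)%C) PX) (PM (PC m11) PY))).
Lemma old_x_eq u v : evC old_x (Xc u v) (Yc u v) = u.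
Proof. simpl. unfold Xc, Yc, Dl. field. auto. Qed.
Lemma old_y_eq u v : evC old_y (Xc u v) (Yc u v) = v.
Proof. simpl. unfold Xc, Yc, Dl. field. auto. Qed.
Definition tilde (G : pexpr R) : pexpr C := psubst (pmap RtoC G) old_x old_y.
Definition dY_dir1 : C := (/ Dl * - m12)%C.
Definition dY_dir2 : C := (/ Dl * m11)%C.
Lemma tilde_iter i : forall G (u v : R),
  evC (Nat.iter i dyC (tilde G)) (Xc (RtoC u) (RtoC v)) (Yc (RtoC u) (RtoC v)) = dir_deriv dY_dir1 dY_dir2 i G u v.
Proof.
  induction i; intros G u v.
  - simpl. unfold tilde. rewrite pev_psubst, old_x_eq, old_y_eq, evC_pmap. auto.
  - rewrite Nat.iter_succ_r.
    rewrite (iter_ext i _ (PA (PM (PC dY_dir1) (tilde (dxR G))) (PM (PC dY_dir2) (tilde (dyR G))))).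
    rewrite iter_lin, !IHi. reflexivity.
    intros x y. unfold tilde. rewrite dy_psubst. simpl. rewrite !pev_psubst, pmap_dx, pmap_dy. simpl. unfold dY_dir1, dY_dir2. ring.
Qed.
Lemma tilde_zero_iff G : (exists x y, evR G x y <> 0) -> exists x y, evC (tilde G) x y <> RtoC 0.
Proof.
  intros [u [v H]]. exists (Xc (RtoC u) (RtoC v)), (Yc (RtoC u) (RtoC v)).
  generalize (tilde_iter 0 G u v). simpl. intros ->. apply RtoC_nz. auto.
Qed.
Let X s := Xc (RtoC (par1 s)) (RtoC (par2 s)).
Let Y s := Yc (RtoC (par1 s)) (RtoC (par2 s)).
Let xt s := (m11 * RtoC (t1 s) + m12 * RtoC (t2 s))%C.
Let yt s := (m21 * RtoC (t1 s) + m22 * RtoC (t2 s))%C.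
Let xn s := (m11 * RtoC (- t2 s) + m12 * RtoC (t1 s))%C.
Let yn s := (m21 * RtoC (- t2 s) + m22 * RtoC (t1 s))%C.

Lemma tilde_vanishes_to_order j : forall G, vanish_to_order z1 z2 t1 t2 r ep j G -> forall i, (i < j)%nat -> forall s,
  evC (Nat.iter i dyC (tilde G)) (X s) (Y s) = RtoC 0.
Proof.
  assert (A : forall i j G, (i < j)%nat -> vanish_to_order z1 z2 t1 t2 r ep j G -> forall s, dir_deriv dY_dir1 dY_dir2 i G (par1 s) (par2 s) = RtoC 0).
  { induction i; intros n G Hi H s.
    - destruct n; [lia|]. destruct H as [H _]. specialize (H s). simpl in H. rewrite sev_ssub, sev_cx, sev_cy, sin_0, cos_0 in H.
      simpl. unfold par1, par2. f_equal. rewrite <- H. f_equal; ring.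
    - destruct n; [lia|]. destruct H as [_ [HA HB]]. simpl. rewrite (IHi n), (IHi n) by (auto; lia). ring. }
  intros G H i Hi s. unfold X, Y. rewrite tilde_iter. apply (A i j); auto.
Qed.
(** At a zero of order k only the normal component of d/dY counts, and [Dl] times that component is
    [xt]. *)
Lemma top_derivative k G : vanish_to_order z1 z2 t1 t2 r ep k G -> forall s,
  (Dl ^ k * evC (Nat.iter k dyC (tilde G)) (X s) (Y s))%C = (xt s ^ k * RtoC (normal_deriv z1 z2 t1 t2 r ep k G s))%C.
Proof.
  intros H s. unfold X, Y. rewrite tilde_iter. unfold par1, par2.
  rewrite (directional_of_normal z1 z2 t1 t2 kk r ep Fr ep2 lam0 dY_dir1 dY_dir2 k G H s).
  rewrite Cmult_assoc, <- Cpow_mult_l. f_equal. f_equal. unfold dY_dir1, dY_dir2, xt. rewrite RtoC_opp. field. auto.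
Qed.

Lemma d_par1 s : is_derive par1 s (lam kk r ep s * t1 s).
Proof.
  unfold par1. eapply is_derive_eq. apply is_derive_Rplus. apply (fr_z1 _ _ _ _ _ Fr).
  apply (is_derive_Rmult (fun _ => r * ep)). apply is_derive_Rconst.
  apply (is_derive_ext (fun s => -1 * t2 s)). intros; rring.
  apply (is_derive_Rmult (fun _ => -1)). apply is_derive_Rconst. apply (fr_t2 _ _ _ _ _ Fr).
  unfold lam. rring.
Qed.
Lemma d_par2 s : is_derive par2 s (lam kk r ep s * t2 s).
Proof.
  unfold par2. eapply is_derive_eq. apply is_derive_Rplus. apply (fr_z2 _ _ _ _ _ Fr).
  apply (is_derive_Rmult (fun _ => r * ep)). apply is_derive_Rconst. apply (fr_t1 _ _ _ _ _ Fr).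
  unfold lam. rring.
Qed.
Lemma cder_lin (a b c d : C) (u v : R -> R) s lu lv : is_derive u s lu -> is_derive v s lv ->
  cder (fun s => (a * (RtoC (u s) - c) + b * (RtoC (v s) - d))%C) s
   (a * RtoC lu + b * RtoC lv)%C.
Proof.
  intros Hu Hv. eapply cder_eq. apply cder_plus; apply cder_mult.
  apply cder_const. apply cder_plus. apply cder_RtoC; eassumption. apply cder_const.
  apply cder_const. apply cder_plus. apply cder_RtoC; eassumption. apply cder_const. cbv beta. ring.
Qed.
Lemma d_X s : cder X s (RtoC (lam kk r ep s) * xt s)%C.
Proof.
  eapply cder_eq. apply (cder_lin m11 m12 q1 q2). apply d_par1. apply d_par2.
  unfold xt. rewrite !RtoC_mult. ring.
Qed.
Lemma d_Y s : cder Y s (RtoC (lam kk r ep s) * yt s)%C.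
Proof.
  eapply cder_eq. apply (cder_lin m21 m22 q1 q2). apply d_par1. apply d_par2.
  unfold yt. rewrite !RtoC_mult. ring.
Qed.
Lemma cder_lin0 (a b : C) (u v : R -> R) s lu lv : is_derive u s lu -> is_derive v s lv ->
  cder (fun s => (a * RtoC (u s) + b * RtoC (v s))%C) s
   (a * RtoC lu + b * RtoC lv)%C.
Proof.
  intros Hu Hv. eapply cder_ext. 2: apply (cder_lin a b (RtoC 0) (RtoC 0)); eassumption.
  intros; simpl; ring.
Qed.
Lemma d_xt s : cder xt s (RtoC (kk s) * xn s)%C.
Proof.
  eapply cder_eq. apply cder_lin0. apply (fr_t1 _ _ _ _ _ Fr). apply (fr_t2 _ _ _ _ _ Fr).
  unfold xn. rewrite !RtoC_mult, !RtoC_opp. ring.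
Qed.
Lemma d_yt s : cder yt s (RtoC (kk s) * yn s)%C.
Proof.
  eapply cder_eq. apply cder_lin0. apply (fr_t1 _ _ _ _ _ Fr). apply (fr_t2 _ _ _ _ _ Fr).
  unfold yn. rewrite !RtoC_mult, !RtoC_opp. ring.
Qed.
Lemma frame_det s : (xt s * yn s - yt s * xn s)%C = Dl.
Proof.
  unfold xt, yt, xn, yn, Dl.
  assert (U : (RtoC (t1 s) * RtoC (t1 s) + RtoC (t2 s) * RtoC (t2 s))%C = RtoC 1).
  { rewrite <- !RtoC_mult, <- RtoC_plus. f_equal. rewrite <- (fr_u _ _ _ _ _ Fr s). ring. }
  rewrite !RtoC_opp.
  transitivity ((m11 * m22 - m12 * m21) * (RtoC (t1 s) * RtoC (t1 s) + RtoC (t2 s) * RtoC (t2 s)))%C.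
  ring. rewrite U. ring.
Qed.

Definition qA : C := (m11 * m11 + m12 * m12)%C.
Definition qB : C := (RtoC 2 * (m11 * m21 + m12 * m22))%C.
Definition qE : C := (m21 * m21 + m22 * m22)%C.

Lemma curve_differential (f : pexpr C) : (forall s, evC f (X s) (Y s) = RtoC 0) -> forall s, exists nu : C,
  evC (dxC f) (X s) (Y s) = (- (nu * yt s))%C /\
  evC (dyC f) (X s) (Y s) = (nu * xt s)%C /\
  (RtoC (lam kk r ep s) * hess f (X s) (Y s))%C = (- (RtoC (kk s) * (nu ^ 3 * Dl)))%C /\
  qform qA qB qE f (X s) (Y s) = (nu ^ 2 * Dl ^ 2)%C.
Proof.
  intros Hf.
  assert (E1 : forall s, (evC (dxC f) (X s) (Y s) * xt s + evC (dyC f) (X s) (Y s) * yt s)%C = RtoC 0).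
  { intro s. assert (A := cder_pexpr f X Y s _ _ (d_X s) (d_Y s)).
    apply cder_ext with (k := fun _ => RtoC 0) in A; auto.
    assert (B := cder_unique _ _ _ _ A (cder_const (RtoC 0) s)).
    apply Cmult_reg_l with (RtoC (lam kk r ep s)). apply RtoC_nz; auto. rewrite Cmult_0_r. refine (eq_trans _ B). ring. }
  intro s.
  assert (A := cder_plus _ _ _ _ _ (cder_mult _ _ _ _ _ (cder_pexpr (dxC f) X Y s _ _ (d_X s) (d_Y s)) (d_xt s))
    (cder_mult _ _ _ _ _ (cder_pexpr (dyC f) X Y s _ _ (d_X s) (d_Y s)) (d_yt s))).
  apply cder_ext with (k := fun _ => RtoC 0) in A. 2: exact E1.
  assert (E2 := cder_unique _ _ _ _ A (cder_const (RtoC 0) s)). cbv beta in E2. clear A.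
  specialize (E1 s). assert (Dt := frame_det s).
  unfold hess, qform.
  rewrite evC_dxdy in E2 |- *.
  set (fx := evC (dxC f) (X s) (Y s)) in *. set (fy := evC (dyC f) (X s) (Y s)) in *.
  set (fxx := evC (dxC (dxC f)) (X s) (Y s)) in *. set (fxy := evC (dyC (dxC f)) (X s) (Y s)) in *.
  set (fyy := evC (dyC (dyC f)) (X s) (Y s)) in *.
  set (l := RtoC (lam kk r ep s)) in *. set (kp := RtoC (kk s)) in *.
  (* The normal derivative of f divided by the determinant of the transformed frame. *)
  set (nu := ((fx * xn s + fy * yn s) / Dl)%C).
  assert (Fx : fx = (- (nu * yt s))%C).
  { apply Cmult_reg_l with Dl; auto. unfold nu.
    transitivity (- ((fx * xn s + fy * yn s) * yt s))%C. 2: field; auto.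
    rewrite <- Dt at 1.
    transitivity (yn s * (fx * xt s + fy * yt s) - (fx * xn s + fy * yn s) * yt s)%C.
    ring. rewrite E1. ring. }
  assert (Fy : fy = (nu * xt s)%C).
  { apply Cmult_reg_l with Dl; auto. unfold nu.
    transitivity ((fx * xn s + fy * yn s) * xt s)%C. 2: field; auto.
    rewrite <- Dt at 1.
    transitivity ((fx * xn s + fy * yn s) * xt s - xn s * (fx * xt s + fy * yt s))%C.
    ring. rewrite E1. ring. }
  exists nu. split; auto. split; auto.
  assert (E3 : (fx * xn s + fy * yn s)%C = (nu * Dl)%C) by (unfold nu; field; auto).
  clearbody nu. split.
  - transitivity (nu * nu * (RtoC 0 - kp * (nu * Dl)))%C. 2: ring.
    rewrite <- E2, <- E3. rewrite Fx, Fy. ring.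
  - rewrite Fx, Fy, <- Dt. unfold qA, qB, qE, xt, yt, xn, yn.
    assert (U : (RtoC (t1 s) * RtoC (t1 s) + RtoC (t2 s) * RtoC (t2 s))%C = RtoC 1).
    { rewrite <- !RtoC_mult, <- RtoC_plus. f_equal. rewrite <- (fr_u _ _ _ _ _ Fr s). ring. }
    rewrite !RtoC_opp. set (a := RtoC (t1 s)) in *. set (b := RtoC (t2 s)) in *.
    transitivity (nu ^ 2 * (m11 * m22 - m12 * m21) ^ 2 * (a * a + b * b))%C.
    ring.
    transitivity (nu ^ 2 * (m11 * m22 - m12 * m21) ^ 2 * ((a * a + b * b) * (a * a + b * b)))%C.
    rewrite U. ring. ring.
Qed.

(** With K = nu^3 Dl and T = re H - K one has H = kk T, - K = l T and 2 re H - K = l' T, where l, l'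
    are [lam] for ep and - ep. Powers of T thus turn the curvature relation into one in H and K. *)
Lemma curve_algebraic_relation (f : pexpr C) (G : pexpr R) (k : nat) (c : R) :
  (forall s, evC f (X s) (Y s) = RtoC 0) -> vanish_to_order z1 z2 t1 t2 r ep k G -> c <> 0 ->
  (forall s, normal_deriv z1 z2 t1 t2 r ep k G s ^ 3 * lam kk r (- ep) s ^ (2 * k)
      = c * (r * kk s) ^ (2 * k) * lam kk r ep s ^ k) ->
  exists c1, c1 <> RtoC 0 /\ forall s, exists K,
     (K * K)%C = (/ Dl ^ 4 * qform qA qB qE f (X s) (Y s) ^ 3)%C /\
     (evC (Nat.iter k dyC (tilde G)) (X s) (Y s) ^ 3 * ((RtoC 2 * RtoC (ep * r) * hess f (X s) (Y s) + RtoC (-1) * K) ^ (2 * k) * (RtoC (ep * r) * hess f (X s) (Y s) + RtoC (-1) * K) ^ k))%C =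
     (c1 * (hess f (X s) (Y s) ^ (2 * k) * evC (dyC f) (X s) (Y s) ^ (3 * k)))%C.
Proof.
  intros Hf HV c0 HW.
  (* (l T)^k = (- K)^k gives the sign and a factor Dl^k; the cube of [top_derivative] gives Dl^(3k)
     in the denominator. *)
  exists (RtoC (-1) ^ k * (RtoC c * RtoC r ^ (2 * k)) / Dl ^ (2 * k))%C.
  split.
  { intro Z. apply (f_equal (fun w => (w * Dl ^ (2 * k))%C)) in Z.
    assert (Dk : (Dl ^ (2 * k))%C <> RtoC 0) by (apply Cpow_nz; auto).
    replace (_ / _ * Dl ^ (2 * k))%C with (RtoC (-1) ^ k * (RtoC c * RtoC r ^ (2 * k)))%C in Z by (field; auto).
    rewrite Cmult_0_l in Z. revert Z. repeat apply Cmult_neq_0. apply Cpow_nz. apply RtoC_nz; lra. apply RtoC_nz; auto.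
    apply Cpow_nz. apply RtoC_nz; lra. }
  intro s. destruct (curve_differential f Hf s) as [nu [Fx [Fy [EH ES]]]].
  assert (TD := top_derivative k G HV s).
  specialize (HW s).
  exists (nu ^ 3 * Dl)%C. split. rewrite ES. field; auto.
  rewrite Fy. set (H := hess f (X s) (Y s)) in *. set (D := evC (Nat.iter k dyC (tilde G)) (X s) (Y s)) in *.
  set (K := (nu ^ 3 * Dl)%C) in *.
  set (re := RtoC (ep * r)). set (kp := RtoC (kk s)) in *. set (l := RtoC (lam kk r ep s)) in *.
  set (l' := RtoC (lam kk r (- ep) s)). set (W := RtoC (normal_deriv z1 z2 t1 t2 r ep k G s)) in *.
  assert (HWc : (W ^ 3 * l' ^ (2 * k))%C = (RtoC c * ((RtoC r * kp) ^ (2 * k) * l ^ k))%C).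
  { unfold W, l', l, kp. rewrite <- RtoC_mult, <- !RtoC_pow, <- !RtoC_mult. rewrite HW. f_equal. ring. }
  assert (El : l = (RtoC 1 - re * kp)%C).
  { unfold l, re, kp, lam. rewrite <- RtoC_mult, <- RtoC_minus. f_equal. }
  assert (El' : l' = (RtoC 1 + re * kp)%C).
  { unfold l', re, kp, lam. rewrite <- RtoC_mult, <- RtoC_plus. f_equal. ring. }
  set (T := (re * H + RtoC (-1) * K)%C).
  assert (EH' : H = (kp * T)%C).
  { unfold T. transitivity (l * H + re * kp * H)%C. rewrite El. ring. rewrite EH. ring. }
  assert (T1 : (l * T)%C = (- K)%C).
  { rewrite El. transitivity (T - re * (kp * T))%C. ring. rewrite <- EH'. unfold T. ring. }
  assert (T2 : (RtoC 2 * re * H + RtoC (-1) * K)%C = (l' * T)%C).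
  { rewrite El'. transitivity (T + re * (kp * T))%C. rewrite <- EH'. unfold T. ring. ring. }
  rewrite T2.
  assert (Dk : (Dl ^ k)%C <> RtoC 0) by (apply Cpow_nz; auto).
  apply Cmult_reg_l with (Dl ^ k * (Dl ^ k * Dl ^ k))%C.
  repeat apply Cmult_neq_0; auto.
  transitivity ((Dl ^ k * D) ^ 3 * ((l' * T) ^ (2 * k) * T ^ k))%C. ring.
  rewrite TD. rewrite !Cpow_mult_l.
  transitivity ((xt s ^ k) ^ 3 * (T ^ (2 * k) * T ^ k) * (W ^ 3 * l' ^ (2 * k)))%C. ring.
  rewrite HWc, !Cpow_mult_l.
  transitivity (RtoC c * ((xt s ^ k) ^ 3 * RtoC r ^ (2 * k) * ((kp * T) ^ (2 * k) * (l * T) ^ k)))%C.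
  rewrite !Cpow_mult_l. ring.
  rewrite <- EH', T1.
  replace (- K)%C with (RtoC (-1) * (nu ^ 3 * Dl))%C by (unfold K; ring).
  rewrite !Cpow_mult_l. replace (Dl ^ (2 * k))%C with (Dl ^ k * Dl ^ k)%C.
  2:{ rewrite <- Cpow_add_r. f_equal. lia. }
  assert (P3 : forall w, (w ^ (3 * k))%C = ((w ^ k) ^ 3)%C).
  { intro w. replace (3 * k)%nat with (k * 3)%nat by lia. apply Cpow_mult_r. }
  rewrite !P3. replace ((nu ^ 3) ^ k)%C with ((nu ^ k) ^ 3)%C.
  2:{ rewrite <- !Cpow_mult_r. f_equal. lia. }
  field. auto.
Qed.
End CurveC.

(** * Sub-quadratic branches *)

Lemma hol_pow n z : hol (fun w => (w ^ n)%C) z (RtoC (INR n) * z ^ (n - 1))%C.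
Proof.
  induction n. simpl. replace (RtoC 0 * RtoC 1)%C with (RtoC 0) by ring. apply (hol_const (RtoC 1)).
  replace (RtoC (INR (S n)) * z ^ (S n - 1))%C with
    (RtoC 1 * z ^ n + z * (RtoC (INR n) * z ^ (n - 1)))%C.
  apply (hol_mult (fun w => w) (fun w => (w ^ n)%C)). apply hol_id. exact IHn.
  rewrite S_INR, RtoC_plus. replace (S n - 1)%nat with n by lia. destruct n. simpl. ring.
  replace (S n - 1)%nat with n by lia. simpl. ring.
Qed.
Lemma cis_pow a n : (cis a ^ n)%C = cis (INR n * a).
Proof.
  induction n. simpl. unfold cis. rewrite Rmult_0_l, cos_0, sin_0. reflexivity.
  rewrite Cpow_S, IHn, S_INR. replace ((INR n + 1) * a) with (a + INR n * a) by ring.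
  unfold cis. rewrite cos_plus, sin_plus. apply injective_projections; simpl; ring.
Qed.
(** As q does not divide p, a primitive q-th root of unity serves; the argument of its p-th power is
    2 PI (p - q)/q modulo 2 PI. *)
Lemma root_of_unity q p : (q < p)%nat -> (p < 2 * q)%nat ->
  exists z : C, Cmod z = 1 /\ (z ^ q)%C = RtoC 1 /\ (z ^ p)%C <> RtoC 1.
Proof.
  intros H1 H2. exists (cis (2 * PI / INR q)). assert (Q : 0 < INR q) by (apply lt_0_INR; lia).
  generalize PI_RGT_0; intro P. split. apply Cmod_cis. split.
  - rewrite cis_pow. replace (INR q * (2 * PI / INR q)) with (2 * PI) by (field; lra).
    unfold cis. rewrite cos_2PI, sin_2PI. auto.
  - rewrite cis_pow. intro E. apply (f_equal fst) in E. simpl in E.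
    replace p with (q + (p - q))%nat in E by lia. rewrite plus_INR in E.
    set (j := INR (p - q)) in *.
    assert (J : 0 < j < INR q) by (unfold j; split; [apply lt_0_INR; lia|apply lt_INR; lia]).
    replace ((INR q + j) * (2 * PI / INR q)) with (2 * (j * PI / INR q) + 2 * INR 1 * PI) in E by (simpl; field; lra).
    rewrite cos_period, cos_2a_sin in E.
    assert (S : 0 < sin (j * PI / INR q)).
    { apply sin_gt_0. apply Rdiv_lt_0_compat; [apply Rmult_lt_0_compat|]; lra.
      apply Rmult_lt_reg_r with (INR q); auto. unfold Rdiv. rewrite Rmult_assoc, Rinv_l by lra. nra. }
    nra.
Qed.
(** The mean value theorem is applied to real and imaginary parts separately, whence the factor
    2. *)
Lemma cder_bound (h l : R -> C) (a b M : R) : a <= b -> (forall t, a <= t <= b -> cder h t (l t)) ->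
  (forall t, a <= t <= b -> Cmod (l t) <= M) -> Cmod (h b - h a) <= 2 * M * (b - a).
Proof.
  intros Hab Hd HM.
  assert (X : forall (u v : R -> R), (forall t, a <= t <= b -> is_derive u t (v t)) -> (forall t, a <= t <= b -> Rabs (v t) <= M) ->
     Rabs (u b - u a) <= M * (b - a)).
  { intros u v Hu Hv. destruct (MVT_gen u a b v) as [c [Hc E]].
    - rewrite Rmin_left, Rmax_right by auto. intros t Ht. apply Hu; lra.
    - rewrite Rmin_left, Rmax_right by auto. intros t Ht. apply continuity_pt_filterlim.
      apply (ex_derive_continuous (V := R_NormedModule) u t). eexists; apply Hu; auto.
    - rewrite Rmin_left, Rmax_right in Hc by auto. rewrite E, Rabs_mult, (Rabs_pos_eq (b - a)) by lra.
      apply Rmult_le_compat_r. lra. apply Hv; auto. }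
  eapply Rle_trans. apply Cmod_le_ReIm.
  assert (A := X (fun t => Re (h t)) (fun t => Re (l t)) (fun t Ht => proj1 (Hd t Ht))
     (fun t Ht => Rle_trans _ _ _ (Rabs_Re_le _) (HM t Ht))).
  assert (B := X (fun t => Im (h t)) (fun t => Im (l t)) (fun t Ht => proj2 (Hd t Ht))
     (fun t Ht => Rle_trans _ _ _ (Rabs_Im_le _) (HM t Ht))).
  replace (Re (h b - h a)) with (Re (h b) - Re (h a)) by (unfold Re; simpl; ring).
  replace (Im (h b - h a)) with (Im (h b) - Im (h a)) by (unfold Im; simpl; ring).
  lra.
Qed.
(** The derivative is controlled for u > 0 only; the linear bound on h lets the lower end of the
    interval tend to 0. *)
Lemma cder_bound_at_0 (h l : R -> C) (a A M : R) : 0 <= A -> 0 < a ->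
  (forall u, 0 < u <= a -> Cmod (h u) <= A * u) ->
  (forall u, 0 < u <= a -> cder h u (l u)) -> (forall u, 0 < u <= a -> Cmod (l u) <= M) ->
  Cmod (h a) <= 2 * M * a.
Proof.
  intros A0 a0 Hh Hd Hl.
  assert (M0 : 0 <= M) by (eapply Rle_trans; [apply (Cmod_ge_0 (l a))|apply Hl; lra]).
  assert (D : forall u, 0 < u <= a -> Cmod (h a) <= 2 * M * a + A * u).
  { intros u Hu.
    assert (Y1 : Cmod (h a - h u) <= 2 * M * (a - u)) by (apply cder_bound with l; intros; try apply Hd; try apply Hl; lra).
    assert (Y3 : Cmod (h a) <= Cmod (h a - h u) + Cmod (h u)).
    { replace (h a) with (h a - h u + h u)%C at 1 by ring. apply Cmod_triangle. }
    specialize (Hh u Hu). nra. }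
  apply Rnot_lt_le. intro Lt. set (gap := Cmod (h a) - 2 * M * a).
  assert (G0 : 0 < gap) by (unfold gap; lra).
  set (u := Rmin a (gap / (2 * (A + 1)))).
  assert (U0 : 0 < u) by (apply Rmin_pos; [lra|apply Rdiv_lt_0_compat; lra]).
  assert (U1 : u <= a) by apply Rmin_l. assert (U2 : u <= gap / (2 * (A + 1))) by apply Rmin_r.
  specialize (D u (conj U0 U1)).
  assert (u * (2 * (A + 1)) <= gap).
  { apply Rle_trans with (gap / (2 * (A + 1)) * (2 * (A + 1))). apply Rmult_le_compat_r; lra. right; field; lra. }
  unfold gap in *. nra.
Qed.
Lemma pow_le_1 x n m : 0 <= x <= 1 -> (m <= n)%nat -> x ^ n <= x ^ m.
Proof.
  intros H L. replace n with (m + (n - m))%nat by lia. rewrite pow_add.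
  assert (0 <= x ^ m) by (apply pow_le; lra). assert (x ^ (n - m) <= 1).
  { rewrite <- (pow1 (n - m)). apply pow_incr. auto. }
  rewrite <- (Rmult_1_r (x ^ m)) at 2. apply Rmult_le_compat_l; auto.
Qed.

(** * Growth estimates on a sub-quadratic branch *)

Section Branch.
Variables (q p k : nat) (rho : R) (Y hh rr : C -> C) (c : C) (f a b g : pexpr C) (A B E kap re c1 : C) (d0 : R).
Hypothesis Hqp : (q < p)%nat.
Hypothesis Hp : (p < 2 * q)%nat.
Hypothesis Hk : (1 <= k)%nat.
Hypothesis rho0 : 0 < rho.
Hypothesis c0 : c <> RtoC 0.
Hypothesis c10 : c1 <> RtoC 0.
Hypothesis HY : forall t, Cmod t < rho -> Y t = (c * (t ^ p * (RtoC 1 + hh t)))%C.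
Hypothesis Hh : forall e, 0 < e -> exists d, 0 < d /\ forall t, Cmod t < d -> Cmod (hh t) < e.
Hypothesis HYd : forall t, Cmod t < rho -> exists l, hol Y t l.
Hypothesis Hf : forall t, Cmod t < rho -> evC f (t ^ q)%C (Y t) = RtoC 0.
Hypothesis HBz : forall x y, (evC a x y * evC f x y + evC b x y * evC (dyC f) x y)%C = rr x.
Hypothesis Hd0 : 0 < d0.
Hypothesis Hrr : forall x, 0 < Cmod x < d0 -> rr x <> RtoC 0.
Hypothesis Hg : forall i, (i < k)%nat -> forall t, Cmod t < rho -> evC (Nat.iter i dyC g) (t ^ q)%C (Y t) = RtoC 0.
Hypothesis Hrel : forall t, Cmod t < rho -> exists K,
     (K * K)%C = (kap * qform A B E f (t ^ q)%C (Y t) ^ 3)%C /\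
     (evC (Nat.iter k dyC g) (t ^ q)%C (Y t) ^ 3 * ((RtoC 2 * re * hess f (t ^ q)%C (Y t) + RtoC (-1) * K) ^ (2 * k) * (re * hess f (t ^ q)%C (Y t) + RtoC (-1) * K) ^ k))%C =
     (c1 * (hess f (t ^ q)%C (Y t) ^ (2 * k) * evC (dyC f) (t ^ q)%C (Y t) ^ (3 * k)))%C.

Let cm := Cmod c.
Lemma cm_pos : 0 < cm. Proof. apply Cmod_gt_0; auto. Qed.

(** One radius for all requirements; s <= 1 and 2 cm s <= 1 keep the abscissa and |Y| below 1, as
    [double_root_bound] asks. *)
Lemma good_radius e : 0 < e -> exists s, 0 < s /\ s <= 1 /\ s <= rho /\ s <= d0 /\ 2 * cm * s <= 1 /\
  forall t, Cmod t < s -> Cmod (hh t) < e /\ Cmod (hh t) < 1 / 2.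
Proof.
  intro He. destruct (Hh e He) as [e1 [P1 Q1]]. destruct (Hh (1/2)) as [e2 [P2 Q2]]. lra.
  generalize cm_pos; intro C0.
  assert (P3 : 0 < / (2 * cm)) by (apply Rinv_0_lt_compat; lra).
  exists (Rmin (Rmin 1 rho) (Rmin (Rmin d0 (/ (2 * cm))) (Rmin e1 e2))).
  set (s := Rmin _ _).
  assert (S1 : s <= Rmin 1 rho) by apply Rmin_l. assert (S2 : s <= Rmin (Rmin d0 (/ (2 * cm))) (Rmin e1 e2)) by apply Rmin_r.
  assert (S3 := Rmin_l 1 rho). assert (S4 := Rmin_r 1 rho).
  assert (S5 := Rmin_l (Rmin d0 (/ (2 * cm))) (Rmin e1 e2)). assert (S6 := Rmin_r (Rmin d0 (/ (2 * cm))) (Rmin e1 e2)).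
  assert (S7 := Rmin_l d0 (/ (2 * cm))). assert (S8 := Rmin_r d0 (/ (2 * cm))).
  assert (S9 := Rmin_l e1 e2). assert (S10 := Rmin_r e1 e2).
  split. unfold s. repeat apply Rmin_pos; auto; lra.
  repeat split; try lra.
  - apply Rle_trans with (2 * cm * / (2 * cm)). apply Rmult_le_compat_l; lra. rewrite Rinv_r; lra.
  - apply Q1. lra.
  - apply Q2. lra.
Qed.

Section Radius.
Variables (e0 s : R).
Hypothesis s0 : 0 < s.
Hypothesis s1 : s <= 1.
Hypothesis srho : s <= rho.
Hypothesis sd : s <= d0.
Hypothesis sc : 2 * cm * s <= 1.
Hypothesis sh : forall t, Cmod t < s -> Cmod (hh t) < e0 /\ Cmod (hh t) < 1 / 2.

Lemma Y_bounds t : Cmod t < s -> cm * Cmod t ^ p / 2 <= Cmod (Y t) <= 2 * cm * Cmod t ^ p.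
Proof.
  intro H. rewrite HY by lra. rewrite !Cmod_mult, Cmod_pow. fold cm.
  destruct (sh t H) as [_ H2].
  assert (U : Cmod (RtoC 1 + hh t) <= 3 / 2).
  { eapply Rle_trans. apply Cmod_triangle. rewrite Cmod_1. lra. }
  assert (L : 1 / 2 <= Cmod (RtoC 1 + hh t)).
  { assert (Cmod (RtoC 1) <= Cmod (RtoC 1 + hh t) + Cmod (- hh t)).
    { replace (RtoC 1) with (RtoC 1 + hh t + - hh t)%C at 1 by ring. apply Cmod_triangle. }
    rewrite Cmod_1, Cmod_opp in H0. lra. }
  assert (0 <= Cmod t ^ p) by (apply pow_le, Cmod_ge_0). generalize cm_pos; intro.
  assert (0 <= cm * Cmod t ^ p) by (apply Rmult_le_pos; lra).
  split; nra.
Qed.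
Lemma Y_le_1 t : Cmod t < s -> Cmod (Y t) <= 1.
Proof.
  intro H. eapply Rle_trans. apply Y_bounds; auto. assert (T := Cmod_ge_0 t).
  assert (Cmod t ^ p <= s). { apply Rle_trans with (Cmod t ^ 1). apply pow_le_1. lra. lia. simpl. lra. }
  generalize cm_pos; intro. nra.
Qed.
Let fx t := evC (dxC f) (t ^ q)%C (Y t).
Let fy t := evC (dyC f) (t ^ q)%C (Y t).
(** On the branch f = 0, so the Bezout relation reduces to b f_y = rr (t^q), which is nonzero for t
    <> 0. *)
Lemma fy_nz t : 0 < Cmod t < s -> fy t <> RtoC 0.
Proof.
  intros [T0 T1] Z. unfold fy in Z. assert (F := Hf t ltac:(lra)). generalize (HBz (t ^ q)%C (Y t)).
  rewrite F, Z. intro R. apply (Hrr (t ^ q)%C).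
  - rewrite Cmod_pow. split. apply pow_lt; auto. apply Rle_lt_trans with (Cmod t ^ 1).
    apply pow_le_1. lra. lia. simpl. lra.
  - rewrite <- R. ring.
Qed.
(** dY/dX on the branch with X = t^q, by implicit differentiation; [slope2] is the second
    derivative. *)
Definition slope (t : C) : C := (- (fx t * / fy t))%C.
Definition slope2 (t : C) : C := (- (hess f (t ^ q)%C (Y t) * / (fy t * (fy t * fy t))))%C.
Let Xd t := (RtoC (INR q) * t ^ (q - 1))%C.

Lemma hol_ev e t : Cmod t < s -> exists l, hol (fun u => evC e (u ^ q)%C (Y u)) t l.
Proof.
  intro H. destruct (HYd t ltac:(lra)) as [l Hl]. eexists. apply hol_pexpr. apply hol_pow. apply Hl.
Qed.
Lemma hol_Y t : 0 < Cmod t < s -> hol Y t (Xd t * slope t)%C.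
Proof.
  intros H. destruct (HYd t ltac:(lra)) as [l Hl].
  assert (P := hol_pexpr f (fun u => (u ^ q)%C) Y t _ _ (hol_pow q t) Hl).
  apply hol_ext with (k := fun _ => RtoC 0) in P.
  2:{ exists (rho - Cmod t). split. lra. intros w Hw. apply Hf.
      replace w with (w - t + t)%C by ring. eapply Rle_lt_trans. apply Cmod_triangle. lra. }
  assert (Z := hol_unique _ _ _ _ P (hol_const (RtoC 0) t)). cbv beta in Z.
  fold (fx t) (fy t) in Z. fold (Xd t) in Z.
  assert (N := fy_nz t H).
  replace (Xd t * slope t)%C with l; auto.
  apply Cmult_reg_l with (fy t); auto. unfold slope.
  transitivity (fx t * Xd t + fy t * l - fx t * Xd t)%C. ring. rewrite Z. field. auto.
Qed.
Lemma hol_slope t : 0 < Cmod t < s -> hol slope t (Xd t * slope2 t)%C.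
Proof.
  intros H. assert (N := fy_nz t H). assert (HYt := hol_Y t H).
  assert (P1 := hol_pexpr (dxC f) (fun u => (u ^ q)%C) Y t _ _ (hol_pow q t) HYt).
  assert (P2 := hol_pexpr (dyC f) (fun u => (u ^ q)%C) Y t _ _ (hol_pow q t) HYt).
  assert (P3 := hol_inv fy t _ N P2).
  assert (P4 := hol_mult _ _ t _ _ (hol_const (RtoC (-1)) t) (hol_mult _ _ t _ _ P1 P3)).
  apply hol_ext with (k := slope) in P4.
  2:{ exists 1. split. lra. intros w _. unfold slope, fx, fy. ring. }
  match type of P4 with hol _ _ ?l => replace (Xd t * slope2 t)%C with l; [exact P4|] end.
  fold (Xd t). fold (fx t) (fy t). unfold slope2, slope, hess. rewrite evC_dxdy.
  fold (fx t) (fy t).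
  set (fxx := evC (dxC (dxC f)) (t ^ q)%C (Y t)). set (fxy := evC (dyC (dxC f)) (t ^ q)%C (Y t)).
  set (fyy := evC (dyC (dyC f)) (t ^ q)%C (Y t)). field. auto.
Qed.
Lemma slope_cont t : 0 < Cmod t < s -> ccont (fun u => (Xd u * slope u)%C) t.
Proof.
  intros H. eapply hol_ccont. apply hol_mult. 2: apply hol_slope; auto.
  apply (hol_mult (fun _ => RtoC (INR q)) (fun u => (u ^ (q - 1))%C)). apply hol_const. apply hol_pow.
Qed.
Lemma slope2_cont t : 0 < Cmod t < s -> ccont (fun u => (Xd u * slope2 u)%C) t.
Proof.
  intros H. destruct (is_pexpr_hess f) as [e He].
  destruct (hol_ev e t ltac:(lra)) as [l1 H1].
  destruct (hol_ev (dyC f) t ltac:(lra)) as [l2 H2]. fold fy in H2.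
  assert (H3 := hol_mult _ _ _ _ _ H2 (hol_mult _ _ _ _ _ H2 H2)).
  assert (N := fy_nz t H).
  assert (H4 := hol_inv (fun w => (fy w * (fy w * fy w))%C) t _ (Cmult_neq_0 _ _ N (Cmult_neq_0 _ _ N N)) H3).
  assert (H5 := hol_mult _ _ t _ _ (hol_const (RtoC (-1)) t) (hol_mult _ _ _ _ _ H1 H4)).
  apply hol_ext with (k := slope2) in H5.
  2:{ exists 1. split. lra. intros w _. unfold slope2. rewrite <- He. ring. }
  eapply hol_ccont. apply hol_mult. 2: exact H5.
  apply (hol_mult (fun _ => RtoC (INR q)) (fun u => (u ^ (q - 1))%C)). apply hol_const. apply hol_pow.
Qed.

Lemma in_annulus (t u : C) r : 0 < Cmod t < r -> Cmod (u - t) < Cmod t -> 0 < Cmod u < 2 * r.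
Proof.
  intros [H1 H2] H. split.
  - assert (Cmod t <= Cmod (t - u) + Cmod u).
    { replace t with (t - u + u)%C at 1 by ring. apply Cmod_triangle. }
    rewrite Cmod_sym in H0. lra.
  - replace u with (u - t + t)%C by ring. eapply Rle_lt_trans. apply Cmod_triangle. lra.
Qed.
Lemma INR_q_ge_1 : 1 <= INR q.
Proof. change 1 with (INR 1). apply le_INR. lia. Qed.
Definition slope_const : R := 4 * cm * 2 ^ p.
(** Cauchy's estimate for Y on the circle of radius |t|/2 around t, inside a disc that omits the
    origin; dY/dt = q t^(q-1) slope converts it. In 4 cm 2^p, 2 cm comes from [Y_bounds], 2^p from
    |u| <= 2|t| and 2 from the radius. *)
Lemma slope_bound t : 0 < Cmod t < s / 2 -> Cmod (slope t) <= slope_const * Cmod t ^ (p - q).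
Proof.
  intros H. assert (T0 : 0 < Cmod t) by tauto.
  assert (X := cauchy_estimate Y (fun u => (Xd u * slope u)%C) t (Cmod t) (Cmod t / 2) (2 * cm * (2 * Cmod t) ^ p)).
  assert (Z : Cmod (Xd t * slope t) * (Cmod t / 2) <= 2 * cm * (2 * Cmod t) ^ p).
  { apply X.
    - intros u Hu. apply hol_Y. replace s with (2 * (s / 2)) by field. eapply in_annulus; eauto.
    - intros u Hu. apply slope_cont. replace s with (2 * (s / 2)) by field. eapply in_annulus; eauto.
    - lra.
    - intros u Hu. assert (Hu' : Cmod (u - t) < Cmod t) by lra.
      assert (I := in_annulus t u _ H Hu'). eapply Rle_trans. apply Y_bounds. lra.
      apply Rmult_le_compat_l. generalize cm_pos; lra. apply pow_incr. split. lra.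
      replace u with (u - t + t)%C by ring. eapply Rle_trans. apply Cmod_triangle. lra. }
  unfold Xd in Z. rewrite !Cmod_mult, Cmod_R, Cmod_pow, Rabs_pos_eq in Z by (generalize INR_q_ge_1; lra).
  rewrite Rpow_mult_distr in Z.
  assert (E1 : Cmod t ^ (q - 1) * Cmod t = Cmod t ^ q). { replace q with (S (q - 1)) at 2 by lia. simpl. ring. }
  assert (E2 : Cmod t ^ p = Cmod t ^ q * Cmod t ^ (p - q)). { rewrite <- pow_add. f_equal. lia. }
  assert (P : 0 < Cmod t ^ q) by (apply pow_lt; auto).
  apply Rmult_le_reg_l with (Cmod t ^ q); auto.
  apply Rle_trans with (INR q * (Cmod t ^ q * Cmod (slope t))).
  { rewrite <- (Rmult_1_l (Cmod t ^ q * Cmod (slope t))) at 1. apply Rmult_le_compat_r.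
    apply Rmult_le_pos. lra. apply Cmod_ge_0. apply INR_q_ge_1. }
  rewrite <- E1 at 1. unfold slope_const. rewrite E2 in Z. lra.
Qed.
Definition slope2_const : R := 2 * slope_const * 2 ^ (p - q).
Lemma slope_const_ge_0 : 0 <= slope_const.
Proof. unfold slope_const. generalize cm_pos; intro. assert (0 < 2 ^ p) by (apply pow_lt; lra). nra. Qed.
(** The same estimate applied to the slope; each use halves the admissible radius. *)
Lemma slope2_bound t : 0 < Cmod t < s / 4 -> Cmod (slope2 t) * Cmod t ^ (2 * q) <= slope2_const * Cmod t ^ p.
Proof.
  intros H. assert (T0 : 0 < Cmod t) by tauto.
  assert (X := cauchy_estimate slope (fun u => (Xd u * slope2 u)%C) t (Cmod t) (Cmod t / 2) (slope_const * (2 * Cmod t) ^ (p - q))).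
  assert (An : forall u, Cmod (u - t) < Cmod t -> 0 < Cmod u < s / 2).
  { intros u Hu. replace (s / 2) with (2 * (s / 4)) by field. eapply in_annulus; eauto. }
  assert (Z : Cmod (Xd t * slope2 t) * (Cmod t / 2) <= slope_const * (2 * Cmod t) ^ (p - q)).
  { apply X.
    - intros u Hu. apply hol_slope. specialize (An u Hu). lra.
    - intros u Hu. apply slope2_cont. specialize (An u Hu). lra.
    - lra.
    - intros u Hu. assert (Hu' : Cmod (u - t) < Cmod t) by lra. specialize (An u Hu').
      eapply Rle_trans. apply slope_bound; auto.
      apply Rmult_le_compat_l. apply slope_const_ge_0. apply pow_incr. split. lra.
      replace u with (u - t + t)%C by ring. eapply Rle_trans. apply Cmod_triangle. lra. }
  unfold Xd in Z. rewrite !Cmod_mult, Cmod_R, Cmod_pow, Rabs_pos_eq in Z by (generalize INR_q_ge_1; lra).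
  rewrite Rpow_mult_distr in Z.
  assert (E1 : Cmod t ^ (q - 1) * Cmod t = Cmod t ^ q). { replace q with (S (q - 1)) at 2 by lia. simpl. ring. }
  assert (E2 : Cmod t ^ p = Cmod t ^ q * Cmod t ^ (p - q)). { rewrite <- pow_add. f_equal. lia. }
  assert (E3 : Cmod t ^ (2 * q) = Cmod t ^ q * Cmod t ^ q). { rewrite <- pow_add. f_equal. lia. }
  assert (P : 0 < Cmod t ^ q) by (apply pow_lt; auto).
  rewrite E2, E3.
  assert (Cmod t ^ q * Cmod (slope2 t) <= slope2_const * Cmod t ^ (p - q)).
  { apply Rle_trans with (INR q * (Cmod t ^ q * Cmod (slope2 t))).
    { rewrite <- (Rmult_1_l (Cmod t ^ q * Cmod (slope2 t))) at 1. apply Rmult_le_compat_r.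
      apply Rmult_le_pos. lra. apply Cmod_ge_0. apply INR_q_ge_1. }
    rewrite <- E1 at 1. unfold slope2_const. lra. }
  replace (Cmod (slope2 t) * (Cmod t ^ q * Cmod t ^ q)) with (Cmod t ^ q * (Cmod t ^ q * Cmod (slope2 t))) by ring.
  replace (slope2_const * (Cmod t ^ q * Cmod t ^ (p - q))) with (Cmod t ^ q * (slope2_const * Cmod t ^ (p - q))) by ring.
  apply Rmult_le_compat_l; lra.
Qed.

(** A bound for |qform| / |f_y|^2; through K^2 = kap qform^3 it makes [K0] a bound for |K| /
    |f_y|^3. *)
Definition S0 : R := Cmod A * slope_const ^ 2 + Cmod B * slope_const + Cmod E.
Definition K0 : R := sqrt (Cmod kap * S0 ^ 3).
Let Dt t := evC (Nat.iter k dyC g) (t ^ q)%C (Y t).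
Lemma S0_pos : 0 <= S0.
Proof.
  unfold S0. generalize (Cmod_ge_0 A) (Cmod_ge_0 B) (Cmod_ge_0 E) slope_const_ge_0. intros.
  assert (0 <= Cmod A * slope_const ^ 2) by (apply Rmult_le_pos; auto; apply pow_le; auto).
  assert (0 <= Cmod B * slope_const) by (apply Rmult_le_pos; auto). lra.
Qed.
Lemma K0_sq : 0 <= K0 /\ K0 ^ 2 = Cmod kap * S0 ^ 3.
Proof.
  split. apply sqrt_pos. unfold K0. apply pow2_sqrt. apply Rmult_le_pos. apply Cmod_ge_0.
  apply pow_le, S0_pos.
Qed.
(** Writing H = - slope2 f_y^3 and |K| <= K0 |f_y|^3, both sides of the relation carry |f_y|^(9k),
    which cancels; the size of f_y near t = 0 is never estimated. *)
Lemma relation_bound t : 0 < Cmod t < s / 4 ->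
  Cmod c1 * Cmod (slope2 t) ^ (2 * k) <= Cmod (Dt t) ^ 3 * (2 * Cmod re * Cmod (slope2 t) + K0) ^ (3 * k).
Proof.
  intros H. assert (N := fy_nz t ltac:(lra)).
  destruct (Hrel t ltac:(lra)) as [K [HK R]]. fold (Dt t) in R. fold (fy t) in R.
  assert (Hm : Cmod (slope t) <= slope_const).
  { eapply Rle_trans. apply slope_bound; lra. rewrite <- (Rmult_1_r slope_const) at 2. apply Rmult_le_compat_l. apply slope_const_ge_0.
    rewrite <- (pow1 (p - q)). apply pow_incr. lra. }
  set (F := Cmod (fy t)). assert (F0 : 0 < F) by (apply Cmod_gt_0; auto).
  assert (Ex : fx t = (- slope t * fy t)%C) by (unfold slope; field; auto).
  assert (EH : hess f (t ^ q)%C (Y t) = (- slope2 t * fy t ^ 3)%C) by (unfold slope2; field; auto).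
  set (y := Cmod (slope2 t)) in *. assert (y0 : 0 <= y) by apply Cmod_ge_0.
  assert (MH : Cmod (hess f (t ^ q)%C (Y t)) = y * F ^ 3).
  { rewrite EH, Cmod_mult, Cmod_opp, Cmod_pow. auto. }
  assert (MS : Cmod (qform A B E f (t ^ q)%C (Y t)) <= S0 * F ^ 2).
  { unfold qform. fold (fx t) (fy t). rewrite Ex.
    replace (_ + _)%C with ((A * slope t ^ 2 + - (B * slope t) + E) * fy t ^ 2)%C by ring.
    rewrite Cmod_mult, Cmod_pow. fold F. apply Rmult_le_compat_r. apply pow_le; lra.
    eapply Rle_trans. apply Cmod_triangle. apply Rplus_le_compat_r.
    eapply Rle_trans. apply Cmod_triangle. rewrite Cmod_opp, !Cmod_mult, Cmod_pow.
    apply Rplus_le_compat; apply Rmult_le_compat_l; auto using Cmod_ge_0. apply pow_incr. split; auto using Cmod_ge_0. }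
  assert (MK : Cmod K <= K0 * F ^ 3).
  { destruct K0_sq as [K1 K2]. apply Rsqr_incr_0_var.
    2: apply Rmult_le_pos; auto; apply pow_le; lra.
    rewrite !Rsqr_pow2, Rpow_mult_distr, K2.
    assert (T : Cmod K ^ 2 = Cmod kap * Cmod (qform A B E f (t ^ q)%C (Y t)) ^ 3).
    { rewrite <- !Cmod_pow, <- Cmod_mult, <- HK. f_equal. ring. }
    rewrite T. rewrite Rmult_assoc. apply Rmult_le_compat_l. apply Cmod_ge_0.
    replace (S0 ^ 3 * (F ^ 3) ^ 2) with ((S0 * F ^ 2) ^ 3) by ring.
    apply pow_incr. split; auto using Cmod_ge_0. }
  apply (f_equal Cmod) in R. rewrite !Cmod_mult, !Cmod_pow, MH in R. fold F in R.
  set (M1 := Cmod (RtoC 2 * re * hess f (t ^ q)%C (Y t) + RtoC (-1) * K)) in *.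
  set (M2 := Cmod (re * hess f (t ^ q)%C (Y t) + RtoC (-1) * K)) in *.
  set (w := 2 * Cmod re * y + K0).
  assert (re0 : 0 <= Cmod re) by apply Cmod_ge_0.
  assert (F3 : 0 < F ^ 3) by (apply pow_lt; auto).
  assert (B1 : 0 <= M1 <= w * F ^ 3).
  { split. apply Cmod_ge_0. unfold M1. eapply Rle_trans. apply Cmod_triangle.
    rewrite !Cmod_mult, MH, !Cmod_R. rewrite (Rabs_pos_eq 2), (Rabs_left1 (-1)) by lra. unfold w. nra. }
  assert (B2 : 0 <= M2 <= w * F ^ 3).
  { split. apply Cmod_ge_0. unfold M2. eapply Rle_trans. apply Cmod_triangle.
    rewrite !Cmod_mult, MH, !Cmod_R. rewrite (Rabs_left1 (-1)) by lra. unfold w.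
    assert (0 <= Cmod re * y) by (apply Rmult_le_pos; auto). nra. }
  assert (Bound : M1 ^ (2 * k) * M2 ^ k <= (w * F ^ 3) ^ (3 * k)).
  { replace (3 * k)%nat with (2 * k + k)%nat by lia. rewrite pow_add.
    apply Rmult_le_compat; try apply pow_le; try lra; apply pow_incr; auto. }
  apply Rmult_le_reg_r with (F ^ (9 * k)). apply pow_lt; auto.
  apply Rle_trans with (Cmod (Dt t) ^ 3 * (w * F ^ 3) ^ (3 * k)).
  - assert (Q : Cmod c1 * y ^ (2 * k) * F ^ (9 * k) = Cmod c1 * ((y * F ^ 3) ^ (2 * k) * F ^ (3 * k))).
    { rewrite Rpow_mult_distr, <- pow_mult. replace (9 * k)%nat with (3 * (2 * k) + 3 * k)%nat by lia. rewrite pow_add. ring. }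
    rewrite Q, <- R. apply Rmult_le_compat_l. apply pow_le, Cmod_ge_0. exact Bound.
  - right. rewrite Rpow_mult_distr, <- pow_mult. replace (3 * (3 * k))%nat with (9 * k)%nat by lia. unfold w. ring.
Qed.
End Radius.

(** [Y t] and [Y (z t)], with [z] a [q]-th root of unity, are distinct roots of multiplicity [k]
    above the same abscissa [t ^ q], at distance [O(t ^ p)]. *)
Lemma top_derivative_bound : exists Bd s, 0 <= Bd /\ 0 < s /\ forall t : R, 0 < t < s ->
  Cmod (evC (Nat.iter k dyC g) (RtoC t ^ q)%C (Y (RtoC t))) <= Bd * t ^ (p * k).
Proof.
  destruct (root_of_unity q p Hqp Hp) as [z [Z1 [Z2 Z3]]].
  assert (N : (RtoC 1 - z ^ p)%C <> RtoC 0) by (apply Cminus_nz; auto).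
  apply Cmod_gt_0 in N. set (k0 := Cmod (RtoC 1 - z ^ p)) in *.
  (* Two perturbations [hh] below k0/4 cannot compensate 1 - z^p, so the two roots are distinct. *)
  destruct (good_radius (k0 / 4) ltac:(lra)) as [s [P1 [P2 [P3 [P4 [P5 P6]]]]]].
  destruct (PolyC.double_root_bound g k) as [K HK].
  generalize cm_pos; intro C0.
  exists (Rabs K * (4 * cm) ^ k), s. split. apply Rmult_le_pos. apply Rabs_pos. apply pow_le; lra.
  split; auto. intros t [T0 T1].
  assert (Mt : Cmod (RtoC t) = t) by (rewrite Cmod_R; apply Rabs_pos_eq; lra).
  assert (Mz : Cmod (z * RtoC t) = t) by (rewrite Cmod_mult, Z1, Mt; ring).
  assert (Ht : Cmod (RtoC t) < s) by lra. assert (Hz : Cmod (z * RtoC t) < s) by lra.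
  assert (Eq : ((z * RtoC t) ^ q)%C = (RtoC t ^ q)%C) by (rewrite Cpow_mult_l, Z2; ring).
  set (y1 := Y (RtoC t)). set (y2 := Y (z * RtoC t)%C).
  assert (Ne : y1 <> y2).
  { intro Ey. unfold y1, y2 in Ey. rewrite !HY in Ey by lra. rewrite Cpow_mult_l in Ey.
    apply Cmult_reg_l in Ey; auto.
    assert (Ey' : (RtoC 1 + hh (RtoC t))%C = (z ^ p * (RtoC 1 + hh (z * RtoC t)%C))%C).
    { apply Cmult_reg_l with (RtoC t ^ p)%C. apply Cpow_nz, RtoC_nz; lra. rewrite Ey. ring. }
    assert (E0 : (RtoC 1 - z ^ p)%C = (z ^ p * hh (z * RtoC t)%C + - hh (RtoC t))%C).
    { transitivity (RtoC 1 + hh (RtoC t) - z ^ p - hh (RtoC t))%C. ring. rewrite Ey'. ring. }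
    apply (f_equal Cmod) in E0. fold k0 in E0.
    assert (L := Cmod_triangle (z ^ p * hh (z * RtoC t)%C)%C (- hh (RtoC t))%C).
    rewrite <- E0, Cmod_opp, Cmod_mult, Cmod_pow, Z1, pow1 in L.
    destruct (P6 _ Ht) as [h1 _]. destruct (P6 _ Hz) as [h2 _]. lra. }
  assert (B1 := Y_bounds (k0/4) s P3 P6 (RtoC t) Ht). rewrite Mt in B1. fold y1 in B1.
  assert (B2 := Y_bounds (k0/4) s P3 P6 (z * RtoC t)%C Hz). rewrite Mz in B2. fold y2 in B2.
  assert (Df : Cmod (y1 - y2) <= 4 * cm * t ^ p).
  { eapply Rle_trans. apply Cmod_triangle. rewrite Cmod_opp. lra. }
  eapply Rle_trans. apply (HK (RtoC t ^ q)%C y1 y2); auto.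
  - rewrite Cmod_pow, Mt, <- (pow1 q). apply pow_incr; lra.
  - apply (Y_le_1 (k0/4) s); auto.
  - apply (Y_le_1 (k0/4) s); auto.
  - intros i Hi. apply (Hg i Hi (RtoC t)). lra.
  - intros i Hi. rewrite <- Eq. apply (Hg i Hi (z * RtoC t)%C). lra.
  - apply Rle_trans with (Rabs K * Cmod (y1 - y2) ^ k).
    apply Rmult_le_compat_r. apply pow_le, Cmod_ge_0. apply Rle_abs.
    rewrite Rmult_assoc. apply Rmult_le_compat_l. apply Rabs_pos.
    rewrite pow_mult, <- Rpow_mult_distr. apply pow_incr. split; auto using Cmod_ge_0.
Qed.

Lemma branch_contradiction : False.
Proof.
  destruct (good_radius 1 ltac:(lra)) as [s [P1 [P2 [P3 [P4 [P5 P6]]]]]].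
  destruct top_derivative_bound as [Bd [s' [Bd0 [s'0 HD]]]].
  assert (C0 := cm_pos).
  assert (Mt : forall t, 0 < t -> Cmod (RtoC t) = t) by (intros; rewrite Cmod_R; apply Rabs_pos_eq; lra).
  assert (INR_q_ge_1' : 1 <= INR q) by apply INR_q_ge_1.
  (* Real t > 0 suffice. If |slope2| <= 1 near 0, two integrations make Y too small; otherwise the
     relation is contradicted at some small t with |slope2| > 1. *)
  destruct (classic (exists e, 0 < e /\ forall t, 0 < t < e -> Cmod (slope2 (RtoC t)) <= 1)) as [[e [e0 He]]|N].
  - set (e1 := Rmin (e / 2) (s / 4)).
    assert (E0 : 0 < e1) by (apply Rmin_pos; lra).
    assert (E1 : e1 <= e / 2) by apply Rmin_l. assert (E2 : e1 <= s / 4) by apply Rmin_r.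
    (* Each integration brings a factor q from dX/dt and a factor 2 from [cder_bound_at_0]; the
       second 2 is kept outside [al]. *)
    set (al := INR q * (2 * INR q)). assert (al0 : 0 < al) by (unfold al; nra).
    assert (Rd : forall t, 0 < t < s -> Cmod (RtoC t) < s) by (intros; rewrite Mt; lra).
    assert (Pth : forall t : R, cder (fun u => RtoC u) t (RtoC 1)) by (intro t; apply cder_RtoC, is_derive_Rid).
    assert (Xm : forall t, 0 < t -> Cmod (RtoC (INR q) * RtoC t ^ (q - 1)) = INR q * t ^ (q - 1)).
    { intros t Ht. rewrite Cmod_mult, Cmod_R, Cmod_pow, Mt, Rabs_pos_eq by lra. auto. }
    assert (Sl : forall t, 0 < t < e1 -> Cmod (slope (RtoC t)) <= 2 * INR q * t ^ q).
    { intros t Ht.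
      assert (Tq : t ^ q = t ^ (q - 1) * t). { replace q with (S (q - 1)) at 1 by lia. simpl. ring. }
      replace (2 * INR q * t ^ q) with (2 * (INR q * t ^ (q - 1)) * t) by (rewrite Tq; ring).
      apply (cder_bound_at_0 (fun w => slope (RtoC w)) (fun w => (RtoC (INR q) * RtoC w ^ (q - 1) * slope2 (RtoC w) * RtoC 1)%C) t slope_const).
      apply slope_const_ge_0. lra.
      - intros u Hu. eapply Rle_trans. apply (slope_bound 1 s); auto. rewrite Mt; lra. rewrite Mt by lra.
        apply Rmult_le_compat_l. apply slope_const_ge_0. apply Rle_trans with (u ^ 1). apply pow_le_1. lra. lia. simpl; lra.
      - intros w Hw. apply cder_hol_comp. 2: apply Pth. apply (hol_slope s); auto. rewrite Mt; lra.
      - intros w Hw. rewrite Cmult_1_r, Cmod_mult, Xm by lra.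
        assert (Cmod (slope2 (RtoC w)) <= 1) by (apply He; lra).
        assert (w ^ (q - 1) <= t ^ (q - 1)) by (apply pow_incr; lra).
        assert (0 <= w ^ (q - 1)) by (apply pow_le; lra).
        apply Rle_trans with (INR q * w ^ (q - 1) * 1). apply Rmult_le_compat_l; auto. apply Rmult_le_pos; lra.
        rewrite Rmult_1_r. apply Rmult_le_compat_l; lra. }
    assert (Yl : forall t, 0 < t < e1 -> Cmod (Y (RtoC t)) <= 2 * al * t ^ (2 * q)).
    { intros t Ht.
      assert (Tq : t ^ (2 * q) = t ^ (2 * q - 1) * t). { replace (2 * q)%nat with (S (2 * q - 1)) at 1 by lia. simpl. ring. }
      replace (2 * al * t ^ (2 * q)) with (2 * (al * t ^ (2 * q - 1)) * t) by (rewrite Tq; ring).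
      apply (cder_bound_at_0 (fun w => Y (RtoC w)) (fun w => (RtoC (INR q) * RtoC w ^ (q - 1) * slope (RtoC w) * RtoC 1)%C) t (2 * cm)).
      lra. lra.
      - intros u Hu. eapply Rle_trans. apply (Y_bounds 1 s); auto. apply Rd; lra. rewrite Mt by lra.
        apply Rmult_le_compat_l. lra. apply Rle_trans with (u ^ 1). apply pow_le_1. lra. lia. simpl; lra.
      - intros w Hw. apply cder_hol_comp. 2: apply Pth. apply (hol_Y s); auto. rewrite Mt; lra.
      - intros w Hw. rewrite Cmult_1_r, Cmod_mult, Xm by lra.
        assert (S1 := Sl w ltac:(lra)).
        assert (0 <= w ^ (q - 1)) by (apply pow_le; lra).
        apply Rle_trans with (INR q * w ^ (q - 1) * (2 * INR q * w ^ q)). apply Rmult_le_compat_l; auto. apply Rmult_le_pos; lra.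
        replace (INR q * w ^ (q - 1) * (2 * INR q * w ^ q)) with (al * (w ^ (q - 1) * w ^ q)) by (unfold al; ring).
        rewrite <- pow_add. replace (q - 1 + q)%nat with (2 * q - 1)%nat by lia.
        apply Rmult_le_compat_l. lra. apply pow_incr; lra. }
    set (t := Rmin (e1 / 2) (cm / (8 * al))).
    assert (T0 : 0 < t) by (apply Rmin_pos; [lra|apply Rdiv_lt_0_compat; lra]).
    assert (T1 : t <= e1 / 2) by apply Rmin_l. assert (T2 : t <= cm / (8 * al)) by apply Rmin_r.
    assert (T3 : t * (8 * al) <= cm).
    { apply Rle_trans with (cm / (8 * al) * (8 * al)). apply Rmult_le_compat_r; lra. right; field; lra. }
    assert (U := Yl t ltac:(lra)).
    destruct (Y_bounds 1 s P3 P6 (RtoC t) (Rd t ltac:(lra))) as [V _]. rewrite Mt in V by auto.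
    (* Since p + 1 <= 2q, the upper bound for Y falls below its lower bound for small t. *)
    assert (W : t ^ (2 * q) <= t ^ p * t).
    { replace (t ^ p * t) with (t ^ (p + 1)). apply pow_le_1. lra. lia. rewrite pow_add. simpl. ring. }
    assert (Pp : 0 < t ^ p) by (apply pow_lt; auto). nra.
  (* [K1] absorbs the constant term: where y = |slope2| > 1 one has 2 |re| y + K0 <= K1 y. *)
  - set (K1 := 2 * Cmod re + K0).
    destruct K0_sq as [K00 _]. assert (re0 := Cmod_ge_0 re).
    assert (c1p : 0 < Cmod c1) by (apply Cmod_gt_0; auto).
    set (c3 := Bd ^ 3 * K1 ^ (3 * k) * slope2_const ^ k).
    assert (Ay0 : 0 <= slope2_const). { unfold slope2_const. assert (A0 := slope_const_ge_0). assert (0 < 2 ^ (p - q)) by (apply pow_lt; lra). nra. }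
    assert (c30 : 0 <= c3).
    { unfold c3. apply Rmult_le_pos; [apply Rmult_le_pos|]; apply pow_le; auto. unfold K1; lra. }
    set (e := Rmin (Rmin (s / 4) s') (Cmod c1 / (2 * (c3 + 1)))).
    assert (e0 : 0 < e) by (repeat apply Rmin_pos; try lra; apply Rdiv_lt_0_compat; lra).
    assert (E1 : e <= s / 4) by (unfold e; eapply Rle_trans; [apply Rmin_l|apply Rmin_l]).
    assert (E2 : e <= s') by (unfold e; eapply Rle_trans; [apply Rmin_l|apply Rmin_r]).
    assert (E3 : e <= Cmod c1 / (2 * (c3 + 1))) by apply Rmin_r.
    apply N. exists e. split; auto. intros t Ht. apply Rnot_lt_le. intro Lt.
    assert (Mtt := Mt t (proj1 Ht)).
    assert (Rb := relation_bound 1 s P1 P2 P3 P4 P6 (RtoC t) ltac:(rewrite Mtt; lra)).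
    assert (Sb := slope2_bound 1 s P2 P3 P4 P6 (RtoC t) ltac:(rewrite Mtt; lra)).
    rewrite Mtt in Sb. specialize (HD t ltac:(lra)).
    set (y := Cmod (slope2 (RtoC t))) in *. set (Dd := Cmod (evC (Nat.iter k dyC g) (RtoC t ^ q)%C (Y (RtoC t)))) in *.
    assert (D0 : 0 <= Dd) by apply Cmod_ge_0.
    assert (Q1 : (2 * Cmod re * y + K0) ^ (3 * k) <= (K1 * y) ^ (3 * k)).
    { apply pow_incr. unfold K1. split. nra. nra. }
    assert (Q2 : Cmod c1 * y ^ (2 * k) <= Dd ^ 3 * (K1 ^ (3 * k) * (y ^ (2 * k) * y ^ k))).
    { eapply Rle_trans. apply Rb. apply Rmult_le_compat_l. apply pow_le; auto.
      eapply Rle_trans. apply Q1. rewrite Rpow_mult_distr. replace (3 * k)%nat with (2 * k + k)%nat at 2 by lia. rewrite pow_add. lra. }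
    assert (yk : 0 < y ^ (2 * k)) by (apply pow_lt; lra).
    assert (Q3 : Cmod c1 <= Dd ^ 3 * (K1 ^ (3 * k) * y ^ k)).
    { apply Rmult_le_reg_r with (y ^ (2 * k)); auto. lra. }
    assert (Q4 : Dd ^ 3 <= Bd ^ 3 * t ^ (3 * (p * k))).
    { replace (t ^ (3 * (p * k))) with ((t ^ (p * k)) ^ 3). rewrite <- Rpow_mult_distr. apply pow_incr. split; auto.
      rewrite <- pow_mult. f_equal. lia. }
    assert (Q5 : y ^ k * t ^ (2 * q * k) <= slope2_const ^ k * t ^ (p * k)).
    { rewrite !pow_mult. rewrite <- (pow_mult t 2 q), <- !Rpow_mult_distr. apply pow_incr. split; auto.
      apply Rmult_le_pos. lra. apply pow_le; lra. }
    assert (tp : 0 < t ^ (2 * q * k)) by (apply pow_lt; lra).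
    assert (K1k : 0 <= K1 ^ (3 * k)) by (apply pow_le; unfold K1; lra).
    assert (Q6 : Cmod c1 * t ^ (2 * q * k) <= c3 * t ^ (4 * (p * k))).
    { apply Rle_trans with (Dd ^ 3 * (K1 ^ (3 * k) * (y ^ k * t ^ (2 * q * k)))).
      - rewrite <- !Rmult_assoc. apply Rmult_le_compat_r. lra. rewrite Rmult_assoc. auto.
      - apply Rle_trans with ((Bd ^ 3 * t ^ (3 * (p * k))) * (K1 ^ (3 * k) * (slope2_const ^ k * t ^ (p * k)))).
        + apply Rmult_le_compat; auto. apply pow_le; auto.
          apply Rmult_le_pos; auto. apply Rmult_le_pos. apply pow_le; lra. lra.
          apply Rmult_le_compat_l; auto.
        + right. unfold c3. replace (4 * (p * k))%nat with (3 * (p * k) + p * k)%nat by lia. rewrite pow_add. ring. }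
    (* The exponents satisfy 2qk + 1 <= 4pk because q < p and k >= 1. *)
    assert (Q7 : t ^ (4 * (p * k)) <= t ^ (2 * q * k) * t).
    { replace (t ^ (2 * q * k) * t) with (t ^ (2 * q * k + 1)). apply pow_le_1. lra. nia. rewrite pow_add. simpl. ring. }
    assert (Q8 : Cmod c1 <= c3 * t).
    { apply Rmult_le_reg_r with (t ^ (2 * q * k)); auto. eapply Rle_trans. apply Q6.
      replace (c3 * t * t ^ (2 * q * k)) with (c3 * (t ^ (2 * q * k) * t)) by ring. apply Rmult_le_compat_l; auto. }
    assert (Q9 : t * (2 * (c3 + 1)) <= Cmod c1).
    { apply Rle_trans with (Cmod c1 / (2 * (c3 + 1)) * (2 * (c3 + 1))). apply Rmult_le_compat_r; lra. right; field; lra. }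
    nra.
Qed.
End Branch.

Theorem theorem5p2
  (O : pt -> Prop) (g : R -> pt) (L beta : R)
  (N : nat) (a1 a2 : nat -> nat -> pt -> R) :
  smooth_simple_closed_arclength g L ->
  convex_domain_bounded_by O g ->
  0 < beta ->
  (forall s, beta < curvature g s) ->
  polynomial_integral beta g O N a1 a2 ->
  nonconstant_pair O N a1 a2 ->
  forall (sgn : R), (sgn = 1 \/ sgn = -1) ->
  forall (Q : cpt) (phi : C -> cpt) (q p : nat),
    puiseux_branch (zariski_closure (curve_image (parallel_curve g (sgn * / beta)))) Q phi q p ->
    (2 * q <= p)%nat.
Proof.
  intros Hsm Hdom Hb Hk Hpi Hnc sgn Hsgn Q phi q p
    [Hq [Hqp [rho [rho0 [Hphi [m11 [m12 [m21 [m22 [c [h [Dl0 [c0 [Hpar Hh]]]]]]]]]]]]]].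
  apply Nat.nlt_ge. intro Hp.
  destruct (parallel_relation O g L beta N a1 a2 Hsm Hdom Hb Hk Hpi Hnc sgn Hsgn)
    as [G [k [K0 [Hk1 [K00 [Gnz [HV HW]]]]]]].
  set (z1 := fun s => fst (g s)) in *. set (z2 := fun s => snd (g s)) in *.
  set (t1 := fun s => fst (d1 g s)) in *. set (t2 := fun s => snd (d1 g s)) in *.
  assert (Fr : frame z1 z2 t1 t2 (curvature g)) by (apply frame_of_curve with L; auto).
  assert (r0 : 0 < / beta) by (apply Rinv_0_lt_compat; auto).
  assert (Hlam : forall s, lam (curvature g) (/ beta) sgn s <> 0).
  { intro s. apply lam_nz; auto. intro u. rewrite <- (Rinv_l beta) by lra. apply Rmult_lt_compat_l; auto. }
  assert (sgn2 : sgn * sgn = 1) by (destruct Hsgn; subst; lra).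
  (* The parallel curve in the coordinates in which the branch has its Puiseux form. *)
  set (Z := fun x y => exists s, x = Xc m11 m12 (fst Q) (snd Q) (RtoC (par1 z1 t2 (/ beta) sgn s)) (RtoC (par2 z2 t1 (/ beta) sgn s)) /\
      y = Yc m21 m22 (fst Q) (snd Q) (RtoC (par1 z1 t2 (/ beta) sgn s)) (RtoC (par2 z2 t1 (/ beta) sgn s))).
  set (Y := fun t => Yc m21 m22 (fst Q) (snd Q) (fst (phi t)) (snd (phi t))).
  assert (Van : forall i, (i < k)%nat -> forall x y, Z x y -> evC (Nat.iter i dyC (tilde m11 m12 m21 m22 (fst Q) (snd Q) G)) x y = RtoC 0).
  { intros i Hi x y [s [-> ->]]. apply (tilde_vanishes_to_order z1 z2 t1 t2 (/ beta) sgn m11 m12 m21 m22 (fst Q) (snd Q) Dl0 k G HV i Hi s). }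
  (* Polynomial equations pass from the curve to its Zariski closure, hence to the branch, whose
     first coordinate is t^q. *)
  assert (Clo : forall t, Cmod t < rho -> forall e, (forall x y, Z x y -> evC e x y = RtoC 0) -> evC e (t ^ q)%C (Y t) = RtoC 0).
  { intros t Ht e He. destruct (Hphi t Ht) as [_ [_ HZ]]. destruct (Hpar t Ht) as [EX _].
    destruct (poly2_of_pexpr (psubst e
      (PA (PM (PC m11) (PA PX (PC (- fst Q)%C))) (PM (PC m12) (PA PY (PC (- snd Q)%C))))
      (PA (PM (PC m21) (PA PX (PC (- fst Q)%C))) (PM (PC m22) (PA PY (PC (- snd Q)%C)))))) as [P HP].
    assert (HPX : forall z, eval_poly2 P z = evC e (Xc m11 m12 (fst Q) (snd Q) (fst z) (snd z)) (Yc m21 m22 (fst Q) (snd Q) (fst z) (snd z))).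
    { intro z. rewrite HP, pev_psubst. reflexivity. }
    specialize (HZ P). rewrite HPX in HZ. unfold Xc at 1 in HZ. rewrite EX in HZ. apply HZ.
    intros w [s <-]. rewrite HPX. apply He. exists s. unfold embedC, parallel_curve, par1, par2, z1, z2, t1, t2. simpl.
    rewrite (Rmult_comm (/ beta) sgn). split; reflexivity. }
  (* A separable equation of the curve exists because the transformed G is nonzero and, as k >= 1,
     vanishes on [Z]. *)
  destruct (PolyC.separable_vanishing Z (tilde m11 m12 m21 m22 (fst Q) (snd Q) G))
    as [f [a [b [rr [Hf [HBz [d0 [d00 Hrr]]]]]]]].
  { apply tilde_zero_iff; auto. }
  { apply (Van 0%nat). lia. }
  destruct (curve_algebraic_relation z1 z2 t1 t2 (curvature g) (/ beta) sgn Fr sgn2 r0 Hlam m11 m12 m21 m22 (fst Q) (snd Q) Dl0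
     f G k K0 ltac:(intro s; apply Hf; exists s; split; reflexivity) HV K00 HW) as [c1 [c10 Hrel]].
  apply (branch_contradiction q p k rho Y h rr c f a b (tilde m11 m12 m21 m22 (fst Q) (snd Q) G)
    (qA m11 m12) (qB m11 m12 m21 m22) (qE m21 m22)
    (/ (m11 * m22 - m12 * m21) ^ 4)%C (RtoC (sgn * / beta)) c1 d0); auto.
  - intros t Ht. apply (Hpar t Ht).
  - intros t Ht. destruct (Hphi t Ht) as [[l1 H1] [[l2 H2] _]]. eexists.
    refine (hol_plus (fun u => (m21 * (fst (phi u) - fst Q))%C) (fun u => (m22 * (snd (phi u) - snd Q))%C) t _ _ _ _).
    + refine (hol_mult (fun _ => m21) (fun u => (fst (phi u) - fst Q)%C) t _ _ (hol_const m21 t) _).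
      exact (hol_plus (fun u => fst (phi u)) (fun _ => (- fst Q)%C) t _ _ H1 (hol_const _ t)).
    + refine (hol_mult (fun _ => m22) (fun u => (snd (phi u) - snd Q)%C) t _ _ (hol_const m22 t) _).
      exact (hol_plus (fun u => snd (phi u)) (fun _ => (- snd Q)%C) t _ _ H2 (hol_const _ t)).
  - intros t Ht. refine (relation_transfer Z _ _ f _ _ _ _ _ _ c1 k (Clo t Ht) _).
    intros x y [s [-> ->]]. exact (Hrel s).
Qed.
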